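(* Consider the principal–agent game described in the context, under the standing assumptions (A1) and (A2). Let $$u_P^D=\int_0^{\tau_A}e^{-\rho s}g(s)(\mu+(1-\mu)\theta)\,ds+e^{-\rho\tau_A}(1-G(\tau_A))\mu$$ be the principal's payoff from delegating authority over the search and the action to the agent. Call the conflict of interest severe if $u_P^D<\theta$, and mild otherwise. If the conflict of interest is mild and the prior probability $\sigma$ of the manipulative agent is sufficiently high, then the principal's payoff from delegating authority to the agent is higher than her equilibrium payoff in the game (without delegation). Specifically, with a mild conflict of interest: (1) if $\sigma>\bar\sigma$, then $u_P^D$ is higher than the principal's payoff in any equilibrium of the game; (2) for some $\widetilde\sigma_D$ with $0<\widetilde\sigma_D<\bar\sigma$, if $\sigma\in(\widetilde\sigma_D,\bar\sigma)$, then $u_P^D$ is higher than the principal's payoff in the unique equilibrium of the game, which features beneficial search.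
   Context: Parameters and primitives. $\theta\in(0,1)$, $\beta\in(0,\theta)$, $\beta<\mu<\theta$, discount rate $\rho>0$, $\sigma\in(0,1)$. $G$ is a continuous CDF supported on $[0,\infty)$ with density $g$ and decreasing hazard rate $H_R(t)=g(t)/(1-G(t))$; $H_R(\infty)=\lim_{t\to\infty}H_R(t)$. Let $\phi_P=\frac{\rho\theta}{\mu(1-\theta)}$, $\phi_A=\frac{\rho\mu}{\beta(1-\mu)}$. Standing assumptions: (A1) $H_R(0)>\phi_P>H_R(\infty)$; (A2) $\phi_P>\phi_A$. $\tau_P\in(0,\infty)$ is the unique value with $H_R(\tau_P)=\phi_P$. Let $$\bar\sigma=1-\exp\Big\{-\int_0^{\tau_P}\frac{\mu(1-\theta)H_R(s)-\rho\theta}{\theta-\mu}ds\Big\}.$$ Let $u_A^{FB}(t)=\int_0^t e^{-\rho x}g(x)(\mu+(1-\mu)\beta)dx+e^{-\rho t}(1-G(t))\mu$. $\tau_A>\tau_P$ is the agent's optimal first-best search duration, i.e. the maximizer of $u_A^{FB}$, given as the unique value with $H_R(\tau_A)=\phi_A$. Interpretation. The risky action pays both players $\omega\in\{0,1\}$ with $\Pr(\omega=1)=\mu$; the safe action pays the principal $\theta$ and the agent $\beta$. Real news, revealing $\omega$ (''type-$\omega$ news''), arrives at a time with CDF $G$ independent of $\omega$. With probability $\sigma$ the agent is manipulative and can fake type-1 news at a time of his choice. The principal stops and chooses safe at a chosen time if no news has arrived; she chooses safe after type-0 news and, after type-1 news at time $t$, chooses risky with probability $a(t)$. Under delegation the agent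 waits for real news until $\tau_A$, follows it if it arrives, and otherwise selects risky at $\tau_A$. Strategies. For $i\in\{A,P\}$, the agent's faking time ($i=A$) and the principal's stopping time ($i=P$) are drawn from a probability measure on $[0,\infty]$ with $F_i(t)=\int_0^t f_i^*(s)\,ds+\sum_{m:\,t_m\le t}f_m$ for $t<\infty$, where $f_i^*\ge0$ is the density of the absolutely continuous part, $\{t_m\}$ is a countable set of atoms with probabilities $f_m>0$, and any remaining mass sits at $\infty$ (never). Write $f_i=f_i^*+\sum_m f_m\delta_{t_m}$; integrals over $[0,t]$ include atoms at the endpoints. ''$f_i(t)>0$'' means $f_i^*(t)>0$ or $t$ is an atom. The principal also chooses $a:[0,\infty)\to[0,1]$. Principal's payoff. $w_0^P(s)=(1-\mu)g(s)(1-\sigma F_A(s))$, $w_1^P(s)=\mu g(s)(1-\sigma F_A(s))+\sigma f_A(s)(1-G(s))$, $W^P_\phi(t)=(1-G(t))(1-\sigma F_A(t))$, and $$\mu_1(s)=\frac{\mu g(s)(1-\sigma F_A(s))+\mu\sigma f_A(s)(1-G(s))}{\mu g(s)(1-\sigma F_A(s))+\sigma f_A(s)(1-G(s))}$$ (so $\mu_1(s)=\mu$ at an atom $s$ of $F_A$). Then $$u_P(t)=\int_0^t e^{-\rho s}\{w_0^P(s)\theta+w_1^P(s)((1-a(s))\theta+a(s)\mu_1(s))\}ds+e^{-\rho t}W^P_\phi(t)\theta .$$ Agent's payoff. $w_0^A(s)=(1-\mu)g(s)(1-F_P(s))$, $w_1^A(s)=\mu g(s)(1-F_P(s))$, $w_S^A(s)=f_P(s)(1-G(s))$,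 $W^A_\phi(t)=(1-G(t))(1-F_P(t))$, and $$u_A(t)=\int_0^t e^{-\rho s}\{w_0^A(s)\beta+w_1^A(s)((1-a(s))\beta+a(s))+w_S^A(s)\beta\}ds+e^{-\rho t}W^A_\phi(t)((1-a(t))\beta+\mu a(t)).$$ At $t=\infty$ the last term of $u_P$ and $u_A$ is $0$. Equilibrium. $(a,F_P,F_A)$ is an equilibrium iff: (AIC) $f_A(t)>0\Rightarrow u_A(t)\ge u_A(t')$ for all $t,t'$; (PICa) for all $t\ge0$, $a(t)=1$ if $\mu_1(t)>\theta$, $a(t)\in[0,1]$ if $\mu_1(t)=\theta$, $a(t)=0$ if $\mu_1(t)<\theta$; (PICt) $f_P(t)>0\Rightarrow u_P(t)\ge u_P(t')$ for all $t,t'$. The principal's equilibrium payoff is the expectation of $u_P$ under $F_P$; the equilibrium has beneficial search if this payoff exceeds $\theta$.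
   Formalization: The case u_P^D = θ is excluded, since the strict comparison fails there; and in (2) the equilibrium is unique among equilibria with beneficial search, because no-search equilibria also exist just below σ̄; the payoff comparison is proved for every equilibrium. *)

(* Defs.v *)
From HB Require Import structures.
From mathcomp Require Import all_boot all_order all_algebra.
From mathcomp Require Import all_classical all_reals all_analysis.

Set Implicit Arguments.
Unset Strict Implicit.
Unset Printing Implicit Defensive.

Import Order.TTheory GRing.Theory Num.Theory.
Import numFieldNormedType.Exports.

Local Open Scope classical_set_scope.
Local Open Scope ring_scope.

(* The probability sigma of the manipulative agent is kept out of the
   primitives: the thresholds below do not depend on it. *)
Record primitives (R : realType) := Primitives {
  theta : R;  (* principal's payoff from the safe action *)
  beta : R;   (* agent's payoff from the safe action *)
  mu : R;     (* prior probability of omega = 1 *)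
  rho : R;    (* discount rate *)
  G : R -> R; (* CDF of the arrival time of real news *)
  g : R -> R  (* density of G *)
}.

Section Primitives.
Context {R : realType}.
Implicit Types (p : primitives R) (t tauP tauA : R).
Notation leb := (@lebesgue_measure R).

Definition hazard p t : R := g p t / (1 - G p t).

Definition hazard_infty p : R := lim (hazard p t @[t --> +oo]).

Definition phiP p : R := rho p * theta p / (mu p * (1 - theta p)).

Definition phiA p : R := rho p * mu p / (beta p * (1 - mu p)).

Record news_cdf p : Prop := NewsCdf {
  g_measurable : measurable_fun (`[0, +oo[ : set R) (g p);
  g_ge0 : forall t, 0 <= t -> 0 <= g p t;
  G_neg : forall t, t < 0 -> G p t = 0;
  G_density : forall t, 0 <= t ->
    (\int[leb]_(s in `[0%R, t]) (g p s)%:E = (G p t)%:E)%E;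
  G_lt1 : forall t, G p t < 1;
  G_infty : G p t @[t --> +oo] --> (1 : R)
}.

(* "Decreasing" is taken in the weak sense, which is enough because the
   points where the hazard rate takes the values phiP and phiA are assumed to
   be unique below. *)
Record standing p : Prop := Standing {
  theta_itv : 0 < theta p < 1;
  beta_itv : 0 < beta p < theta p;
  mu_itv : beta p < mu p < theta p;
  rho_gt0 : 0 < rho p;
  news : news_cdf p;
  hazard_decr : forall s t, 0 <= s -> s <= t -> hazard p t <= hazard p s;
  A1 : hazard_infty p < phiP p < hazard p 0;
  A2 : phiA p < phiP p
}.

Definition is_tauP p tauP : Prop :=
  [/\ 0 < tauP, hazard p tauP = phiP p &
      forall t, 0 <= t -> hazard p t = phiP p -> t = tauP].

Definition uFB p t : R :=
  \int[leb]_(x in `[0, t])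
     (expR (- rho p * x) * g p x * (mu p + (1 - mu p) * beta p))
  + expR (- rho p * t) * (1 - G p t) * mu p.

Definition is_tauA p tauP tauA : Prop :=
  [/\ tauP < tauA,
      forall t, 0 <= t -> uFB p t <= uFB p tauA,
      hazard p tauA = phiA p &
      forall t, 0 <= t -> hazard p t = phiA p -> t = tauA].

Definition sigma_bar p tauP : R :=
  1 - expR (- \int[leb]_(s in `[0, tauP])
                ((mu p * (1 - theta p) * hazard p s - rho p * theta p)
                 / (theta p - mu p))).

Definition uPD p tauA : R :=
  \int[leb]_(s in `[0, tauA])
     (expR (- rho p * s) * g p s * (mu p + (1 - mu p) * theta p))
  + expR (- rho p * tauA) * (1 - G p tauA) * mu p.

Definition severe p tauA : bool := uPD p tauA < theta p.

Definition mild p tauA : bool := ~~ severe p tauA.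

End Primitives.

(* Law of a random time in [0, oo] without singular part: [dens] is the density
   f^* of the absolutely continuous part and [atom t] is the probability of the
   point t, so t is an atom iff 0 < atom t. Values at negative points are
   irrelevant. *)
Record timing (R : realType) := Timing {
  dens : R -> R;
  atom : R -> R
}.

Record profile (R : realType) := Profile {
  accept : R -> R;   (* a *)
  stop : timing R;   (* F_P *)
  fake : timing R    (* F_A *)
}.

Section Game.
Context {R : realType}.
Implicit Types (p : primitives R) (F : timing R) (E : profile R) (sigma : R).
Notation leb := (@lebesgue_measure R).

(* Finiteness of the total mass forces the set of atoms to be countable. *)
Record timing_law F : Prop := TimingLaw {
  dens_measurable : measurable_fun (`[0, +oo[ : set R) (dens F);
  dens_ge0 : forall t, 0 <= t -> 0 <= dens F t;
  atom_ge0 : forall t, 0 <= t -> 0 <= atom F t;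
  mass_le1 :
    (\int[leb]_(s in `[0%R, +oo[) (dens F s)%:E
     + (\esum_(s in `[0%R, +oo[) (atom F s)%:E)%R <= 1)%E
}.

(* Integral over D of (k0 + f k1), where f = f^* + \sum_m f_m delta_{t_m} is
   the generalized density of F. The atomic part is a sum of nonnegative terms
   in all uses below (k1 is nonnegative). *)
Definition flow F (D : set R) (k0 k1 : R -> R) : R :=
  \int[leb]_(s in D) (k0 s + dens F s * k1 s)
  + fine (\esum_(s in D) (atom F s * k1 s)%:E).

Definition cdfT F (t : R) : R := flow F `[0, t] (cst 0) (cst 1).

Definition mass_infty F : R := 1 - flow F `[0, +oo[ (cst 0) (cst 1).

(* "f(t) > 0" for t in [0, oo]; at t = oo it says that the law puts positive
   mass on never stopping (faking). *)
Definition charged F (t : \bar R) : Prop :=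
  match t with
  | r%:E => 0 < dens F r \/ 0 < atom F r
  | +oo%E => 0 < mass_infty F
  | -oo%E => False
  end.

Definition upto (t : \bar R) : set R := [set s | 0 <= s /\ (s%:E <= t)%E].

Definition expectation_of F (u : \bar R -> R) : R :=
  flow F `[0, +oo[ (cst 0) (fun t => u t%:E) + mass_infty F * u +oo%E.

Definition mu1 p sigma E (s : R) : R :=
  if 0 < atom (fake E) s then mu p
  else
    let S := 1 - sigma * cdfT (fake E) s in
    let f := dens (fake E) s in
    (mu p * g p s * S + mu p * sigma * f * (1 - G p s))
    / (mu p * g p s * S + sigma * f * (1 - G p s)).

(* The weight w_1^P is mu g (1 - sigma F_A) + f_A sigma (1 - G); its second
   term, which carries the atoms of F_A, is the k1-part of the flow. *)
Definition uP p sigma E (t : \bar R) : R :=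
  let S s := 1 - sigma * cdfT (fake E) s in
  let w0 s := (1 - mu p) * g p s * S s in
  let v s := (1 - accept E s) * theta p + accept E s * mu1 p sigma E s in
  flow (fake E) (upto t)
    (fun s => expR (- rho p * s) * (w0 s * theta p + mu p * g p s * S s * v s))
    (fun s => expR (- rho p * s) * (sigma * (1 - G p s) * v s))
  + (if t is r%:E then expR (- rho p * r) * ((1 - G p r) * S r) * theta p
     else 0).

Definition uA p E (t : \bar R) : R :=
  let S s := 1 - cdfT (stop E) s in
  let w0 s := (1 - mu p) * g p s * S s in
  let w1 s := mu p * g p s * S s in
  flow (stop E) (upto t)
    (fun s => expR (- rho p * s) *
       (w0 s * beta p + w1 s * ((1 - accept E s) * beta p + accept E s)))
    (fun s => expR (- rho p * s) * ((1 - G p s) * beta p))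
  + (if t is r%:E then
       expR (- rho p * r) * ((1 - G p r) * S r) *
       ((1 - accept E r) * beta p + mu p * accept E r)
     else 0).

Record strategies E : Prop := Strategies {
  accept_measurable : measurable_fun (`[0, +oo[ : set R) (accept E);
  accept_itv : forall t, 0 <= t -> 0 <= accept E t <= 1;
  stop_law : timing_law (stop E);
  fake_law : timing_law (fake E)
}.

Record equilibrium p sigma E : Prop := Equilibrium {
  eq_strategies : strategies E;
  AIC : forall t t' : \bar R, (0 <= t)%E -> (0 <= t')%E ->
    charged (fake E) t -> uA p E t' <= uA p E t;
  PICa : forall t : R, 0 <= t ->
    (theta p < mu1 p sigma E t -> accept E t = 1) /\
    (mu1 p sigma E t < theta p -> accept E t = 0);
  PICt : forall t t' : \bar R, (0 <= t)%E -> (0 <= t')%E ->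
    charged (stop E) t -> uP p sigma E t' <= uP p sigma E t
}.

Definition payoffP p sigma E : R := expectation_of (stop E) (uP p sigma E).

Definition beneficial p sigma E : Prop := theta p < payoffP p sigma E.

(* Equality of the triples (a, F_P, F_A): densities are identified when they
   induce the same CDF. *)
Definition same_profile E E' : Prop :=
  forall t : R, 0 <= t ->
    [/\ accept E t = accept E' t, cdfT (stop E) t = cdfT (stop E') t &
        cdfT (fake E) t = cdfT (fake E') t].

End Game.

(* Main.v *)
(* The principal's payoff is absolutely continuous in her stopping time, because at an atom of
   faking she rejects and is paid [theta] either way; it starts at [theta] and decreases after
   [tauP], so she stops by [tauP].

   If faking at an accepted time [t] were worth more than the agent's equilibrium payoff, [t]
   would be a faking time with interior acceptance; her payoff would then strictly decrease,
   she would not stop, and the excess would persist forever: a contradiction.  Hence, until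
   she has stopped for sure, type-1 news is always accepted.

   So, unless she stops at once (payoff [theta]), there is no faking before the first time
   [t0] at which her payoff is maximal, and on [[t0, tauP]] both players are indifferent, which
   gives linear equations for the two survival functions.  The agent must have faked by [tauP],
   so [1 - sigma = exp (- \int_t0^tauP fake_rate)].  This is impossible for
   [sigma > sigma_bar]; for [sigma < sigma_bar] it determines [t0], hence the equilibrium, and
   [t0] tends to [0], hence the payoff to [theta < uPD], as [sigma] tends to [sigma_bar]. *)
Require Import Defs.
From HB Require Import structures.
From mathcomp Require Import all_boot all_order all_algebra.
From mathcomp Require Import all_classical all_reals all_analysis.
From mathcomp Require Import measurable_realfun.
From mathcomp Require Import ring lra.
Import Order.TTheory GRing.Theory Num.Theory.
Import numFieldNormedType.Exports.
Local Open Scope ring_scope.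

Set Implicit Arguments.
Unset Strict Implicit.

(** * Primitives of locally integrable functions *)

Section Prim.
Local Open Scope classical_set_scope.
Context {R : realType}.
Notation leb := (@lebesgue_measure R).
Implicit Types (f g x y X Y : R -> R) (a b c s t r C : R).

(** Densities are only measurable and random times may have atoms, so payoffs are not differentiable
    in time. Calculus is therefore done on increments: the product rule, the chain rule for exp and
    integration by parts all come from telescoping errors that are small on short intervals. Payoffs
    are expressed through K = exp (- rho t) (1 - G) times a survival function: payments of [theta]
    or [beta] at the end of the game add up to that amount less interest, and only premia for
    acceptance remain. This form shows where the constants come from. Per unit of time the principal
    gains mu (1 - theta) h from waiting, forgoes interest rho theta, and loses theta - mu per
    accepted fake; the agent gains beta (1 - mu) h, forgoes rho mu, and loses mu - beta per stop.
    The hazards [phiP] and [phiA] balance the first two terms, [fake_rate] and [stop_rate] balance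
    all three, and [sigma_bar] is the mass that fakes on [0, tauP] at the former rate. Optimality
    binds only at charged times, and the value of faking is only right-continuous, so certain
    acceptance cannot be read off pointwise; an excess has to be followed to the right. *)

Definition meas_pos f := measurable_fun (`[0, +oo[%classic : set R) f.

Definition locint f := forall t, leb.-integrable `[0, t] (EFin \o f).

(** For negative [t] the interval is empty and the value is 0, which extends the primitive
    continuously to the whole line. *)
Definition prim f t := \int[leb]_(x in `[0, t]) f x.

Lemma itv0_sub t : (`[0, t]%classic : set R) `<=` `[0, +oo[%classic.
Proof. by move=> r /=; rewrite !in_itv /= => /andP[->]. Qed.

Lemma oc_sub s t : 0 <= s -> (`]s, t]%classic : set R) `<=` `[0, t]%classic.
Proof.
move=> s0 r /=; rewrite !in_itv /= => /andP[sr ->].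
by rewrite andbT ltW // (le_lt_trans s0 sr).
Qed.

Lemma meas_locint f C : meas_pos f -> (forall r, 0 <= r -> `|f r| <= C) -> locint f.
Proof.
move=> mf fC t; apply: measurable_bounded_integrable => //=.
- by rewrite lebesgue_measure_itv /=; case: ifPn; rewrite ?ltry // -EFinB ltry.
- by apply: measurable_funS mf => //; exact: itv0_sub.
- exists C; split; first exact: num_real.
  move=> M CM r /=; rewrite in_itv /= => /andP[r0 _].
  by apply: le_trans (ltW CM); exact: fC.
Qed.

Lemma locint_eq f g : locint f -> (forall r, 0 <= r -> f r = g r) -> locint g.
Proof.
move=> lf fg t; apply: eq_integrable (lf t) => // r.
by rewrite inE /= in_itv /= => /andP[r0 _]; rewrite fg.
Qed.

Lemma locintD f g : locint f -> locint g -> locint (fun r => f r + g r).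
Proof. by move=> lf lg t; apply: (@integrableD _ _ R leb _ _ (EFin \o f) (EFin \o g) (lf t)
  (lg t)) => //. Qed.

Lemma locintZ c f : locint f -> locint (fun r => c * f r).
Proof. by move=> lf t; apply: (@integrableZl _ _ R leb _ _ c (EFin \o f) (lf t)) => //. Qed.

Definition locbnd f := forall t, exists C, forall r, 0 <= r -> r <= t -> `|f r| <= C.

Lemma locintM f g : locint f -> meas_pos g -> locbnd g -> locint (fun r => f r * g r).
Proof.
move=> lf mg gC t; have [C {}gC] := gC t; apply: (integrableMl _ (lf t)) => //=.
- by apply: measurable_funS mg => //; exact: itv0_sub.
- exists C; split; first exact: num_real.
  move=> M CM r /=; rewrite in_itv /= => /andP[r0 rt].
  by apply: le_trans (ltW CM); exact: gC.
Qed.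

Lemma locint_meas f : locint f -> meas_pos f.
Proof.
move=> lf; rewrite /meas_pos.
have -> : (`[0, +oo[%classic : set R) = \bigcup_(n : nat) `[0, n%:R]%classic.
  apply/seteqP; split => r /=.
    rewrite in_itv /= andbT => r0; exists (Num.truncn r).+1 => //=.
    rewrite in_itv /= r0 /= ltW //; exact: truncnS_gt.
  by case=> n _ /=; rewrite !in_itv /= => /andP[->].
apply/measurable_fun_bigcup => // n.
by apply/measurable_EFinP; exact: (measurable_int leb (lf n%:R)).
Qed.

Lemma locint_cst c : locint (fun=> c).
Proof. by apply: (@meas_locint _ `|c|) => //; exact: measurable_cst. Qed.

Lemma prim0 f : prim f 0 = 0.
Proof. by rewrite /prim set_itv1 Rintegral_set1. Qed.

Lemma prim_neg f t : t < 0 -> prim f t = 0.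
Proof. by move=> t0; rewrite /prim set_itv_ge ?Rintegral_set0 // bnd_simp -ltNge. Qed.

Lemma primD f g : locint f -> locint g -> forall t,
  prim (fun r => f r + g r) t = prim f t + prim g t.
Proof. by move=> lf lg t; rewrite /prim RintegralD. Qed.

Lemma primZ c f t : locint f -> prim (fun r => c * f r) t = c * prim f t.
Proof. by move=> lf; rewrite /prim RintegralZl. Qed.

Lemma primB s t f : locint f -> 0 <= s -> s <= t ->
  prim f t - prim f s = \int[leb]_(x in `]s, t]) f x.
Proof. by move=> lf s0 st; rewrite /prim Rintegral_itvB // bnd_simp. Qed.

Lemma eq_prim f g t : (forall r, 0 <= r -> r <= t -> f r = g r) ->
  prim f t = prim g t.
Proof.
move=> fg; apply: eq_Rintegral => r; rewrite inE /= in_itv /= => /andP[r0 rt].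
exact: fg.
Qed.

Lemma eq_primB f g s t : locint f -> locint g -> 0 <= s -> s <= t ->
  (forall r, s < r -> r <= t -> f r = g r) ->
  prim f t - prim f s = prim g t - prim g s.
Proof.
move=> lf lg s0 st fg; rewrite !primB //; apply: eq_Rintegral => r.
by rewrite inE /= in_itv /= => /andP[r0 rt]; exact: fg.
Qed.

Lemma le_primB f g s t : locint f -> locint g -> 0 <= s -> s <= t ->
  (forall r, s < r -> r <= t -> f r <= g r) ->
  prim f t - prim f s <= prim g t - prim g s.
Proof.
move=> lf lg s0 st fg; rewrite !primB //; apply: le_Rintegral => //.
- by apply: integrableS (lf t) => //; exact: oc_sub.
- by apply: integrableS (lg t) => //; exact: oc_sub.
- by move=> r /=; rewrite in_itv /= => /andP[r0 rt]; exact: fg.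
Qed.

Lemma prim_cst c t : 0 <= t -> prim (fun=> c) t = c * t.
Proof.
rewrite le_eqVlt => /predU1P[<-|t0]; first by rewrite prim0 mulr0.
rewrite /prim Rintegral_cst //; congr (c * _).
rewrite [RHS](_ : t = fine (t - 0)%:E); last by rewrite /= subr0.
by congr fine; apply: etrans (lebesgue_measure_itv _) _ => /=; rewrite lte_fin t0.
Qed.

Lemma primB_le f c s t : locint f -> 0 <= s -> s <= t ->
  (forall r, s < r -> r <= t -> f r <= c) -> prim f t - prim f s <= c * (t - s).
Proof.
move=> lf s0 st fc; rewrite mulrBr -!prim_cst ?(le_trans s0) //.
exact: le_primB (locint_cst c) s0 st fc.
Qed.

Lemma primB_ge f c s t : locint f -> 0 <= s -> s <= t ->
  (forall r, s < r -> r <= t -> c <= f r) -> c * (t - s) <= prim f t - prim f s.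
Proof.
move=> lf s0 st fc; rewrite mulrBr -!prim_cst ?(le_trans s0) //.
exact: le_primB (locint_cst c) lf s0 st fc.
Qed.

Lemma primB_norm f c s t : locint f -> 0 <= s -> s <= t ->
  (forall r, s < r -> r <= t -> `|f r| <= c) ->
  `|prim f t - prim f s| <= c * (t - s).
Proof.
move=> lf s0 st fc; rewrite ler_norml -mulNr primB_le ?primB_ge //.
- by move=> r sr rt; have := fc _ sr rt; rewrite ler_norml => /andP[].
- by move=> r sr rt; have := fc _ sr rt; rewrite ler_norml => /andP[].
Qed.

Lemma primB_eq0 f s t : locint f -> 0 <= s -> s <= t ->
  (forall r, s < r -> r <= t -> f r = 0) -> prim f t = prim f s.
Proof.
move=> lf s0 st f0; apply/eqP; rewrite -subr_eq0.
by rewrite (eq_primB lf (locint_cst 0) s0 st) // !prim_cst ?mul0r ?subrr // (le_trans s0).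
Qed.

Lemma prim_nondecr f s t : locint f -> 0 <= s -> s <= t ->
  (forall r, s < r -> r <= t -> 0 <= f r) -> prim f s <= prim f t.
Proof.
by move=> lf s0 st f0; have := primB_ge lf s0 st f0; rewrite mul0r subr_ge0.
Qed.

(** Absolute continuity of the integral: extended by 0 off [0, b], [f] is integrable on the line and
    puts little of its absolute mass on sets of small measure. The modulus is uniform in [s] and
    [t]. *)
Lemma prim_ucont f b : locint f -> forall e : R, 0 < e ->
  exists2 d : R, 0 < d & forall s t, 0 <= s -> s <= t -> t <= b -> t - s < d ->
    `|prim f t - prim f s| < e.
Proof.
move=> lf e e0.
have : leb.-integrable setT (EFin \o f \_ `[0, b]).
  by rewrite -restrict_EFin; apply/integrable_restrict => //=; rewrite setTI.
move=> /integral_normr_continuous /(_ _ e0)[d [d0 /= H]]; exists d => // s t s0 st tb tsd.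
rewrite primB //.
have m : (lebesgue_measure (`]s, t]%classic : set R) < d%:E)%E.
  by rewrite lebesgue_measure_itv /=; case: ifPn; rewrite ?lte_fin.
have sub : (`]s, t]%classic : set R) `<=` `[0, b]%classic.
  move=> r /(oc_sub s0) /=; rewrite !in_itv /= => /andP[-> rt].
  exact: le_trans tb.
apply: le_lt_trans (H _ (measurable_itv _) m).
apply: le_trans (le_normr_Rintegral _ _) _ => //.
  by apply: integrableS (lf b).
rewrite le_eqVlt; apply/orP; left; apply/eqP; apply: eq_Rintegral => r rst.
by rewrite patchE ifT //; rewrite inE; apply: sub; rewrite inE in rst.
Qed.

Lemma prim_continuous f : locint f -> continuous (prim f).
Proof.
move=> lf x; apply/cvgrPdist_lt => /= e e0.
(* Every point within distance 1 of [x] is at most |x + 1|, whatever the sign of [x]. *)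
have [d d0 H] := prim_ucont `|x + 1| lf e0.
have H' s t : s <= t -> t <= `|x + 1| -> t - s < d -> `|prim f t - prim f s| < e.
  move=> st tb tsd.
  have [t0|t0] := ltP t 0; first by rewrite !prim_neg ?subrr ?normr0 // (le_lt_trans st).
  have [s0|s0] := ltP s 0; last exact: H.
  by rewrite (prim_neg f s0) -(prim0 f); apply: H => //; lra.
near=> y.
have yx : `|x - y| < Num.min d 1.
  by near: y; apply: cvgr_dist_lt => //; rewrite lt_min d0 /=.
move: yx; rewrite lt_min => /andP[yd y1].
have b1 : x <= `|x + 1| by rewrite (le_trans _ (ler_norm _)) //; lra.
have b2 : y <= `|x + 1|.
  rewrite (le_trans _ (ler_norm _)) //; move: y1;
    rewrite distrC => /(le_lt_trans (ler_norm _)); lra.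
have [xy|xy] := leP x y.
  by rewrite distrC; apply: H' => //; move: yd; rewrite distrC => /(le_lt_trans (ler_norm _)).
by apply: H' => //; [exact: ltW|move: yd => /(le_lt_trans (ler_norm _))].
Unshelve. all: by end_near. Qed.

(* Summing the hypothesis over a partition of mesh (b - a) / n makes [m] telescope. *)
Lemma small_increments_le (Phi m : R -> R) a b C : a <= b ->
  (forall s t, a <= s -> s <= t -> t <= b ->
     Phi t - Phi s <= C * (t - s) * (m t - m s)) ->
  Phi b <= Phi a.
Proof.
move=> ab H.
have P n : (Phi b - Phi a) * n.+1%:R <= C * (b - a) * (m b - m a).
  pose u k := a + (b - a) * k%:R / n.+1%:R.
  have n0 : n.+1%:R != 0 :> R by rewrite pnatr_eq0.
  have ba0 : 0 <= b - a by lra.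
  have uS k : u k.+1 - u k = (b - a) / n.+1%:R.
    rewrite /u -[k.+1]addn1 natrD; move: n0; set N := n.+1%:R => n0.
    by field.
  have u0 : u 0%N = a by rewrite /u mulr0 mul0r addr0.
  have un : u n.+1 = b by rewrite /u mulfK //; lra.
  have uSle k : u k <= u k.+1 by rewrite -subr_ge0 uS divr_ge0.
  have ua k : a <= u k by rewrite /u lerDl; rewrite divr_ge0 // mulr_ge0.
  have ub k : (k <= n.+1)%N -> u k <= b.
    move=> kn; rewrite -un /u lerD2l ler_wpM2r ?invr_ge0 // ler_wpM2l // ler_nat //.
  have Q k : (k <= n.+1)%N ->
      Phi (u k) - Phi a <= C * ((b - a) / n.+1%:R) * (m (u k) - m a).
    elim: k => [_|k IH kn]; first by rewrite u0 !subrr mulr0.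
    have := H _ _ (ua k) (uSle k) (ub _ kn); rewrite uS.
    have := IH (ltnW kn); set X := (b - a) / _; nra.
  have := Q n.+1 (leqnn _); rewrite un.
  rewrite -ler_pdivlMr ?ltr0n //.
  by rewrite mulrA mulrAC.
rewrite leNgt; apply/negP => lt.
pose D := Phi b - Phi a; have D0 : 0 < D by rewrite subr_gt0.
pose Z := C * (b - a) * (m b - m a).
have := P (Num.truncn (Z / D)); rewrite -/D -/Z leNgt => /negP; apply.
by rewrite mulrC -ltr_pdivrMr //; exact: truncnS_gt.
Qed.

Lemma small_increments_eq (Phi m : R -> R) a b C : a <= b ->
  (forall s t, a <= s -> s <= t -> t <= b ->
     `|Phi t - Phi s| <= C * (t - s) * (m t - m s)) ->
  Phi b = Phi a.
Proof.
move=> ab H; apply/eqP; rewrite eq_le; apply/andP; split.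
  apply: small_increments_le ab _ => s t sa st tb.
  by apply: le_trans (H s t sa st tb); exact: ler_norm.
rewrite -lerN2; apply: (@small_increments_le (fun t => - Phi t)) ab _ => s t sa st tb.
by apply: le_trans (H s t sa st tb); rewrite -opprD -normrN ler_norm.
Qed.

Lemma locintB f g : locint f -> locint g -> locint (fun r => f r - g r).
Proof.
move=> lf lg; apply: (locint_eq (locintD lf (locintZ (-1) lg))) => r _; ring.
Qed.

Lemma primBfun f g t : locint f -> locint g ->
  prim (fun r => f r - g r) t = prim f t - prim g t.
Proof. by move=> lf lg; rewrite /prim RintegralB. Qed.

(* The integrands are merely bounded and measurable, so the product rule is obtained by
   summing increments rather than by differentiation. *)
Lemma prod_rule X Y x y a b L : 0 <= a -> a <= b ->
  locint x -> locint y -> locint (fun r => x r * Y r + X r * y r) ->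
  (forall r, a <= r -> r <= b -> `|x r| <= L /\ `|y r| <= L) ->
  (forall s t, a <= s -> s <= t -> t <= b -> X t - X s = prim x t - prim x s) ->
  (forall s t, a <= s -> s <= t -> t <= b -> Y t - Y s = prim y t - prim y s) ->
  X b * Y b - X a * Y a =
  prim (fun r => x r * Y r + X r * y r) b - prim (fun r => x r * Y r + X r * y r) a.
Proof.
move=> a0 ab lx ly lxy bd HX HY.
set z := fun r => _.
suff : X b * Y b - prim z b = X a * Y a - prim z a by lra.
have L0 : 0 <= L by apply: le_trans (bd a (lexx _) ab).1.
(* One L^2 comes from the product of the two increments, two from freezing the factors [X] and [Y]
   inside [z] at [s]. *)
apply: (@small_increments_eq (fun r => X r * Y r - prim z r) id a b (3 * (L * L)) ab)
  => s t sa st tb.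
have s0 : 0 <= s by exact: le_trans sa.
have HXl r q : s <= r -> r <= q -> q <= t -> `|X q - X r| <= L * (q - r).
  move=> sr rq qt; rewrite HX ?(le_trans sa) ?(le_trans qt) //.
  apply: primB_norm => //; first exact: le_trans s0 sr.
  by move=> w w1 w2; apply: (bd w _ _).1; lra.
have HYl r q : s <= r -> r <= q -> q <= t -> `|Y q - Y r| <= L * (q - r).
  move=> sr rq qt; rewrite HY ?(le_trans sa) ?(le_trans qt) //.
  apply: primB_norm => //; first exact: le_trans s0 sr.
  by move=> w w1 w2; apply: (bd w _ _).2; lra.
pose w r := Y s * x r + X s * y r.
have lw : locint w by apply: locintD; exact: locintZ.
have dw : prim w t - prim w s = Y s * (X t - X s) + X s * (Y t - Y s).
  rewrite /w !primD ?primZ //; try exact: locintZ.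
  rewrite HX // HY //; ring.
have dzw : `|prim (fun r => z r - w r) t - prim (fun r => z r - w r) s|
    <= 2 * (L * L) * (t - s) * (t - s).
  rewrite -mulrA mulrC -mulrA mulrC; apply: primB_norm => //; first exact: locintB.
  move=> r sr rt.
  have -> : z r - w r = x r * (Y r - Y s) + y r * (X r - X s) by rewrite /z /w; ring.
  apply: le_trans (ler_normD _ _) _; rewrite !normrM.
  have [b1 b2] := bd r (le_trans sa (ltW sr)) (le_trans rt tb).
  have c1 : `|Y r - Y s| <= L * (t - s).
    by apply: le_trans (HYl _ _ (lexx s) (ltW sr) rt) _; rewrite ler_wpM2l //; lra.
  have c2 : `|X r - X s| <= L * (t - s).
    by apply: le_trans (HXl _ _ (lexx s) (ltW sr) rt) _; rewrite ler_wpM2l //; lra.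
  apply: (@le_trans _ _ (L * (L * (t - s)) + L * (L * (t - s)))).
    by apply: lerD; apply: ler_pM.
  by rewrite le_eqVlt; apply/orP; left; apply/eqP; ring.
rewrite !primBfun // in dzw.
have -> : X t * Y t - prim z t - (X s * Y s - prim z s) =
   (X t - X s) * (Y t - Y s) - (prim z t - prim w t - (prim z s - prim w s)).
  have -> : prim z t - prim w t - (prim z s - prim w s) =
    prim z t - prim z s - (prim w t - prim w s) by ring.
  rewrite dw; ring.
apply: le_trans (ler_normB _ _) _; rewrite normrM.
have p := ler_pM (normr_ge0 _) (normr_ge0 _) (HXl _ _ (lexx s) st (lexx t)) (HYl _ _ (lexx s)
  st (lexx t)).
apply: le_trans (lerD p dzw) _.
by rewrite le_eqVlt; apply/orP; left; apply/eqP; ring.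
Qed.

End Prim.

(** * Exponentials of primitives and linear integral equations *)

Section Ode.
Local Open Scope classical_set_scope.
Context {R : realType}.
Notation leb := (@lebesgue_measure R).
Implicit Types (f g k Y : R -> R) (a b c s t r C L : R).

Lemma bounded_locbnd f C : (forall r, 0 <= r -> `|f r| <= C) -> locbnd f.
Proof. by move=> fC t; exists C => r r0 _; exact: fC. Qed.

Lemma locint_bnd f : meas_pos f -> locbnd f -> locint f.
Proof.
move=> mf bf; apply: (locint_eq (locintM (locint_cst 1) mf bf)) => r _.
by rewrite mul1r.
Qed.

Lemma continuous_meas f : continuous f -> meas_pos f.
Proof. by move=> cf; apply: measurable_funTS; exact: continuous_measurable_fun. Qed.

Lemma continuous_locbnd f : continuous f -> locbnd f.
Proof.
move=> cf t; have [t0|t0] := ltP t 0.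
  by exists 0 => r r0 rt; have := le_lt_trans (le_trans r0 rt) t0; rewrite ltxx.
have /(compact_bounded (V := R^o)) [C [_ HC]] : compact (f @` `[0, t]).
  apply: continuous_compact (@segment_compact _ 0 t).
  exact: continuous_subspaceT.
exists (C + 1) => r r0 rt; apply: (HC (C + 1)); first by rewrite ltrDl.
by exists r => //=; rewrite in_itv /= r0.
Qed.

Lemma locintMc f g : locint f -> continuous g -> locint (fun r => f r * g r).
Proof.
by move=> lf cg; apply: locintM => //; [exact: continuous_meas|exact: continuous_locbnd].
Qed.

(** Both bounds come from the tangent inequality 1 + u <= exp u, used at [x] and at [y]; convexity
    makes the first-order remainder nonnegative. *)
Lemma expR_quad (x y : R) : `|expR y - expR x| <= Num.max (expR x) (expR y) * `|y - x| /\
  `|expR y - expR x - expR x * (y - x)| <= `|y - x| * `|expR y - expR x|.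
Proof.
have e0 := expR_gt0 x; have e1 := expR_gt0 y.
have a1 : expR x * (1 + (y - x)) <= expR y.
  by rewrite -ler_pdivlMl // mulrC -expRN -expRD expR_ge1Dx.
have a2 : expR y * (1 + (x - y)) <= expR x.
  by rewrite -ler_pdivlMl // mulrC -expRN -expRD expR_ge1Dx.
have mx : expR x <= Num.max (expR x) (expR y) by rewrite le_max lexx.
have my : expR y <= Num.max (expR x) (expR y) by rewrite le_max lexx orbT.
set M := Num.max _ _ in mx my *.
split.
  have [xy|xy] := leP x y.
    have h : 0 <= y - x by lra.
    have e : expR x <= expR y by rewrite ler_expR.
    rewrite !ger0_norm ?subr_ge0 //.
    apply: (@le_trans _ _ (expR y * (y - x))); last by rewrite ler_wpM2r.
    by lra.
  have h : 0 <= x - y by lra.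
  have e : expR y <= expR x by rewrite ler_expR ltW.
  rewrite distrC [`|y - x|]distrC !ger0_norm ?subr_ge0 //; last exact: ltW.
  apply: (@le_trans _ _ (expR x * (x - y))); last by rewrite ler_wpM2r.
  by lra.
have h : 0 <= expR y - expR x - expR x * (y - x) by lra.
rewrite -normrM (ger0_norm h).
apply: (le_trans _ (ler_norm _)); lra.
Qed.

(** Telescoping again: on [s, t] the first-order remainder of exp and the freezing of [E] at [s]
    each cost at most B (L (t - s))^2. *)
Lemma exp_rule k L a b : 0 <= a -> a <= b -> locint k ->
  (forall r, 0 <= r -> r <= b -> `|k r| <= L) ->
  expR (prim k b) - expR (prim k a) =
  prim (fun r => k r * expR (prim k r)) b - prim (fun r => k r * expR (prim k r)) a.
Proof.
move=> a0 ab lk kL.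
pose E r := expR (prim k r).
have cE : continuous E.
  move=> x; apply: continuous_comp; first exact: prim_continuous.
  exact: continuous_expR.
have lkE : locint (fun r => k r * E r) by exact: locintMc.
rewrite -/(E b) -/(E a).
set z := (fun r => _); have lz : locint z by [].
suff : E b - prim z b = E a - prim z a.
  by move: (E a) (E b) (prim z a) (prim z b) => *; lra.
have [B HB] := continuous_locbnd cE b.
have EB r : 0 <= r -> r <= b -> E r <= B.
  by move=> r0 rb; apply: le_trans (HB r r0 rb); rewrite ger0_norm // expR_ge0.
have B0 : 0 <= B by apply: le_trans (EB a a0 ab); exact: expR_ge0.
have L0 : 0 <= L by apply: le_trans (kL a a0 ab).
apply: (@small_increments_eq _ (fun r => E r - prim z r) id a b (2 * (B * L * L)) ab)
  => s t sa st tb.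
have s0 : 0 <= s by exact: le_trans sa.
have dk r q : s <= r -> r <= q -> q <= t -> `|prim k q - prim k r| <= L * (q - r).
  move=> sr rq qt; apply: primB_norm => //; first exact: le_trans s0 sr.
  by move=> w w1 w2; apply: kL; lra.
have dE r : s <= r -> r <= t -> `|E r - E s| <= B * (L * (t - s)).
  move=> sr rt; apply: le_trans (expR_quad _ _).1 _; apply: ler_pM => //.
  - rewrite ge_max; apply/andP; split; apply: EB => //.
    + exact: le_trans st tb.
    + exact: le_trans s0 sr.
    + exact: le_trans rt tb.
  - apply: le_trans (dk _ _ _ _ _) _ => //; apply: ler_wpM2l => //; lra.
have q2 := (expR_quad (prim k s) (prim k t)).2; rewrite -/(E t) -/(E s) in q2.
have {}q2 : `|E t - E s - E s * (prim k t - prim k s)| <= (L * (t - s)) * (B * (L * (t - s))).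
  apply: le_trans q2 _; apply: ler_pM => //; first exact: dk.
  exact: dE.
have lw : locint (fun r => E s * k r) by exact: locintZ.
have q3 : `|prim (fun r => z r - E s * k r) t - prim (fun r => z r - E s * k r) s|
    <= (L * (B * (L * (t - s)))) * (t - s).
  apply: primB_norm => //; first exact: locintB.
  move=> r sr rt; rewrite /z (mulrC (E s)) -mulrBr normrM; apply: ler_pM => //.
    by apply: kL; lra.
  by apply: dE => //; exact: ltW.
rewrite !primBfun ?primZ // in q3.
have -> : E t - prim z t - (E s - prim z s) =
  (E t - E s - E s * (prim k t - prim k s)) -
  (prim z t - E s * prim k t - (prim z s - E s * prim k s)).
  by move: (E s) (E t) (prim z s) (prim z t) (prim k s) (prim k t) => *; ring.
apply: le_trans (ler_normB _ _) _; apply: le_trans (lerD q2 q3) _.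
by rewrite le_eqVlt; apply/orP; left; apply/eqP; ring.
Qed.

Lemma primN k t : locint k -> prim (fun r => - k r) t = - prim k t.
Proof.
move=> lk; rewrite -mulN1r -primZ //; apply: eq_prim => r _ _; by rewrite mulN1r.
Qed.

Lemma locintN k : locint k -> locint (fun r => - k r).
Proof. by move=> lk; apply: (locint_eq (locintZ (-1) lk)) => r _; rewrite mulN1r. Qed.

(** Integrating factor: by the product rule, the product of [Y] with exp (- prim k) has a vanishing
    integrand, hence is constant. *)
Lemma linear_ode k Y L a b : 0 <= a -> a <= b -> locint k ->
  (forall r, 0 <= r -> r <= b -> `|k r| <= L) ->
  locint (fun r => k r * Y r) -> (forall r, a <= r -> r <= b -> `|Y r| <= L) ->
  (forall s t, a <= s -> s <= t -> t <= b ->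
    Y t - Y s = prim (fun r => k r * Y r) t - prim (fun r => k r * Y r) s) ->
  Y b = Y a * expR (prim k b - prim k a).
Proof.
move=> a0 ab lk kL lkY YL HY.
pose X r := expR (prim (fun r => - k r) r).
have lNk := locintN lk.
have cX : continuous X.
  move=> x; apply: continuous_comp; first exact: prim_continuous.
  exact: continuous_expR.
have [C HC] := continuous_locbnd cX b.
have L0 : 0 <= L by apply: le_trans (kL a a0 ab).
have C0 : 0 <= C by apply: le_trans (HC a a0 ab).
have Z r : - k r * X r * Y r + X r * (k r * Y r) = 0 by ring.
have := @prod_rule _ X Y (fun r => - k r * X r) (fun r => k r * Y r) a b (L * C + L * L)
  a0 ab (locintMc lNk cX) lkY.
have lz : locint (fun r => - k r * X r * Y r + X r * (k r * Y r)).
  by apply: (locint_eq (locint_cst 0)) => r _; rewrite Z.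
move=> /(_ lz) /=.
have E0 t : prim (fun r => - k r * X r * Y r + X r * (k r * Y r)) t = 0.
  have [t0|t0] := ltP t 0; first exact: prim_neg.
  by rewrite (eq_prim (g := fun=> 0)) ?prim_cst ?mul0r.
rewrite !E0 subrr => H.
have {H} : X b * Y b - X a * Y a = 0.
  apply: H => [r ra rb||//].
    have r0 : 0 <= r by exact: le_trans ra.
    split; rewrite normrM.
      apply: (@le_trans _ _ (L * C)); last by rewrite lerDl mulr_ge0.
      by rewrite normrN; apply: ler_pM => //; [exact: kL|exact: HC].
    apply: (@le_trans _ _ (L * L)); last by rewrite lerDr mulr_ge0.
    by apply: ler_pM => //; [exact: kL|exact: YL].
  move=> s t sa st tb.
  apply: (@exp_rule (fun r => - k r) L s t) => //; first exact: le_trans sa.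
  by move=> r r0 rt; rewrite normrN; apply: kL => //; exact: le_trans tb.
rewrite /X !primN // => H.
have -> : Y b = expR (prim k b) * (expR (- prim k b) * Y b).
  by rewrite mulrA -expRD subrr expR0 mul1r.
have -> : expR (- prim k b) * Y b = expR (- prim k a) * Y a by exact: subr0_eq.
by rewrite mulrA -expRD mulrC.
Qed.

End Ode.

(** * Random times *)

Section Timing.
Local Open Scope classical_set_scope.
Context {R : realType}.
Notation leb := (@lebesgue_measure R).
Implicit Types (f g k w : R -> R) (a b c s t r C L : R) (D A : set R).

Lemma esumZ c D w : 0 <= c -> (forall r, D r -> 0 <= w r) ->
  \esum_(s in D) (c * w s)%:E = (c%:E * \esum_(s in D) (w s)%:E)%E.
Proof.
move=> c0 w0.
(* Truncation at 0 makes the terms nonnegative off [D] as well, so that [c] can be moved through all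
   finite sums. *)
pose v s := (Num.max (w s) 0)%:E : \bar R.
have v0 s : (0 <= v s)%E by rewrite /v lee_fin le_max lexx orbT.
have E s : D s -> (w s)%:E = v s by move=> /w0 ?; rewrite /v max_l.
rewrite (eq_esum E) (@eq_esum _ _ _ _ (fun s => (c%:E * v s)%E)); last first.
  by move=> s /E <-; rewrite EFinM.
rewrite /esum -ereal_supZl //; last first.
  by apply/set0P; exists (\sum_(x \in set0) v x)%E; exists set0 => //; exact: fsets_set0.
rewrite image_comp; congr ereal_sup; apply: eq_imagel => A _ /=.
by rewrite ge0_mule_fsumr.
Qed.

Lemma esum_subset A D w : A `<=` D -> (forall r, D r -> 0 <= w r) ->
  (\esum_(s in A) (w s)%:E <= \esum_(s in D) (w s)%:E)%E.
Proof.
move=> AD w0; rewrite (esumID A D); last by move=> r /w0; rewrite lee_fin.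
rewrite (setIidr AD) leeDl // esum_ge0 // => r [/w0]; by rewrite lee_fin.
Qed.

Variable F : timing R.
Hypothesis law : timing_law F.

Local Notation pos := (`[0, +oo[ : set R).

Lemma posP r : pos r = (0 <= r) :> Prop.
Proof. by rewrite /pos /= in_itv /= andbT. Qed.

Definition jumps D w := fine (\esum_(s in D) (atom F s * w s)%:E).

Lemma esum_atom_le1 : (\esum_(s in pos) (atom F s)%:E <= 1)%E.
Proof.
apply: le_trans (mass_le1 law); rewrite leeDr // integral_ge0 // => r.
by rewrite /= in_itv /= andbT lee_fin => /(dens_ge0 law).
Qed.

(** The condition [0 <= r] keeps [D] where the atoms of [F] are known to be nonnegative; bounded
    weights then give finite sums. *)
Definition nneg_bounded D w := exists C, forall r, D r -> 0 <= r /\ 0 <= w r <= C.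

Lemma jumps_fin D w : nneg_bounded D w -> (\esum_(s in D) (atom F s * w s)%:E)%R \is a fin_num.
Proof.
move=> [C H].
pose C' := Num.max C 0; have C0 : 0 <= C' by rewrite le_max lexx orbT.
have a0 r : D r -> 0 <= atom F r by move=> /H[r0 _]; exact: atom_ge0.
rewrite ge0_fin_numE; last first.
  apply: esum_ge0 => r Dr; rewrite lee_fin mulr_ge0 ?a0 //.
  by have [_ /andP[]] := H r Dr.
apply: (@le_lt_trans _ _ (C'%:E * 1)%E); last by rewrite mule1 ltry.
apply: (@le_trans _ _ (\esum_(s in D) (C' * atom F s)%:E)).
  apply: le_esum => r Dr; rewrite lee_fin mulrC ler_wpM2r ?a0 //.
  by have [_ /andP[_ wC]] := H r Dr; rewrite le_max wC.
rewrite esumZ //; apply: lee_pmul; rewrite ?lee_fin //.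
  by apply: esum_ge0 => r Dr; rewrite lee_fin a0.
apply: le_trans esum_atom_le1; apply: esum_subset.
  by move=> r /H[r0 _]; rewrite /pos /= in_itv /= r0.
by move=> r; rewrite posP => /(atom_ge0 law).
Qed.

Lemma jumps_ge0 D w : nneg_bounded D w -> 0 <= jumps D w.
Proof.
move=> [C H]; apply: fine_ge0; apply: esum_ge0 => r Dr; have [r0 /andP[w0 _]] := H r Dr.
by rewrite lee_fin mulr_ge0 // atom_ge0.
Qed.

Lemma nneg_boundedS D A w : A `<=` D -> nneg_bounded D w -> nneg_bounded A w.
Proof. by move=> AD [C H]; exists C => r /AD; exact: H. Qed.

Lemma jumps_split A D w : A `<=` D -> nneg_bounded D w ->
  jumps D w = jumps A w + jumps (D `\` A) w.
Proof.
move=> AD H; rewrite /jumps (esumID A); last first.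
  case: H => C H r Dr; have [r0 /andP[w0 _]] := H r Dr.
  by rewrite lee_fin mulr_ge0 // atom_ge0.
rewrite (setIidr AD) fineD //; apply: jumps_fin; apply: nneg_boundedS H => //.
Qed.

Lemma le_jumps D w v : nneg_bounded D w -> nneg_bounded D v -> (forall r, D r -> w r <= v r) ->
  jumps D w <= jumps D v.
Proof.
move=> gw gv wv; apply: fine_le; try exact: jumps_fin.
apply: le_esum => r Dr; rewrite lee_fin ler_wpM2l ?wv //.
by case: gw => C /(_ r Dr)[r0 _]; exact: atom_ge0.
Qed.

Lemma eq_jumps D w v : (forall r, D r -> atom F r * w r = atom F r * v r) ->
  jumps D w = jumps D v.
Proof. by move=> wv; congr fine; apply: eq_esum => r Dr; rewrite wv. Qed.

Lemma jumpsZ D w c : 0 <= c -> nneg_bounded D w -> jumps D (fun r => c * w r) = c * jumps D w.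
Proof.
move=> c0 gw; rewrite /jumps.
rewrite (@eq_esum _ _ _ _ (fun s => (c * (atom F s * w s))%:E)); last first.
  by move=> s _; rewrite mulrCA.
rewrite esumZ // ?fineM //; first exact: jumps_fin.
case: gw => C H r Dr; have [r0 /andP[w0 _]] := H r Dr.
by rewrite mulr_ge0 // atom_ge0.
Qed.

Lemma nneg_bounded1 D : D `<=` pos -> nneg_bounded D (fun=> 1).
Proof. by move=> Dp; exists 1 => r /Dp; rewrite posP => ->; rewrite ler01 lexx. Qed.

Lemma nneg_bounded_cst D c : 0 <= c -> D `<=` pos -> nneg_bounded D (fun=> c).
Proof. by move=> c0 Dp; exists c => r /Dp; rewrite posP => ->; rewrite c0 lexx. Qed.

Lemma jumps_cst D c : 0 <= c -> D `<=` pos -> jumps D (fun=> c) = c * jumps D (fun=> 1).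
Proof.
move=> c0 Dp; rewrite -jumpsZ //; last exact: nneg_bounded1.
by apply: eq_jumps => r _; rewrite mulr1.
Qed.

Lemma jumps_eq0 D w : (forall r, D r -> atom F r * w r = 0) -> jumps D w = 0.
Proof.
move=> H; rewrite /jumps esum1 //= => r Dr; by rewrite H.
Qed.

Definition jump w t := jumps `[0, t] w.

Lemma seg_pos t : `[0, t] `<=` pos.
Proof. exact: itv0_sub. Qed.

Lemma oc_pos s t : 0 <= s -> `]s, t] `<=` pos.
Proof. by move=> s0 r /(oc_sub s0); exact: seg_pos. Qed.

Lemma nneg_bounded_seg w t C : (forall r, 0 <= r -> r <= t -> 0 <= w r <= C) ->
  nneg_bounded `[0, t] w.
Proof.
by move=> H; exists C => r /=; rewrite in_itv /= => /andP[r0 rt]; split => //; exact: H.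
Qed.

Lemma jumpB w s t : 0 <= s -> s <= t -> nneg_bounded `[0, t] w ->
  jump w t - jump w s = jumps `]s, t] w.
Proof.
move=> s0 st gw; rewrite /jump (@jumps_split `[0, s] `[0, t]) //; last first.
  move=> r /=; rewrite !in_itv /= => /andP[-> rs]; exact: le_trans st.
rewrite addrC addKr; congr jumps; apply/seteqP; split => r /=; rewrite !in_itv /=.
  by move=> [/andP[r0 ->]] /negP; rewrite r0 /= -ltNge => ->.
move=> /andP[sr rt]; rewrite rt andbT (le_trans s0 (ltW sr)); split => //.
by rewrite /= leNgt sr.
Qed.

Lemma jumpB_le w c s t : 0 <= s -> s <= t -> nneg_bounded `[0, t] w -> 0 <= c ->
  (forall r, s < r -> r <= t -> w r <= c) ->
  jump w t - jump w s <= c * (jump (fun=> 1) t - jump (fun=> 1) s).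
Proof.
move=> s0 st gw c0 wc; rewrite !jumpB //; last by apply: nneg_bounded1; exact: seg_pos.
rewrite -jumps_cst //; last exact: oc_pos.
apply: le_jumps.
- exact: nneg_boundedS (oc_sub s0) gw.
- by apply: nneg_bounded_cst => //; exact: oc_pos.
- by move=> r /=; rewrite in_itv /= => /andP[]; exact: wc.
Qed.

Lemma jumpB_ge w c s t : 0 <= s -> s <= t -> nneg_bounded `[0, t] w -> 0 <= c ->
  (forall r, s < r -> r <= t -> c <= w r) ->
  c * (jump (fun=> 1) t - jump (fun=> 1) s) <= jump w t - jump w s.
Proof.
move=> s0 st gw c0 wc; rewrite !jumpB //; last by apply: nneg_bounded1; exact: seg_pos.
rewrite -jumps_cst //; last exact: oc_pos.
apply: le_jumps.
- by apply: nneg_bounded_cst => //; exact: oc_pos.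
- exact: nneg_boundedS (oc_sub s0) gw.
- by move=> r /=; rewrite in_itv /= => /andP[]; exact: wc.
Qed.

Lemma jump1_nondecr s t : 0 <= s -> s <= t -> jump (fun=> 1) s <= jump (fun=> 1) t.
Proof.
move=> s0 st; rewrite -subr_ge0 jumpB //; last by apply: nneg_bounded1; exact: seg_pos.
by apply: jumps_ge0; apply: nneg_bounded1; exact: oc_pos.
Qed.

Lemma jump0 w : 0 <= w 0 -> jump w 0 = atom F 0 * w 0.
Proof.
move=> w0; rewrite /jump /jumps set_itv1 esum_set1 //=.
by rewrite lee_fin mulr_ge0 // atom_ge0.
Qed.

Lemma atom_le_jump t : 0 <= t -> atom F t <= jump (fun=> 1) t.
Proof.
move=> t0; rewrite /jump (@jumps_split [set t]); last 2 first.
- by move=> r /= ->; rewrite in_itv /= t0 lexx.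
- by apply: nneg_bounded1; exact: seg_pos.
rewrite {1}/jumps esum_set1 ?mulr1 ?lee_fin ?atom_ge0 //=.
rewrite lerDl jumps_ge0 //; apply: nneg_bounded1.
by move=> r [] /seg_pos.
Qed.

(* A finite set of atoms carries all but [e] of the atomic mass beyond [s]. *)
Lemma jump_rcont s e : 0 <= s -> 0 < e -> exists2 d, s < d &
  forall t, s <= t -> t < d -> jump (fun=> 1) t - jump (fun=> 1) s < e.
Proof.
move=> s0 e0.
pose T := \esum_(r in `]s, +oo[) (atom F r)%:E.
have sp : `]s, +oo[ `<=` pos.
  by move=> r; rewrite posP /= in_itv /= andbT => /ltW; exact: (le_trans s0).
have gT : nneg_bounded `]s, +oo[ (fun=> 1) by exact: nneg_bounded1.
have Tfin : T \is a fin_num.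
  have := jumps_fin gT; rewrite /T; congr (_ \is a _).
  by apply: eq_esum => r _; rewrite mulr1.
have := @ub_ereal_sup_adherent R [set (\sum_(x \in A)
  (atom F x)%:E)%R | A in fsets `]s, +oo[] e e0 Tfin.
move=> [_ [A [fA As] <-]] HA.
rewrite -/(esum _ _) -/T in HA.
(* As [A] is finite and lies strictly above [s], some [d > s] is a lower bound of it; for [t < d]
   the atoms in ]s, t] then avoid [A]. *)
have [d sd dA] : exists2 d, s < d & forall r, A r -> d <= r.
  have /finite_seqP [l lE] := fA.
  have : forall r, r \in l -> s < r.
    by move=> r rl; have := As r; rewrite lE /= in_itv /= andbT; exact.
  rewrite lE => {lE}; elim: l => [_|x l IH H]; first by exists (s + 1) => //; rewrite ltrDl.
  have [|d sd dl] := IH; first by move=> r rl; apply: H; rewrite in_cons rl orbT.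
  exists (Num.min x d); first by rewrite lt_min sd H // in_cons eqxx.
  move=> r /=; rewrite in_cons => /orP[/eqP ->|/dl dr]; first by rewrite ge_min lexx.
  by rewrite ge_min dr orbT.
exists d => // t st td; rewrite jumpB //; last by apply: nneg_bounded1; exact: seg_pos.
have := @jumps_split `]s, t] `]s, +oo[ _ _ gT.
have sub : `]s, t] `<=` `]s, +oo[.
  by move=> r /=; rewrite !in_itv /= andbT => /andP[].
move=> /(_ sub) E.
have HT : jumps `]s, +oo[ (fun=> 1) = fine T.
  by congr fine; apply: eq_esum => r _; rewrite mulr1.
have HA' : (\sum_(x \in A) (atom F x)%:E <= (jumps (`]s, +oo[ `\` `]s, t]) (fun=> 1))%:E)%E.
  rewrite /jumps fineK; last by apply: jumps_fin; apply: nneg_boundedS gT => r [].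
  apply: ereal_sup_ubound; exists A; last by apply: eq_fsbigr => r _; rewrite mulr1.
  split => // r Ar; split; first exact: As.
  rewrite /= in_itv /= => /andP[_ rt]; have := dA _ Ar; lra.
have := lt_le_trans HA HA'; rewrite -(fineK Tfin) -EFinB lte_fin -HT E.
lra.
Qed.

End Timing.

(** * Distribution functions and integration against them *)

Section Cdf.
Local Open Scope classical_set_scope.
Context {R : realType}.
Notation leb := (@lebesgue_measure R).
Implicit Types (f g k w K : R -> R) (a b c s t r L : R) (D A : set R).

Lemma pos_bigcup : (`[0, +oo[ : set R) = \bigcup_(n : nat) `[0, n%:R].
Proof.
apply/seteqP; split => r /=.
  rewrite in_itv /= andbT => r0; exists (Num.truncn r).+1 => //=.
  rewrite in_itv /= r0 /= ltW //; exact: truncnS_gt.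
by case=> n _ /=; rewrite !in_itv /= => /andP[->].
Qed.

Lemma meas_homo f : (forall s t, 0 <= s -> s <= t -> f s <= f t) -> meas_pos f.
Proof.
move=> H; pose h t := f (Num.max t 0).
have mh : measurable_fun (`[0, +oo[%classic : set R) h.
  apply: nondecreasing_measurable => // s t st; apply: H.
    by rewrite le_max lexx orbT.
  by rewrite ge_max !le_max st lexx orbT.
apply: eq_measurable_fun mh => r; rewrite inE /= in_itv /= andbT => r0.
by rewrite /h max_l.
Qed.

Lemma meas_antihomo f : (forall s t, 0 <= s -> s <= t -> f t <= f s) -> meas_pos f.
Proof.
move=> H; have m : meas_pos (fun t => - f t) by apply: meas_homo => s t s0 st; rewrite lerN2 H.
apply: eq_measurable_fun (measurable_funN m) => r _ /=; exact: opprK.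
Qed.

Lemma measM f g : meas_pos f -> meas_pos g -> meas_pos (fun r => f r * g r).
Proof. by move=> mf mg; exact: measurable_funM. Qed.

Lemma measD f g : meas_pos f -> meas_pos g -> meas_pos (fun r => f r + g r).
Proof. by move=> mf mg; exact: measurable_funD. Qed.

Lemma meas_cst c : meas_pos (fun=> c).
Proof. exact: measurable_cst. Qed.

Lemma measB f g : meas_pos f -> meas_pos g -> meas_pos (fun r => f r - g r).
Proof. by move=> mf mg; exact: measurable_funB. Qed.

Lemma locbndM f g : locbnd f -> locbnd g -> locbnd (fun r => f r * g r).
Proof.
move=> bf bg t; have [C HC] := bf t; have [C' HC'] := bg t; exists (C * C') => r r0 rt.
by rewrite normrM; apply: ler_pM => //; [exact: HC|exact: HC'].
Qed.

(** Monotone convergence along the intervals [0, n]; only large horizons matter, so the bound is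
    asked from [T] on. *)
Lemma integral_oo_le f B T : locint f -> (forall r, 0 <= r -> 0 <= f r) ->
  (forall t, T <= t -> prim f t <= B) ->
  (\int[leb]_(x in `[0%R, +oo[) (f x)%:E <= B%:E)%E.
Proof.
move=> lf f0 fB.
pose In n := (\int[leb]_(x in `[0%R, n%:R]) (f x)%:E)%E.
have InE n : In n = (prim f n%:R)%:E.
  by rewrite /In /prim /Rintegral fineK //; apply: integrable_fin_num => //; exact: lf.
have cv : In n @[n --> \oo] --> (\int[leb]_(x in `[0%R, +oo[) (f x)%:E)%E.
  rewrite pos_bigcup; apply: (@ge0_nondecreasing_set_cvg_integral _ (measurableTypeR R)
    R (fun n : nat => (`[0, n%:R] : set R)) (EFin \o f) leb) => //.
  - move=> n m nm; apply/subsetPset => r /=; rewrite !in_itv /= => /andP[-> rn].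
    by rewrite (le_trans rn) // ler_nat.
  - by move=> n; exact: (measurable_int leb (lf n%:R)).
  - by move=> n r /=; rewrite in_itv /= lee_fin => /andP[r0 _]; exact: f0.
apply: (cvge_le _ cv); exists (Num.truncn T).+1 => // n /= Tn.
rewrite InE lee_fin fB // (le_trans (ltW (truncnS_gt _))) // ler_nat //.
Qed.

Lemma prim_oo_le f B T : locint f -> (forall r, 0 <= r -> 0 <= f r) ->
  (forall t, T <= t -> prim f t <= B) -> \int[leb]_(x in `[0, +oo[) f x <= B.
Proof.
move=> lf f0 fB; have le := integral_oo_le lf f0 fB.
rewrite /Rintegral -lee_fin fineK // ge0_fin_numE.
  by apply: le_lt_trans le _; rewrite ltry.
by apply: integral_ge0 => r /=; rewrite in_itv /= andbT lee_fin; exact: f0.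
Qed.

Lemma Rintegral_supp f t (D : set R) : `[0, t] `<=` D -> measurable D ->
  (forall r, D r -> ~~ (0 <= r <= t) -> f r = 0) ->
  \int[leb]_(x in D) f x = prim f t.
Proof.
move=> sD mD f0; rewrite /prim (Rintegral_mkcond leb D) (Rintegral_mkcond leb `[0, t]).
apply: eq_Rintegral => r _; rewrite /patch.
have [rt|rt] := boolP (r \in (`[0, t] : set R)).
  by rewrite ifT // inE; apply: sD; rewrite inE in rt.
case: ifPn => //; rewrite inE => Dr; apply: f0 => //.
by apply/negP => h; move/negP: rt; apply; rewrite inE /= in_itv.
Qed.

Section Law.
Variable F : timing R.
Hypothesis law : timing_law F.

Local Notation pos := (`[0, +oo[ : set R).

Lemma dens_int_le1 : (\int[leb]_(s in pos) (dens F s)%:E <= 1)%E.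
Proof.
apply: le_trans (mass_le1 law); rewrite leeDl // esum_ge0 // => r.
by rewrite /= in_itv /= andbT lee_fin => /(atom_ge0 law).
Qed.

Lemma dens_integrable : leb.-integrable pos (EFin \o dens F).
Proof.
apply/integrableP; split.
  by apply/measurable_EFinP; exact: dens_measurable.
apply: le_lt_trans (ltry 1); apply: le_trans dens_int_le1.
rewrite le_eqVlt; apply/orP; left; apply/eqP; apply: eq_integral => r.
rewrite inE /pos /= in_itv /= andbT => r0; rewrite /= ger0_norm //.
exact: (dens_ge0 law).
Qed.

Lemma locint_dens : locint (dens F).
Proof.
move=> t; apply: (integrableS _ _ _ dens_integrable); try exact: measurable_itv.
exact: itv0_sub.
Qed.

(** Integral of [w] against the law [F] over [0, t], an atom at 0 included. *)
Definition stieltjes w t := prim (fun r => dens F r * w r) t + jump F w t.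

Lemma flowE (k0 k1 : R -> R) t :
  flow F `[0, t] k0 k1 = prim (fun r => k0 r + dens F r * k1 r) t + jump F k1 t.
Proof. by []. Qed.

Lemma cdfTE t : cdfT F t = prim (dens F) t + jump F (fun=> 1) t.
Proof.
rewrite /cdfT flowE; congr (_ + _); apply: eq_prim => r _ _ /=.
by rewrite add0r mulr1.
Qed.

Lemma stieltjesB_le w c s t : 0 <= s -> s <= t -> meas_pos w -> locbnd w ->
  (forall r, 0 <= r -> 0 <= w r) -> 0 <= c ->
  (forall r, s < r -> r <= t -> w r <= c) ->
  stieltjes w t - stieltjes w s <= c * (cdfT F t - cdfT F s).
Proof.
move=> s0 st mw bw w0 c0 wc; rewrite /stieltjes !cdfTE.
have [C HC] := bw t.
have gw : nneg_bounded `[0, t] w.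
  apply: (@nneg_bounded_seg _ w t C) => r r0 rt; rewrite w0 //=.
  by apply: le_trans (HC r r0 rt); exact: ler_norm.
have h1 := jumpB_le law s0 st gw c0 wc.
have h2 : prim (fun r => dens F r * w r) t - prim (fun r => dens F r * w r) s <=
   prim (fun r => c * dens F r) t - prim (fun r => c * dens F r) s.
  apply: le_primB => //; [exact: locintM locint_dens mw bw|exact: locintZ locint_dens|].
  move=> r sr rt; rewrite mulrC; apply: ler_wpM2r; last exact: wc.
  by apply: (dens_ge0 law); lra.
rewrite !primZ in h2; try exact: locint_dens.
lra.
Qed.

Lemma stieltjesB_ge w c s t : 0 <= s -> s <= t -> meas_pos w -> locbnd w ->
  (forall r, 0 <= r -> 0 <= w r) -> 0 <= c ->
  (forall r, s < r -> r <= t -> c <= w r) ->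
  c * (cdfT F t - cdfT F s) <= stieltjes w t - stieltjes w s.
Proof.
move=> s0 st mw bw w0 c0 wc; rewrite /stieltjes !cdfTE.
have [C HC] := bw t.
have gw : nneg_bounded `[0, t] w.
  apply: (@nneg_bounded_seg _ w t C) => r r0 rt; rewrite w0 //=.
  by apply: le_trans (HC r r0 rt); exact: ler_norm.
have h1 := jumpB_ge law s0 st gw c0 wc.
have h2 : prim (fun r => c * dens F r) t - prim (fun r => c * dens F r) s <=
  prim (fun r => dens F r * w r) t - prim (fun r => dens F r * w r) s.
  apply: le_primB => //; [exact: locintZ locint_dens|exact: locintM locint_dens mw bw|].
  move=> r sr rt; rewrite [leRHS]mulrC; apply: ler_wpM2r; last exact: wc.
  by apply: (dens_ge0 law); lra.
rewrite !primZ in h2; try exact: locint_dens.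
lra.
Qed.

Lemma cdfT_nondecr s t : 0 <= s -> s <= t -> cdfT F s <= cdfT F t.
Proof.
move=> s0 st; rewrite !cdfTE; apply: lerD; last exact: jump1_nondecr.
apply: prim_nondecr => //; first exact: locint_dens.
by move=> r sr rt; apply: (dens_ge0 law); lra.
Qed.

Lemma cdfT0 : cdfT F 0 = atom F 0.
Proof. by rewrite cdfTE prim0 add0r jump0 // mulr1. Qed.

Lemma cdfT_ge0 t : 0 <= t -> 0 <= cdfT F t.
Proof.
by move=> t0; apply: le_trans (cdfT_nondecr (lexx 0) t0); rewrite cdfT0 atom_ge0.
Qed.

Lemma meas_cdf : meas_pos (cdfT F).
Proof. by apply: meas_homo => s t; exact: cdfT_nondecr. Qed.

Definition tmass := flow F pos (cst 0) (cst 1).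

Lemma tmassE : tmass = \int[leb]_(s in pos) dens F s + jumps F pos (fun=> 1).
Proof.
rewrite /tmass /flow; congr (_ + _); apply: eq_Rintegral => r _ /=.
by rewrite add0r mulr1.
Qed.

Lemma tmass_le1 : tmass <= 1.
Proof.
rewrite tmassE -lee_fin EFinD.
have g1 : nneg_bounded pos (fun=> 1) by apply: nneg_bounded1.
have := jumps_fin law g1.
have -> : \esum_(s in pos) (atom F s * 1)%:E = \esum_(s in pos) (atom F s)%:E.
  by apply: eq_esum => r _; rewrite mulr1.
move=> fi; rewrite /jumps; have -> : \esum_(s in pos) (atom F s * 1)%:E = \esum_(s in pos)
  (atom F s)%:E.
  by apply: eq_esum => r _; rewrite mulr1.
rewrite /Rintegral !fineK //; first exact: (mass_le1 law).
by apply: (integrable_fin_num _ dens_integrable); exact: measurable_itv.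
Qed.

Lemma mass_infty_ge0 : 0 <= mass_infty F.
Proof. by rewrite /mass_infty -/tmass subr_ge0 tmass_le1. Qed.

Lemma cdfT_le_tmass t : cdfT F t <= tmass.
Proof.
rewrite cdfTE tmassE; apply: lerD; last first.
  rewrite (@jumps_split _ _ law `[0, t] pos); [|exact: seg_pos|exact: nneg_bounded1].
  rewrite lerDl; apply: jumps_ge0 => //; apply: nneg_bounded1; by move=> r [].
rewrite /prim; apply: fine_le.
- by apply: integrable_fin_num => //; exact: locint_dens.
- by apply: (integrable_fin_num _ dens_integrable); exact: measurable_itv.
- have mp : measurable (pos : set (measurableTypeR R)) by exact: measurable_itv.
  apply: (ge0_subset_integral leb _ mp) => //.
  + by apply/measurable_EFinP; exact: dens_measurable.
  + by move=> r; rewrite posP lee_fin; exact: dens_ge0.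
  + exact: itv0_sub.
Qed.

Lemma cdfT_le1 t : cdfT F t <= 1.
Proof. exact: le_trans (cdfT_le_tmass t) tmass_le1. Qed.

Lemma cdfT_norm t : 0 <= t -> `|cdfT F t| <= 1.
Proof. by move=> t0; rewrite ger0_norm ?cdfT_le1 // cdfT_ge0. Qed.

Lemma locbnd_cdf : locbnd (cdfT F).
Proof. by apply: (@bounded_locbnd _ _ 1) => r; exact: cdfT_norm. Qed.

Lemma cdfT_rcont s e : 0 <= s -> 0 < e -> exists2 d, s < d &
  forall t, s <= t -> t < d -> cdfT F t - cdfT F s < e.
Proof.
move=> s0 e0; have e2 : 0 < e / 2 by rewrite divr_gt0.
have [d sd Hd] := jump_rcont law s0 e2.
have [d' d'0 Hd'] := prim_ucont (s + 1) locint_dens e2.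
exists (Num.min d (Num.min (s + d') (s + 1))); first by rewrite !lt_min sd /= !ltrDl d'0 /=.
move=> t st; rewrite !lt_min => /and3P[td td' t1].
have := Hd t st td; have := Hd' s t s0 st (ltW t1).
rewrite !cdfTE => H1 H2.
have {}H1 : prim (dens F) t - prim (dens F) s < e / 2.
  by apply: le_lt_trans (ler_norm _) (H1 _); lra.
lra.
Qed.

Lemma flow_supp (k0 k1 : R -> R) t D : `[0, t] `<=` D -> D `<=` pos -> measurable D ->
  (forall r, t < r -> 0 <= r -> k0 r + dens F r * k1 r = 0 /\ atom F r * k1 r = 0) ->
  flow F D k0 k1 = flow F `[0, t] k0 k1.
Proof.
move=> sD Dp mD H; rewrite /flow; congr (_ + fine _).
  apply: Rintegral_supp => // r /Dp; rewrite posP => r0 rt.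
  by apply: (H r _ _).1 => //; move: rt; rewrite r0 /= -ltNge.
rewrite esum_mkcond [RHS]esum_mkcond; apply: eq_esum => r _.
have [rt|rt] := boolP (r \in (`[0, t] : set R)).
  by rewrite ifT // inE; apply: sD; rewrite inE in rt.
case: ifPn => //; rewrite inE => /Dp; rewrite posP => r0.
rewrite (H r _ _).2 //; rewrite ltNge; apply/negP => h.
by move/negP: rt; apply; rewrite inE /= in_itv /= r0.
Qed.

Definition uncharged r := dens F r = 0 /\ atom F r = 0.

Lemma not_charged r : 0 <= r -> ~ charged F r%:E -> uncharged r.
Proof.
move=> r0 /= nc; split; apply/eqP.
  rewrite eq_le (dens_ge0 law) // andbT leNgt; apply/negP => h; by apply: nc; left.
rewrite eq_le (atom_ge0 law) // andbT leNgt; apply/negP => h; by apply: nc; right.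
Qed.

Lemma cdfT_flat s t : 0 <= s -> s <= t -> (forall r, s < r -> r <= t -> uncharged r) ->
  cdfT F t = cdfT F s.
Proof.
move=> s0 st H; rewrite !cdfTE; congr (_ + _).
  by apply: primB_eq0 => // [|r sr rt]; [exact: locint_dens|have [] := H r sr rt].
apply/eqP; rewrite -subr_eq0 (jumpB law) //; last by apply: nneg_bounded1; exact: seg_pos.
apply/eqP; apply: jumps_eq0 => r /=; rewrite in_itv /= => /andP[sr rt].
by have [_ ->] := H r sr rt; rewrite mul0r.
Qed.

Lemma tmass_flat t : (forall r, t < r -> 0 <= r -> uncharged r) -> tmass = cdfT F t.
Proof.
move=> H; rewrite /tmass /cdfT; apply: flow_supp => //; first exact: itv0_sub.
by move=> r tr r0; have [-> ->] := H r tr r0; rewrite !mul0r addr0.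
Qed.

Lemma tmass0 : (forall r, 0 <= r -> uncharged r) -> tmass = 0.
Proof.
move=> H; rewrite (@tmass_flat 0) ?cdfT0; first by have [] := H 0 (lexx 0).
by move=> r r0 _; apply: H; exact: ltW.
Qed.

(** The two parts are passed to the limit one after the other: the atoms are cut at a horizon [s],
    the horizon of the density part tends to infinity, and then the supremum over finite sets of
    atoms is taken. *)
Lemma flow_oo_le (k0 k1 : R -> R) B T :
  locint (fun r => k0 r + dens F r * k1 r) ->
  (forall r, 0 <= r -> 0 <= k0 r + dens F r * k1 r) -> nneg_bounded pos k1 ->
  (forall t, T <= t -> flow F `[0, t] k0 k1 <= B) ->
  flow F pos k0 k1 <= B.
Proof.
move=> lk k00 gk HB; rewrite {1}/flow -/(jumps F pos k1).
have gs t : nneg_bounded `[0, t] k1 by apply: nneg_boundedS gk; exact: seg_pos.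
have jn s t : 0 <= s -> s <= t -> jump F k1 s <= jump F k1 t.
  move=> s0 st; rewrite -subr_ge0 (jumpB law) //; apply: jumps_ge0 => //.
  by apply: nneg_boundedS gk; exact: oc_pos.
have H1 s : 0 <= s -> \int[leb]_(x in pos) (k0 x + dens F x * k1 x) <= B - jump F k1 s.
  move=> s0; apply: (@prim_oo_le _ _ (Num.max s T)) => // t.
  rewrite ge_max => /andP[st Tt]; have := HB t Tt; rewrite flowE.
  have := jn _ _ s0 st; lra.
set I := \int[_]_(_ in _) _ in H1 *.
rewrite -lerBrDl -lee_fin /jumps fineK; last exact: jumps_fin.
apply: ge_ereal_sup => _ [A [fA As] <-].
have [s s0 sA] : exists2 s, 0 <= s & A `<=` `[0, s].
  have /finite_seqP [l lE] := fA.
  have {As} : forall r, r \in l -> 0 <= r.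
    by move=> r rl; have := As r; rewrite lE posP; exact.
  rewrite lE => {lE}; elim: l => [_|x l IH H]; first by exists 0.
  have [|d d0 dl] := IH; first by move=> r rl; apply: H; rewrite in_cons rl orbT.
  have x0 : 0 <= x by apply: H; rewrite in_cons eqxx.
  exists (Num.max x d); first by rewrite le_max x0.
  move=> r /=; rewrite in_cons in_itv /= => /orP[/eqP ->|/dl /=].
    by rewrite x0 le_max lexx.
  by rewrite in_itv /= => /andP[-> rd]; rewrite le_max rd orbT.
have := H1 s s0 => H2.
apply: (@le_trans _ _ (jump F k1 s)%:E); last by rewrite lee_fin; lra.
rewrite /jump /jumps fineK; last exact: jumps_fin.
by apply: ereal_sup_ubound; exists A.
Qed.

(** Integration by parts. Over [a, b] the Stieltjes increment lies between [K b] and [K a] times the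
    increment of the CDF, so the error is at most a multiple of (b - a) times that increment: the
    telescoping works with the CDF itself as the function [m], despite its jumps. *)
Lemma stieltjes_parts K k L s t : 0 <= s -> s <= t -> locint k -> meas_pos K -> locbnd K ->
  (forall r, 0 <= r -> `|k r| <= L) -> (forall r, 0 <= r -> 0 <= K r) ->
  (forall r q, 0 <= r -> r <= q -> K q <= K r) ->
  (forall r q, 0 <= r -> r <= q -> K q - K r = prim k q - prim k r) ->
  K t * cdfT F t - K s * cdfT F s =
  prim (fun r => k r * cdfT F r) t - prim (fun r => k r * cdfT F r) s + (stieltjes K t -
    stieltjes K s).
Proof.
move=> s0 st lk mK bK kL K0 Kd HK.
have lkF : locint (fun r => k r * cdfT F r) by apply: locintM => //; [exact: meas_cdf|exact:
  locbnd_cdf].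
set z := fun r => k r * cdfT F r.
suff : K t * cdfT F t - prim z t - stieltjes K t = K s * cdfT F s - prim z s - stieltjes K s by lra.
have L0 : 0 <= L by apply: le_trans (kL 0 (lexx _)).
apply: (@small_increments_eq _ (fun r => K r * cdfT F r - prim z r - stieltjes K r) (cdfT F)
  s t (2 * L) st).
move=> a b sa ab bt.
have a0 : 0 <= a by exact: le_trans sa.
have b0 : 0 <= b by exact: le_trans ab.
have Fab := cdfT_nondecr a0 ab.
have dK : K a - K b <= L * (b - a).
  rewrite -opprB HK // lerNl -mulNr; apply: primB_ge => // r ar rb.
  by rewrite -lerN2 opprK; apply: le_trans (kL r _); [rewrite -normrN ler_norm|lra].
have h1 : stieltjes K b - stieltjes K a <= K a * (cdfT F b - cdfT F a).
  by apply: stieltjesB_le => //; [exact: K0|move=> r ar rb; apply: Kd => //; exact: ltW].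
have h2 : K b * (cdfT F b - cdfT F a) <= stieltjes K b - stieltjes K a.
  by apply: stieltjesB_ge => //; [exact: K0|move=> r ar rb; apply: Kd => //; lra].
have h3 : `|prim (fun r => z r - cdfT F a * k r) b - prim (fun r => z r - cdfT F a * k r) a|
   <= L * (cdfT F b - cdfT F a) * (b - a).
  apply: primB_norm => //; first by apply: locintB => //; exact: locintZ.
  move=> r ar rb; rewrite /z (mulrC _ (k r)) -mulrBr normrM.
  apply: ler_pM => //; first by apply: kL; lra.
  rewrite ger0_norm ?subr_ge0 ?cdfT_nondecr //; try lra.
  by rewrite lerD2r cdfT_nondecr //; lra.
rewrite !primBfun ?primZ // in h3; try exact: locintZ.
have h4 := HK a b a0 ab.
have : (K a - K b) * (cdfT F b - cdfT F a) <= L * (b - a) * (cdfT F b - cdfT F a).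
  by rewrite ler_wpM2r // subr_ge0.
move: h3; rewrite !ler_norml => /andP[h5 h6] h7.
have e1 : cdfT F a * (K b - K a) = cdfT F a * (prim k b - prim k a) by rewrite h4.
apply/andP; split; lra.
Qed.

End Law.
End Cdf.

(** * Payoffs *)

Section Primitives.
Local Open Scope classical_set_scope.
Context {R : realType}.
Notation leb := (@lebesgue_measure R).
Variable p : primitives R.
Hypothesis hp : standing p.
Implicit Types (r s t c : R) (F : timing R) (E : profile R).

Local Notation h := (hazard p).

Definition disc t := expR (- rho p * t) * (1 - G p t).
Local Notation K := disc.

Let nw := news hp.

Lemma params : [/\ 0 < rho p, 0 < beta p, beta p < mu p, mu p < theta p & theta p < 1].
Proof.
by case: hp => /andP[_ ?] /andP[? _] /andP[? ?] ? *.
Qed.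

Lemma Gbar_gt0 t : 0 < 1 - G p t.
Proof. by rewrite subr_gt0 (G_lt1 nw). Qed.

Lemma g_hazard t : g p t = h t * (1 - G p t).
Proof. by rewrite /hazard divfK // gt_eqF // Gbar_gt0. Qed.

Lemma hazard_ge0 t : 0 <= t -> 0 <= h t.
Proof. by move=> t0; rewrite /hazard divr_ge0 ?(g_ge0 nw) // ltW // Gbar_gt0. Qed.

Lemma hazard_le0 t : 0 <= t -> h t <= h 0.
Proof. by move=> t0; exact: hazard_decr hp _ _ (lexx 0) t0. Qed.

Lemma G_ge0 t : 0 <= t -> 0 <= G p t.
Proof.
move=> t0; rewrite -lee_fin -(G_density nw t0); apply: integral_ge0 => r /=.
by rewrite in_itv /= lee_fin => /andP[r0 _]; exact: (g_ge0 nw).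
Qed.

Lemma Gbar_le1 t : 0 <= t -> 1 - G p t <= 1.
Proof. by move=> t0; rewrite gerBl G_ge0. Qed.

Lemma g_le t : 0 <= t -> g p t <= h 0.
Proof.
move=> t0; rewrite g_hazard; have := hazard_ge0 t0; have := hazard_le0 t0.
have := Gbar_le1 t0; have := Gbar_gt0 t; nra.
Qed.

Lemma locint_g : locint (g p).
Proof.
apply: (@meas_locint _ (g p) (h 0)); first exact: g_measurable nw.
by move=> r r0; rewrite ger0_norm ?g_le // (g_ge0 nw).
Qed.

Lemma G_prim t : 0 <= t -> G p t = prim (g p) t.
Proof. by move=> t0; rewrite /prim /Rintegral (G_density nw t0). Qed.

Lemma G0 : G p 0 = 0.
Proof. by rewrite G_prim // prim0. Qed.

Lemma G_nondecr s t : 0 <= s -> s <= t -> G p s <= G p t.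
Proof.
move=> s0 st; rewrite !G_prim // ?(le_trans s0) //; apply: prim_nondecr => //.
  exact: locint_g.
by move=> r sr _; apply: (g_ge0 nw); exact: (le_trans s0 (ltW sr)).
Qed.

Lemma meas_hazard : meas_pos h.
Proof. by apply: meas_antihomo => s t; exact: (hazard_decr hp). Qed.

Lemma hazard_norm t : 0 <= t -> `|h t| <= h 0.
Proof. by move=> t0; rewrite ger0_norm ?hazard_ge0 // hazard_le0. Qed.

Lemma locint_hazard : locint h.
Proof. exact: (meas_locint meas_hazard hazard_norm). Qed.

Lemma disc_gt0 t : 0 < K t.
Proof. by rewrite /disc mulr_gt0 ?expR_gt0 ?Gbar_gt0. Qed.

Lemma disc0 : K 0 = 1.
Proof. by rewrite /disc mulr0 expR0 G0 subr0 mulr1. Qed.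

Lemma disc_antihomo s t : 0 <= s -> s <= t -> K t <= K s.
Proof.
have [r0 _ _ _ _] := params => s0 st; rewrite /disc; apply: ler_pM.
- exact: expR_ge0.
- exact: ltW (Gbar_gt0 _).
- by rewrite ler_expR !mulNr lerN2 ler_pM2l.
- by rewrite lerD2l lerN2 G_nondecr.
Qed.

Lemma disc_le1 t : 0 <= t -> K t <= 1.
Proof. by move=> t0; rewrite -disc0 disc_antihomo. Qed.

Lemma disc_norm t : 0 <= t -> `|K t| <= 1.
Proof. by move=> t0; rewrite gtr0_norm ?disc_le1 // disc_gt0. Qed.

Lemma meas_disc : meas_pos K.
Proof. by apply: meas_antihomo => s t; exact: disc_antihomo. Qed.

Lemma locbnd_disc : locbnd K.
Proof. by apply: bounded_locbnd => r; exact: disc_norm. Qed.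

Lemma locint_discM f : meas_pos f -> locbnd f -> locint (fun r => K r * f r).
Proof.
move=> mf bf; apply: locint_bnd; first exact: measM meas_disc mf.
exact: locbndM locbnd_disc bf.
Qed.

(** Logarithmic derivative of [disc]: impatience plus the arrival rate of news. *)
Definition discrate t := - (rho p + h t).

Lemma meas_discrate : meas_pos discrate.
Proof.
by apply: (measurable_funN (measD (meas_cst _) meas_hazard)).
Qed.

Lemma discrate_norm t : 0 <= t -> `|discrate t| <= rho p + h 0.
Proof.
have [r0 _ _ _ _] := params => t0; rewrite /discrate normrN ger0_norm.
  by rewrite lerD2l hazard_le0.
by rewrite addr_ge0 ?hazard_ge0 // ltW.
Qed.

Lemma locint_discrate : locint discrate.
Proof. exact: (meas_locint meas_discrate discrate_norm). Qed.

Lemma disc_primB s t : 0 <= s -> s <= t ->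
  K t - K s = prim (fun r => discrate r * K r) t - prim (fun r => discrate r * K r) s.
Proof.
have [rp _ _ _ _] := params => s0 st.
(* Discounting is written as exp of a primitive, so that [exp_rule] supplies its increments to the
   product rule. *)
pose k := fun _ : R => - rho p; pose X r := expR (prim k r).
have pk r : 0 <= r -> prim k r = - rho p * r by exact: prim_cst.
have lk : locint k by exact: locint_cst.
pose x r := k r * X r; pose y r := - g p r; pose Y r := 1 - G p r.
have XE r : 0 <= r -> X r = expR (- rho p * r) by move=> r0; rewrite /X pk.
have cX : continuous X.
  move=> z; apply: continuous_comp; first exact: prim_continuous.
  exact: continuous_expR.
have lx : locint x by exact: locintMc.
have ly : locint y by exact: locintN locint_g.
have E r : 0 <= r -> x r * Y r + X r * y r = discrate r * K r.
  move=> r0; rewrite /x XE // /k /y /Y /disc /discrate g_hazard; ring.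
have lz : locint (fun r => discrate r * K r).
  exact: locintM locint_discrate meas_disc locbnd_disc.
have lxy : locint (fun r => x r * Y r + X r * y r).
  by apply: (locint_eq lz) => r r0; rewrite E.
have -> : K t - K s = X t * Y t - X s * Y s.
  by rewrite !XE // (le_trans s0).
rewrite (@prod_rule _ X Y x y s t (rho p + h 0) s0 st lx ly lxy).
- by congr (_ - _); apply: eq_prim => r r0 _; exact: E.
- move=> r sr rt; have r0 := le_trans s0 sr; have h0 := le_trans (hazard_ge0 r0) (hazard_le0 r0).
  have h1 := ltW rp; split.
    have -> : `|x r| = rho p * expR (- rho p * r).
      by rewrite /x XE // /k normrM normrN (gtr0_norm rp) (ger0_norm (expR_ge0 _)).
    have : expR (- rho p * r) <= 1 by rewrite -expR0 ler_expR mulNr oppr_le0 mulr_ge0.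
    have := expR_ge0 (- rho p * r); nra.
  by rewrite /y normrN ger0_norm ?(g_ge0 nw) //; have := g_le r0; lra.
- move=> a b sa ab bt; have a0 := le_trans s0 sa.
  apply: (@exp_rule _ k (rho p)) => //.
  by move=> r r0 rb; rewrite /k normrN gtr0_norm.
- move=> a b sa ab bt; have a0 := le_trans s0 sa; have b0 := le_trans a0 ab.
  rewrite /Y !G_prim // !primN //; try exact: locint_g; ring.
Qed.

Lemma disc_exp s t : 0 <= s -> s <= t -> K t = K s * expR (prim discrate t - prim discrate s).
Proof.
have [rp _ _ _ _] := params => s0 st.
apply: (@linear_ode _ discrate K (1 + rho p + h 0)) => //.
- exact: locint_discrate.
- by move=> r r0 _; apply: le_trans (discrate_norm r0) _; lra.
- exact: locintM locint_discrate meas_disc locbnd_disc.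
- move=> r sr _; have r0 := le_trans s0 sr; apply: le_trans (disc_norm r0) _.
  by have := le_trans (hazard_ge0 r0) (hazard_le0 r0); lra.
- by move=> a b sa ab bt; apply: disc_primB => //; exact: le_trans sa.
Qed.

(** Since the hazard rate is nonincreasing, a zero of it would freeze [G] from then on at a value
    below 1, against its limit. *)
Lemma hazard_gt0 t : 0 <= t -> 0 < h t.
Proof.
move=> t0; rewrite lt_neqAle hazard_ge0 // andbT eq_sym; apply/eqP => ht.
have Gt s : t <= s -> G p s = G p t.
  move=> ts; rewrite !G_prim // ?(le_trans t0) //; apply: primB_eq0 => //.
    exact: locint_g.
  move=> r tr _; rewrite g_hazard.
  have := hazard_decr hp t0 (ltW tr); have := hazard_ge0 (le_trans t0 (ltW tr)).
  by rewrite ht => a b; have -> : h r = 0; [lra|exact: mul0r].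
have c : G p s @[s --> +oo] --> G p t.
  apply: cvg_near_cst; near=> s; apply: Gt.
  by near: s; apply: nbhs_pinfty_ge; exact: num_real.
have := cvg_unique (@Rhausdorff R) c (G_infty nw) => G1.
by have := G_lt1 nw t; rewrite G1 ltxx.
Unshelve. all: by end_near.
Qed.

Section Survival.
Variable F : timing R.
Hypothesis law : timing_law F.
Variable c : R.
Hypothesis c01 : 0 <= c <= 1.

(** The weight [c] is the probability that the timed event is present at all: [sigma] for faking, 1
    for stopping. *)
Definition surv t := 1 - c * cdfT F t.

Lemma surv_itv t : 0 <= t -> 0 <= surv t <= 1.
Proof.
move=> t0; have := cdfT_ge0 law t0; have := cdfT_le1 law t; move: c01 => /andP[a b] u v.
rewrite /surv; apply/andP; split; nra.
Qed.

Lemma surv_norm t : 0 <= t -> `|surv t| <= 1.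
Proof. by move=> /surv_itv /andP[a b]; rewrite ger0_norm. Qed.

Lemma surv_antihomo s t : 0 <= s -> s <= t -> surv t <= surv s.
Proof.
move=> s0 st; rewrite /surv lerD2l lerN2; case/andP: c01 => c0 _.
by rewrite ler_wpM2l // cdfT_nondecr.
Qed.

Lemma meas_surv : meas_pos surv.
Proof. by apply: meas_antihomo => s t; exact: surv_antihomo. Qed.

Lemma locbnd_surv : locbnd surv.
Proof. by apply: bounded_locbnd => r; exact: surv_norm. Qed.

Definition dsurv t := K t * surv t.

Lemma meas_dsurv : meas_pos dsurv.
Proof. exact: measM meas_disc meas_surv. Qed.

Lemma locbnd_dsurv : locbnd dsurv.
Proof. exact: locbndM locbnd_disc locbnd_surv. Qed.

Lemma locint_dsurv : locint dsurv.
Proof. exact: locint_bnd meas_dsurv locbnd_dsurv. Qed.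

Lemma dsurv_itv t : 0 <= t -> 0 <= dsurv t <= 1.
Proof.
move=> t0; have /andP[a b] := surv_itv t0.
have := disc_le1 t0; have := disc_gt0 t => u v; rewrite /dsurv; apply/andP; split; nra.
Qed.

Lemma locintM_dsurv k : locint k -> locint (fun r => k r * dsurv r).
Proof. by move=> lk; apply: locintM lk meas_dsurv locbnd_dsurv. Qed.

Lemma stieltjes0 w : 0 <= w 0 -> stieltjes F w 0 = atom F 0 * w 0.
Proof. by move=> w0; rewrite /stieltjes prim0 add0r jump0. Qed.

(** Two sources of decay: [discrate] acts continuously, and the law removes c K dF, atoms included;
    the latter is obtained by parts. *)
Lemma dsurv_primB s t : 0 <= s -> s <= t ->
  dsurv t - dsurv s =
  prim (fun r => discrate r * dsurv r) t - prim (fun r => discrate r * dsurv r) s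
  - c * (stieltjes F K t - stieltjes F K s).
Proof.
move=> s0 st.
have lK : locint (fun r => discrate r * K r) by exact:
  locintM locint_discrate meas_disc locbnd_disc.
have lKF : locint (fun r => discrate r * K r * cdfT F r).
  exact: locintM lK (meas_cdf law) (locbnd_cdf law).
have H := @stieltjes_parts _ F law K (fun r => discrate r * K r) (rho p + h 0)
  s t s0 st lK meas_disc locbnd_disc.
have {}H : K t * cdfT F t - K s * cdfT F s =
    prim (fun r => discrate r * K r * cdfT F r) t - prim (fun r => discrate r * K r * cdfT F r) s
    + (stieltjes F K t - stieltjes F K s).
  apply: H => [r r0|r r0|r q r0 rq|r q r0 rq].
  - rewrite normrM; have := discrate_norm r0; have := disc_norm r0.
    have := normr_ge0 (discrate r); have := normr_ge0 (K r); nra.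
  - exact: ltW (disc_gt0 _).
  - exact: disc_antihomo.
  - exact: disc_primB.
have P q : prim (fun r => discrate r * dsurv r) q =
    prim (fun r => discrate r * K r) q - c * prim (fun r => discrate r * K r * cdfT F r) q.
  rewrite -primZ // -primBfun //; last exact: locintZ.
  apply: eq_prim => r _ _; rewrite /dsurv /surv; ring.
rewrite !P /dsurv /surv; have := disc_primB s0 st.
rewrite !mulrBr !mulr1 ![K _ * (c * _)]mulrCA => H1.
have H2 : c * (K t * cdfT F t - K s * cdfT F s) = c * (
   prim (fun r => discrate r * K r * cdfT F r) t - prim (fun r => discrate r * K r * cdfT F r) s
    + (stieltjes F K t - stieltjes F K s)) by rewrite H.
move: H1 H2; lra.
Qed.

(* Both sides are the expected discount factor at the earliest of the arrival of news, the
   event timed by [F] (present with probability [c]) and [t]. *)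
Lemma discounted_total t : 0 <= t ->
  prim (fun r => h r * dsurv r) t + c * stieltjes F K t + dsurv t =
  1 - rho p * prim dsurv t.
Proof.
move=> t0; have := dsurv_primB (lexx 0) t0; rewrite !prim0.
rewrite stieltjes0 ?disc0 // mulr1 {2}/dsurv disc0 mul1r /surv cdfT0 // => H.
have -> : rho p * prim dsurv t =
  - prim (fun r => discrate r * dsurv r) t - prim (fun r => h r * dsurv r) t.
  rewrite -primN; last exact: locintM_dsurv locint_discrate.
  rewrite -primBfun; last 2 first.
  - by apply: locintN; exact: locintM_dsurv locint_discrate.
  - exact: locintM_dsurv locint_hazard.
  rewrite -primZ; last exact: locint_dsurv.
  by apply: eq_prim => r _ _; rewrite /discrate; ring.
lra.
Qed.

End Survival.

End Primitives.

(** * Integrated forms of the two payoffs *)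

Section Payoffs.
Local Open Scope classical_set_scope.
Context {R : realType}.
Notation leb := (@lebesgue_measure R).
Variable p : primitives R.
Hypothesis hp : standing p.
Variable sigma : R.
Hypothesis sigma01 : 0 < sigma < 1.
Variable E : profile R.
Hypothesis sE : strategies E.
Implicit Types (r s t c : R).

Local Notation h := (hazard p).
Local Notation K := (disc p).
Local Notation a := (accept E).
Local Notation Y := (dsurv p (stop E) 1).
Local Notation Z := (dsurv p (fake E) sigma).
Local Notation S := (surv (fake E) sigma).
Local Notation f := (dens (fake E)).

Let sl := stop_law sE.
Let fl := fake_law sE.

Lemma one01 : 0 <= (1 : R) <= 1. Proof. by rewrite ler01 lexx. Qed.

Lemma sigma01w : 0 <= sigma <= 1.
Proof. by case/andP: sigma01 => *; rewrite !ltW. Qed.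

Lemma upto_fin t : upto t%:E = `[0, t] :> set R.
Proof. by apply/seteqP; split => r /=; rewrite in_itv /= ?lee_fin => /andP. Qed.

Lemma upto_oo : upto +oo%E = `[0, +oo[ :> set R.
Proof.
apply/seteqP; split => r; first by move=> [r0 _]; rewrite /= in_itv /= r0.
by rewrite /= in_itv /= andbT => r0; split => //; exact: leey.
Qed.

Lemma accept_norm r : 0 <= r -> `|a r| <= 1.
Proof. by move=> /(accept_itv sE) /andP[a0 a1]; rewrite ger0_norm. Qed.

Lemma meas_accept : meas_pos a. Proof. exact: accept_measurable sE. Qed.

Lemma locbnd_accept : locbnd a.
Proof. by apply: bounded_locbnd => r; exact: accept_norm. Qed.

Lemma locintM_accept k : locint k -> locint (fun r => a r * k r).
Proof.
move=> lk; apply: (locint_eq (locintM lk meas_accept locbnd_accept)) => r _.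
exact: mulrC.
Qed.

Lemma nneg_bounded_disc t : nneg_bounded `[0, t] K.
Proof.
apply: (@nneg_bounded_seg _ _ t 1) => r r0 _.
by rewrite (disc_le1 hp) // ltW // (disc_gt0 hp).
Qed.

Lemma jump_discZ F c t : timing_law F -> 0 <= c -> jump F (fun r => c * K r) t = c * jump F K t.
Proof. by move=> lF c0; rewrite /jump jumpsZ //; exact: nneg_bounded_disc. Qed.

Lemma locint_hY : locint (fun r => h r * Y r).
Proof. exact: (locintM_dsurv hp sl one01 (locint_hazard hp)). Qed.

Lemma locint_hZ : locint (fun r => h r * Z r).
Proof. exact: (locintM_dsurv hp fl sigma01w (locint_hazard hp)). Qed.

Lemma locint_densK F : timing_law F -> locint (fun r => dens F r * K r).
Proof. by move=> lF; exact: locintM (locint_dens lF) (meas_disc hp) (locbnd_disc hp). Qed.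

(** By [discounted_total], receiving [beta] whenever the game ends is worth beta (1 - rho prim Y t).
    On top come the premium 1 - beta on accepted true news and the premium mu - beta on an accepted
    fake at [t]. *)
Lemma uA_fin t : 0 <= t ->
  uA p E t%:E = beta p * (1 - rho p * prim Y t)
    + mu p * (1 - beta p) * prim (fun r => a r * (h r * Y r)) t
    + (mu p - beta p) * (a t * Y t).
Proof.
move=> t0; have [_ b0 _ _ _] := params hp.
rewrite /uA upto_fin flowE.
rewrite (eq_prim (g := fun r => beta p * (h r * Y r)
   + (mu p * (1 - beta p) * (a r * (h r * Y r)) + beta p * (dens (stop E) r * K r)))); last first.
  by move=> r r0 _; rewrite (g_hazard hp) /dsurv /surv /disc; ring.
rewrite [jump _ _ t](_ : _ = beta p * jump (stop E) K t); last first.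
  rewrite -jump_discZ //; last exact: ltW.
  by apply: eq_jumps => r _; rewrite /disc; ring.
have l1 := locint_hY; have l2 := locintM_accept l1; have l3 := locint_densK sl.
have l4 := locintZ (mu p * (1 - beta p)) l2.
have l5 := locintZ (beta p) l3.
rewrite primD; [|exact: locintZ|exact: locintD].
rewrite primD // !primZ //.
have := discounted_total hp sl one01 t0; rewrite /stieltjes mul1r.
have -> : expR (- rho p * t) * ((1 - G p t) * (1 - cdfT (stop E) t)) = Y t.
  by rewrite /dsurv /surv /disc mul1r mulrA.
move=> H; rewrite -H; ring.
Qed.

Lemma surv_gt0 r : 0 <= r -> 0 < S r.
Proof.
move=> r0; rewrite /surv; have := cdfT_ge0 fl r0; have := cdfT_le1 fl r.
case/andP: sigma01 => s0 s1; nra.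
Qed.

(** Positive even without fakes, because the hazard rate never vanishes and [sigma < 1]; the
    quotient in [mu1] is thus never a division by 0. *)
Lemma mu1_den_gt0 r : 0 <= r ->
  0 < mu p * g p r * S r + sigma * f r * (1 - G p r).
Proof.
move=> r0; have [_ b0 bm _ _] := params hp; have m0 := lt_trans b0 bm.
apply: ltr_wpDr.
  by rewrite !mulr_ge0 ?(dens_ge0 fl) // ltW ?(Gbar_gt0 hp) //; case/andP: sigma01.
by rewrite !mulr_gt0 // ?surv_gt0 // (g_hazard hp) mulr_gt0 ?(hazard_gt0 hp) // (Gbar_gt0 hp).
Qed.

Lemma mu1_noatom r : 0 <= r -> atom (fake E) r = 0 ->
  mu1 p sigma E r * (mu p * g p r * S r + sigma * f r * (1 - G p r)) =
  mu p * g p r * S r + mu p * sigma * f r * (1 - G p r).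
Proof.
move=> r0 at0; rewrite /mu1 at0 ltxx divfK // gt_eqF //.
exact: mu1_den_gt0.
Qed.

Lemma mu1_itv r : 0 <= r -> 0 <= mu1 p sigma E r <= 1.
Proof.
move=> r0; have [_ b0 bm mt t1] := params hp; have m0 := lt_trans b0 bm.
rewrite /mu1; case: ifPn => _; first by rewrite ltW //=; lra.
have d0 := mu1_den_gt0 r0; have f0 := dens_ge0 fl r0; have S0 := surv_gt0 r0.
have g0 : 0 <= g p r by rewrite (g_ge0 (news hp)).
have G1 := Gbar_gt0 hp r; case/andP: sigma01 => s0 _.
have fG : 0 <= sigma * f r * (1 - G p r) by rewrite !mulr_ge0 // ltW.
apply/andP; split.
  apply: divr_ge0; last exact: ltW.
  by apply: addr_ge0; rewrite ?mulr_ge0 // ltW.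
rewrite ler_pdivrMr // mul1r lerD2l -!(mulrA (mu p)) ler_piMl //; lra.
Qed.

(* Principal's flow gain from accepting type-1 news rather than rejecting it. *)
Definition accept_gain r :=
  mu p * (1 - theta p) * (h r * Z r) - (theta p - mu p) * sigma * (f r * K r).

Lemma locint_gain : locint accept_gain.
Proof.
by apply: locintB; apply: locintZ; [exact: locint_hZ|exact: locint_densK].
Qed.

(** Stated as a hypothesis to serve two cases: in an equilibrium the posterior at an atom is [mu p],
    below [theta p], and the profile constructed later has no atoms of faking. *)
Hypothesis reject_atom : forall r, 0 <= r -> 0 < atom (fake E) r -> a r = 0.

Let v r := (1 - a r) * theta p + a r * mu1 p sigma E r.

(** Off the atoms, multiplying [mu1] by its denominator clears the quotient and acceptance enters
    only through [accept_gain]; at the atoms acceptance is 0. *)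
Lemma uP_integrand r : 0 <= r ->
  expR (- rho p * r) * ((1 - mu p) * g p r * S r * theta p + mu p * g p r * S r * v r)
  + f r * (expR (- rho p * r) * (sigma * (1 - G p r) * v r))
  = theta p * (h r * Z r) + (theta p * sigma * (f r * K r) + a r * accept_gain r).
Proof.
move=> r0; have at0 := atom_ge0 fl r0.
have [at1|at1] := eqVneq (atom (fake E) r) 0.
  have H := mu1_noatom r0 at1.
  rewrite /v /accept_gain /dsurv /disc; move: H; rewrite (g_hazard hp).
  set e := expR _; set m := mu1 _ _ _ _; set S' := S r; set Gb := 1 - G p r => H.
  have {}H : a r * e * (m * (mu p * (h r * Gb) * S' + sigma * f r * Gb)) =
     a r * e * (mu p * (h r * Gb) * S' + mu p * sigma * f r * Gb) by rewrite H.
  lra.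
have a0 : a r = 0 by apply: reject_atom => //; rewrite lt_neqAle eq_sym at1.
rewrite /v /accept_gain a0 /dsurv /disc (g_hazard hp); ring.
Qed.

Lemma atom_v r : 0 <= r -> atom (fake E) r * v r = atom (fake E) r * theta p.
Proof.
move=> r0; have at0 := atom_ge0 fl r0.
have [at1|at1] := eqVneq (atom (fake E) r) 0; first by rewrite at1 !mul0r.
have a0 : a r = 0 by apply: reject_atom => //; rewrite lt_neqAle eq_sym at1.
by rewrite /v a0; ring.
Qed.

Lemma locint_uP : locint (fun r => theta p * (h r * Z r) + (theta p * sigma * (f r * K r)
  + a r * accept_gain r)).
Proof.
apply: locintD; first exact: locintZ locint_hZ.
apply: locintD; first exact: locintZ (locint_densK fl).
exact: locintM_accept locint_gain.
Qed.

Let k0 r := expR (- rho p * r) * ((1 - mu p) * g p r * S r * theta p + mu p * g p r * S r * v r).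
Let k1 r := expR (- rho p * r) * (sigma * (1 - G p r) * v r).

Lemma flow_uP t : 0 <= t -> flow (fake E) `[0, t] k0 k1 =
  theta p * (1 - rho p * prim Z t) + prim (fun r => a r * accept_gain r) t - theta p * Z t.
Proof.
move=> t0; rewrite flowE.
rewrite (eq_prim (g := fun r => theta p * (h r * Z r) + (theta p * sigma * (f r * K r)
  + a r * accept_gain r))); last first.
  by move=> r r0 _; exact: uP_integrand.
have [_ b0 bm mt t1] := params hp; case/andP: sigma01 => s0 _.
have ts : 0 <= theta p * sigma by rewrite mulr_ge0 //; lra.
rewrite [jump _ _ t](_ : _ = theta p * sigma * jump (fake E) K t); last first.
  rewrite -jump_discZ //.
  apply: eq_jumps => r; rewrite /= in_itv /= => /andP[r0 _].
  transitivity (expR (- rho p * r) * (sigma * (1 - G p r)) * (atom (fake E) r * v r)).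
    by rewrite /k1; ring.
  by rewrite atom_v // /disc; ring.
have l1 := locint_hZ; have l2 := locintM_accept locint_gain; have l3 := locint_densK fl.
have l4 := locintZ (theta p * sigma) l3.
rewrite primD; [|exact: locintZ|exact: locintD].
rewrite primD // !primZ //.
rewrite -(discounted_total hp fl sigma01w t0) /stieltjes; ring.
Qed.

Lemma uP_fin t : 0 <= t ->
  uP p sigma E t%:E = theta p * (1 - rho p * prim Z t) + prim (fun r => a r * accept_gain r) t.
Proof.
move=> t0; rewrite /uP upto_fin.
have := flow_uP t0; rewrite /k0 /k1 /v /surv => H.
rewrite [X in X + _]H /dsurv /surv /disc; ring.
Qed.

(** The payoff from never stopping is the limit of the flows up to [t], and each of these is at most
    the payoff from stopping at [t], since the terminal payment is nonnegative. *)
Lemma uP_oo_le B T : (forall t, T <= t -> uP p sigma E t%:E <= B) ->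
  uP p sigma E +oo%E <= B.
Proof.
move=> HB; have [_ b0 bm mt t1] := params hp; case/andP: (sigma01) => s0 s1.
have v01 r : 0 <= r -> 0 <= v r <= 1.
  move=> r0; have /andP[m0 m1] := mu1_itv r0; have /andP[a0 a1] := accept_itv sE r0.
  by rewrite /v; apply/andP; split; nra.
rewrite /uP upto_oo addr0.
apply: (@flow_oo_le _ _ fl k0 k1 B (Num.max T 0)).
- by apply: (locint_eq locint_uP) => r r0; rewrite uP_integrand.
- move=> r r0; have /andP[v0 _] := v01 r r0; have S0 := ltW (surv_gt0 r0).
  have g0 : 0 <= g p r by rewrite (g_ge0 (news hp)).
  have G1 := ltW (Gbar_gt0 hp r); have f0 := dens_ge0 fl r0.
  have e0 := expR_ge0 (- rho p * r).
  have t0 : 0 <= theta p by lra.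
  have m0 : 0 <= mu p by lra.
  have m1 : 0 <= 1 - mu p by lra.
  apply: addr_ge0; last by rewrite /k1 !mulr_ge0 // ltW.
  by rewrite /k0 mulr_ge0 // addr_ge0 // !mulr_ge0.
- exists 1 => r; rewrite posP => r0; split => //.
  have -> : k1 r = K r * (sigma * v r) by rewrite /k1 /disc; ring.
  have := disc_le1 hp r0; have := disc_gt0 hp r; have /andP[v0 v1] := v01 r r0.
  have sv0 : 0 <= sigma * v r by rewrite mulr_ge0 // ltW.
  have sv1 : sigma * v r <= 1 by nra.
  by move=> c1 c2; apply/andP; split; nra.
- move=> t; rewrite ge_max => /andP[Tt t0].
  rewrite flow_uP //; have := HB t Tt; rewrite uP_fin //.
  have /andP[Z0 _] := dsurv_itv hp fl sigma01w t0.
  have : 0 <= theta p * Z t by rewrite mulr_ge0 //; lra.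
  lra.
Qed.

End Payoffs.

(** * Comparison of primitives on open intervals and strict monotonicity *)

Section Strict.
Local Open Scope classical_set_scope.
Context {R : realType}.
Notation leb := (@lebesgue_measure R).
Implicit Types (f g : R -> R) (s t r c : R).

Lemma primB_oo s t f : locint f -> 0 <= s -> s <= t ->
  prim f t - prim f s = \int[leb]_(x in `]s, t[) f x.
Proof.
move=> lf s0 st; rewrite primB // Rintegral_itv_bndo_bndc //.
apply: integrableS (lf t) => //; apply: subset_trans (oc_sub s0).
by move=> r /=; rewrite !in_itv /= => /andP[-> /ltW].
Qed.

Lemma le_primBo f g s t : locint f -> locint g -> 0 <= s -> s <= t ->
  (forall r, s < r -> r < t -> f r <= g r) ->
  prim f t - prim f s <= prim g t - prim g s.
Proof.
move=> lf lg s0 st fg; rewrite !primB_oo //.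
have sub : `]s, t[ `<=` `[0, t].
  move=> r /=; rewrite !in_itv /= => /andP[sr /ltW ->]; rewrite andbT.
  by rewrite ltW // (le_lt_trans s0 sr).
apply: le_Rintegral => //.
- by apply: integrableS (lf t).
- by apply: integrableS (lg t).
- by move=> r /=; rewrite in_itv /= => /andP[r0 rt]; exact: fg.
Qed.

Lemma eq_primBo f g s t : locint f -> locint g -> 0 <= s -> s <= t ->
  (forall r, s < r -> r < t -> f r = g r) ->
  prim f t - prim f s = prim g t - prim g s.
Proof.
move=> lf lg s0 st fg; apply/eqP; rewrite eq_le.
by apply/andP; split; apply: le_primBo => // r sr rt; rewrite fg.
Qed.

Lemma primBo_ge f c s t : locint f -> 0 <= s -> s <= t ->
  (forall r, s < r -> r < t -> c <= f r) -> c * (t - s) <= prim f t - prim f s.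
Proof.
move=> lf s0 st fc; rewrite mulrBr -!prim_cst ?(le_trans s0) //.
exact: le_primBo (locint_cst c) lf s0 st fc.
Qed.

(** A positive integrand with integral 0 would vanish almost everywhere on an interval of positive
    measure. *)
Lemma prim_lt f s t : locint f -> 0 <= s -> s < t ->
  (forall r, s < r -> r < t -> 0 < f r) -> prim f s < prim f t.
Proof.
move=> lf s0 st f0; rewrite ltNge; apply/negP => le.
have sub : `]s, t[ `<=` `[0, t].
  move=> r /=; rewrite !in_itv /= => /andP[sr /ltW ->]; rewrite andbT.
  by rewrite ltW // (le_lt_trans s0 sr).
have If : leb.-integrable `]s, t[ (EFin \o f) by apply: integrableS (lf t).
have I0 : (\int[leb]_(x in `]s, t[) `|(EFin \o f) x| = 0)%E.
  transitivity (\int[leb]_(x in `]s, t[) (f x)%:E)%E.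
    apply: eq_integral => r; rewrite inE /= in_itv /= => /andP[sr rt].
    by rewrite gtr0_norm // f0.
  have : \int[leb]_(x in `]s, t[) f x <= 0 by rewrite -primB_oo ?subr_le0 // ltW.
  have : 0 <= \int[leb]_(x in `]s, t[) f x.
    by apply: Rintegral_ge0 => r /=; rewrite in_itv /= => /andP[sr rt]; exact: ltW (f0 _ _ _).
  rewrite /Rintegral => ge0 le0; apply/eqP; rewrite -[X in X == _]fineK; last first.
    exact: (integrable_fin_num _ If).
  by rewrite eqe eq_le le0 ge0.
have mf : measurable_fun (`]s, t[ : set R) (EFin \o f) by exact: (measurable_int leb If).
have := ae_eq_integral_abs leb (measurable_itv _) mf => -[/(_ I0) ae _].
have [N [mN N0 sN]] := ae.
have : (lebesgue_measure (`]s, t[%classic : set R) <= lebesgue_measure N)%E.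
  apply: le_measure; rewrite ?inE //.
  move=> r rst; apply: sN => /= /(_ rst); move: rst.
  rewrite /= in_itv /= => /andP[sr rt] [] H; have := f0 r sr rt.
  by rewrite H ltxx.
rewrite N0 lebesgue_measure_itv /= lte_fin st -EFinB lee_fin; lra.
Qed.

End Strict.

(** * Structure of equilibria *)

Section Thresholds.
Context {R : realType}.
Variable p : primitives R.
Hypothesis hp : standing p.
Variable tauP : R.
Hypothesis htauP : is_tauP p tauP.
Implicit Types r s t : R.
Local Notation h := (hazard p).

Lemma tauP_gt0 : 0 < tauP. Proof. by case: htauP. Qed.

Lemma phiPE : mu p * (1 - theta p) * phiP p = rho p * theta p.
Proof.
have [r0 b0 bm mt t1] := params hp.
by rewrite /phiP mulrC divfK // gt_eqF // mulr_gt0 //; lra.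
Qed.

(** Monotonicity puts the hazard weakly above [phiP] before [tauP]; uniqueness of the crossing makes
    this strict. *)
Lemma gainP_gt0 t : 0 <= t -> t < tauP -> 0 < mu p * (1 - theta p) * h t - rho p * theta p.
Proof.
have [r0 b0 bm mt t1] := params hp; case: htauP => T0 hT uT t0 tT.
rewrite subr_gt0 -phiPE ltr_pM2l; last by rewrite mulr_gt0 //; lra.
rewrite lt_neqAle -{2}hT (hazard_decr hp) // ?andbT; last exact: ltW.
by apply/eqP => e; move: (uT t t0 (esym e)) tT => ->; rewrite ltxx.
Qed.

Lemma gainP_ge0 t : 0 <= t -> t <= tauP -> 0 <= mu p * (1 - theta p) * h t - rho p * theta p.
Proof.
move=> t0; rewrite le_eqVlt => /predU1P[->|tT]; last exact: ltW (gainP_gt0 _ _).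
by case: htauP => T0 -> uT; rewrite phiPE subrr.
Qed.

Lemma gainP_lt0 t : tauP < t -> mu p * (1 - theta p) * h t - rho p * theta p < 0.
Proof.
have [r0 b0 bm mt t1] := params hp; case: htauP => T0 hT uT tT.
have t0 := lt_trans T0 tT.
rewrite subr_lt0 -phiPE ltr_pM2l; last by rewrite mulr_gt0 //; lra.
rewrite lt_neqAle -{2}hT (hazard_decr hp) // ?andbT; try exact: ltW.
by apply/eqP => e; move: (uT t (ltW t0) e) tT => ->; rewrite ltxx.
Qed.

(** Up to [tauP] the hazard is at least [phiP], which exceeds [phiA] by [A2]: absent stops and with
    certain acceptance, the agent strictly gains from waiting. *)
Lemma gainA_gt0 t : 0 <= t -> t <= tauP -> 0 < beta p * (1 - mu p) * h t - rho p * mu p.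
Proof.
have [r0 b0 bm mt t1] := params hp; case: htauP => T0 hT uT t0 tT.
have H : phiP p <= h t by rewrite -hT (hazard_decr hp).
have H2 := A2 hp.
have d0 : 0 < beta p * (1 - mu p) by rewrite mulr_gt0 //; lra.
have -> : rho p * mu p = beta p * (1 - mu p) * phiA p.
  by rewrite /phiA [RHS]mulrC divfK // gt_eqF.
by rewrite subr_gt0 ltr_pM2l //; exact: lt_le_trans H.
Qed.

End Thresholds.

(** * The principal's stopping incentives *)

Section Equil.
Local Open Scope classical_set_scope.
Context {R : realType}.
Notation leb := (@lebesgue_measure R).
Variable p : primitives R.
Hypothesis hp : standing p.
Variable tauP : R.
Hypothesis htauP : is_tauP p tauP.
Variable sigma : R.
Hypothesis sigma01 : 0 < sigma < 1.
Variable E : profile R.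
Hypothesis eqE : equilibrium p sigma E.
Implicit Types (r s t c : R).

Local Notation h := (hazard p).
Local Notation K := (disc p).
Local Notation a := (accept E).
Local Notation Y := (dsurv p (stop E) 1).
Local Notation Z := (dsurv p (fake E) sigma).
Local Notation S := (surv (fake E) sigma).
Local Notation SP := (surv (stop E) 1).
Local Notation f := (dens (fake E)).
Local Notation gain := (accept_gain p sigma E).
Local Notation T := tauP.

Let sE := eq_strategies eqE.
Let sl := stop_law sE.
Let fl := fake_law sE.
Let T0 := tauP_gt0 htauP.

Lemma lt_fin0 t : 0 <= t -> (0 <= t%:E :> \bar R)%E.
Proof. by rewrite lee_fin. Qed.

Lemma reject_atom r : 0 <= r -> 0 < atom (fake E) r -> a r = 0.
Proof.
have [r0 b0 bm mt t1] := params hp.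
by move=> r0' at0; have [_ ->//] := PICa eqE r0'; rewrite /mu1 at0.
Qed.

Lemma uPE t : 0 <= t ->
  uP p sigma E t%:E = theta p * (1 - rho p * prim Z t) + prim (fun r => a r * gain r) t.
Proof. exact: (uP_fin hp sigma01 sE reject_atom). Qed.

Lemma locint_again : locint (fun r => a r * gain r).
Proof. exact: locintM_accept sE _ (locint_gain hp sigma01 sE). Qed.

Lemma locint_Z : locint Z.
Proof. exact: (locint_dsurv hp fl (sigma01w sigma01)). Qed.

Lemma Z_gt0 r : 0 <= r -> 0 < Z r.
Proof.
by move=> r0; rewrite /dsurv mulr_gt0 ?(disc_gt0 hp) // (surv_gt0 sigma01 sE).
Qed.

Lemma uPB s t : 0 <= s -> s <= t -> uP p sigma E t%:E - uP p sigma E s%:E =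
  prim (fun r => a r * gain r - theta p * rho p * Z r) t -
  prim (fun r => a r * gain r - theta p * rho p * Z r) s.
Proof.
move=> s0 st; rewrite !uPE // ?(le_trans s0) //.
have lZ := locintZ (theta p * rho p) locint_Z.
rewrite !primBfun ?primZ //; try exact: locint_Z; try exact: locint_again.
ring.
Qed.

Lemma locint_uPB : locint (fun r => a r * gain r - theta p * rho p * Z r).
Proof.
apply: locintB; first exact: locint_again.
apply: locintZ; exact: locint_Z.
Qed.

(** Fakes only lower the gain and [a] is at most 1, so certain acceptance of unfaked news is the
    best case. *)
Lemma again_le r : 0 <= r -> a r * gain r <= mu p * (1 - theta p) * (h r * Z r).
Proof.
move=> r0; have [rp b0 bm mt t1] := params hp.
have /andP[a0 a1] := accept_itv sE r0.
have fK : 0 <= f r * K r by rewrite mulr_ge0 ?(dens_ge0 fl) // ltW // (disc_gt0 hp).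
have hZ : 0 <= h r * Z r by rewrite mulr_ge0 ?(hazard_ge0 hp) // ltW // Z_gt0.
case/andP: sigma01 => s0 s1.
have u0 : 0 <= mu p * (1 - theta p) * (h r * Z r) by apply: mulr_ge0 => //; apply: mulr_ge0; lra.
have v0 : 0 <= (theta p - mu p) * sigma * (f r * K r) by apply: mulr_ge0 => //; apply:
  mulr_ge0; lra.
rewrite /accept_gain; set u := _ * (h r * Z r) in u0 *; set v := _ * (f r * K r) in v0 *.
nra.
Qed.

(** Past [tauP] even the best case of [again_le] earns less than the interest on [theta]. *)
Lemma uP_decr s t : T <= s -> s < t -> uP p sigma E t%:E < uP p sigma E s%:E.
Proof.
move=> Ts st; have s0 : 0 <= s by apply: le_trans Ts; exact: ltW.
rewrite -subr_lt0 (uPB s0 (ltW st)) subr_lt0 -ltrN2 -!primN; try exact: locint_uPB.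
apply: prim_lt => //; first exact: locintN locint_uPB.
move=> r sr rt; have r0 := le_trans s0 (ltW sr).
have A := again_le r0; have B := gainP_lt0 hp htauP (le_lt_trans Ts sr).
have C := Z_gt0 r0; rewrite opprB subr_gt0; apply: le_lt_trans A _.
by rewrite mulrA -subr_gt0 -mulrBl mulr_gt0 // -oppr_lt0 opprB [theta p * _]mulrC.
Qed.

Lemma stop_before r : T < r -> uncharged (stop E) r.
Proof.
move=> Tr; have r0 := lt_trans T0 Tr.
apply: (not_charged sl); first exact: ltW.
move=> ch; have := PICt eqE (t := r%:E) (t' := T%:E) _ _ ch.
move=> /(_ (lt_fin0 (ltW r0)) (lt_fin0 (ltW T0))).
by rewrite leNgt uP_decr.
Qed.

Lemma uP_oo_lt : uP p sigma E +oo%E < uP p sigma E T%:E.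
Proof.
apply: (@le_lt_trans _ _ (uP p sigma E (T + 1)%:E)); last by apply: uP_decr => //; lra.
apply: (uP_oo_le hp sigma01 sE reject_atom (T := T + 1)) => t.
rewrite le_eqVlt => /predU1P[<-//|Tt]; apply: ltW; apply: uP_decr => //; lra.
Qed.

Lemma stop_mass0 : mass_infty (stop E) = 0.
Proof.
apply/eqP; rewrite eq_le (mass_infty_ge0 sl) andbT leNgt; apply/negP => ch.
have := PICt eqE (t := +oo%E) (t' := T%:E) (leey _) (lt_fin0 (ltW T0)) ch.
by rewrite leNgt uP_oo_lt.
Qed.

Lemma stop_tmass : tmass (stop E) = 1.
Proof. by have := stop_mass0; rewrite /mass_infty -/(tmass _) => /eqP;
  rewrite subr_eq0 => /eqP. Qed.

Lemma stop_cdf_T t : T <= t -> cdfT (stop E) t = 1.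
Proof.
move=> Tt; rewrite -stop_tmass (@tmass_flat _ _ t) // => r tr r0.
apply: stop_before; exact: le_lt_trans tr.
Qed.

Lemma exists_stop : exists2 r, 0 <= r & charged (stop E) r%:E.
Proof.
apply: contrapT => nex.
have : tmass (stop E) = 0.
  apply: (tmass0 sl) => r r0; apply: (not_charged sl) => // ch; apply: nex; by exists r.
by rewrite stop_tmass => /eqP; rewrite oner_eq0.
Qed.

(** [PICt] puts the payoff at its maximum wherever the law of stopping has positive density or an
    atom, and no mass sits at infinity; the expectation is therefore the maximum itself. *)
Lemma max_uP : exists V, [/\ forall t, 0 <= t -> uP p sigma E t%:E <= V,
   forall r, 0 <= r -> charged (stop E) r%:E -> uP p sigma E r%:E = V &
   payoffP p sigma E = V].
Proof.
have [r0 r00 ch0] := exists_stop.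
pose V := uP p sigma E r0%:E.
have H1 t : 0 <= t -> uP p sigma E t%:E <= V.
  by move=> t0; apply: (PICt eqE) ch0; exact: lt_fin0.
have H2 r : 0 <= r -> charged (stop E) r%:E -> uP p sigma E r%:E = V.
  move=> r0' ch; apply/eqP; rewrite eq_le H1 //=.
  by apply: (PICt eqE) ch; exact: lt_fin0.
exists V; split => //.
have dV r : 0 <= r -> dens (stop E) r * uP p sigma E r%:E = dens (stop E) r * V.
  move=> rr; have := dens_ge0 sl rr; rewrite le_eqVlt => /predU1P[<-|d0]; first by rewrite !mul0r.
  by rewrite H2 //; left.
have aV r : 0 <= r -> atom (stop E) r * uP p sigma E r%:E = atom (stop E) r * V.
  move=> rr; have := atom_ge0 sl rr; rewrite le_eqVlt => /predU1P[<-|d0]; first by rewrite !mul0r.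
  by rewrite H2 //; right.
have Vge : 0 <= V.
  apply: le_trans (H1 0 (lexx _)); rewrite uPE // !prim0 mulr0 subr0 mulr1 addr0.
  by have [? ? ? ? ?] := params hp; lra.
rewrite /payoffP /expectation_of stop_mass0 mul0r addr0.
transitivity (V * tmass (stop E)); last by rewrite stop_tmass mulr1.
rewrite (tmassE (stop E)) /flow mulrDr; congr (_ + _).
  rewrite -RintegralZl //; last exact: dens_integrable sl.
  apply: eq_Rintegral => r; rewrite inE /= in_itv /= andbT => rr.
  by rewrite add0r dV // mulrC.
rewrite -/(jumps _ _ (fun t => uP p sigma E t%:E)) -(jumps_cst sl) //.
by apply: eq_jumps => r; rewrite /= in_itv /= andbT => rr; exact: aV.
Qed.

Lemma uP0 : uP p sigma E 0%:E = theta p.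
Proof. by rewrite uPE // !prim0; ring. Qed.

Lemma payoff_immediate : cdfT (stop E) 0 = 1 -> payoffP p sigma E = theta p.
Proof.
rewrite (cdfT0 sl) => at1; have [V [_ HV ->]] := max_uP.
by rewrite -(HV 0) ?uP0 //; right; rewrite at1.
Qed.

(** Some time is charged, possibly +oo: with no finite charged time all the mass of faking sits at
    infinity. *)
Lemma max_uA : exists M, (forall t : \bar R, (0 <= t)%E -> uA p E t <= M) /\
   (forall t : \bar R, (0 <= t)%E -> charged (fake E) t -> uA p E t = M).
Proof.
have [t0 t00 ch0] : exists2 t : \bar R, (0 <= t)%E & charged (fake E) t.
  apply: contrapT => nex.
  have t0 : tmass (fake E) = 0.
    apply: (tmass0 fl) => r r0; apply: (not_charged fl) => // ch; apply: nex; by exists r%:E.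
  apply: nex; exists +oo%E; first exact: leey.
  by rewrite /= /mass_infty -/(tmass _) t0 subr0.
exists (uA p E t0); split => [t ht|t ht ch]; first exact: (AIC eqE).
by apply/eqP; rewrite eq_le; apply/andP; split; apply: (AIC eqE).
Qed.

End Equil.

Lemma phirate_bound (R : realType) (rh b m H x y al : R) : 0 < rh -> 0 < b -> b < m -> m < 1 ->
  0 <= x -> x <= H -> 0 <= y -> y <= 1 -> 0 <= al -> al <= 1 ->
  `|(b * (1 - m) * x - rh * m) * y - m * (1 - b) * (x * ((1 - al) * y))| <= 1 + rh + H.
Proof.
move=> rp b0 bm m1 h0 h1 y0 y1 a0 a1.
have z0 : 0 <= (1 - al) * y by rewrite mulr_ge0 //; lra.
have z1 : (1 - al) * y <= 1 by nra.
have q0 : 0 <= x * ((1 - al) * y) by rewrite mulr_ge0.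
have q1 : x * ((1 - al) * y) <= H by nra.
move: q0 q1; move: (x * _) => q q0 q1.
have A0 : 0 <= m * (1 - b) <= 1 by apply/andP; split; nra.
have B0 : 0 <= b * (1 - m) <= 1 by apply/andP; split; nra.
move: A0 B0; move: (m * (1 - b)) (b * (1 - m)) => A B /andP[A0 A1] /andP[B0 B1].
have Aq : 0 <= A * q <= H by apply/andP; split; nra.
have Bx : 0 <= B * x <= H by apply/andP; split; nra.
have rm : 0 <= rh * m <= rh by apply/andP; split; nra.
move: Aq Bx rm; move: (A * q) (B * x) (rh * m) => u v w /andP[u0 u1] /andP[v0 v1] /andP[w0 w1].
rewrite ler_norml.
have k1 : (v - w) * y <= H by nra.
have k2 : - rh <= (v - w) * y by nra.
apply/andP; split; lra.
Qed.

(** * The agent's value of faking as a function of time *)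

Section Agent.
Local Open Scope classical_set_scope.
Context {R : realType}.
Variable p : primitives R.
Hypothesis hp : standing p.
Variable E : profile R.
Hypothesis sE : strategies E.
Implicit Types (r s t c : R).

Local Notation h := (hazard p).
Local Notation K := (disc p).
Local Notation a := (accept E).
Local Notation Y := (dsurv p (stop E) 1).
Local Notation dr := (discrate p).

Let sl := stop_law sE.

(* Agent's payoff from faking at [t] if the principal were sure to accept at [t]. *)
Definition waiting_value t := beta p * (1 - rho p * prim Y t)
    + mu p * (1 - beta p) * prim (fun r => a r * (h r * Y r)) t
    + (mu p - beta p) * Y t.

Lemma uA_phi t : 0 <= t ->
  uA p E t%:E = waiting_value t - (mu p - beta p) * ((1 - a t) * Y t).
Proof. by move=> t0; rewrite (uA_fin hp sE) // /waiting_value; ring. Qed.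

(** Drift of [waiting_value] in the absence of stops; the last term is what the agent loses when
    true type-1 news is rejected. *)
Definition waiting_rate r := (beta p * (1 - mu p) * h r - rho p * mu p) * Y r
  - mu p * (1 - beta p) * (h r * ((1 - a r) * Y r)).

Definition phibnd := 1 + rho p + h 0.

Let lY : locint Y. Proof. exact: (locint_dsurv hp sl one01). Qed.
Let lhY : locint (fun r => h r * Y r). Proof. exact: (locint_hY hp sE). Qed.
Let lahY : locint (fun r => a r * (h r * Y r)).
Proof. exact: locintM_accept sE _ lhY. Qed.
Let ldY : locint (fun r => dr r * Y r).
Proof. exact: (locintM_dsurv hp sl one01 (locint_discrate hp)). Qed.

Lemma phirateE r : waiting_rate r = - (beta p * rho p) * Y r
  + (mu p * (1 - beta p) * (a r * (h r * Y r)) + (mu p - beta p) * (dr r * Y r)).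
Proof. by rewrite /waiting_rate /discrate; ring. Qed.

Lemma locint_phirate : locint waiting_rate.
Proof.
have l : locint (fun r => - (beta p * rho p) * Y r
  + (mu p * (1 - beta p) * (a r * (h r * Y r)) + (mu p - beta p) * (dr r * Y r))).
  by apply: locintD; [exact: locintZ|apply: locintD; exact: locintZ].
by apply: (locint_eq l) => r _; rewrite phirateE.
Qed.

Lemma phiB s t : 0 <= s -> s <= t -> waiting_value t - waiting_value s =
  prim waiting_rate t - prim waiting_rate s - (mu p - beta p) * (stieltjes (stop E) K t -
    stieltjes (stop E) K s).
Proof.
move=> s0 st.
have P q : prim waiting_rate q = - (beta p * rho p) * prim Y q
  + (mu p * (1 - beta p) * prim (fun r => a r * (h r * Y r)) q
  + (mu p - beta p) * prim (fun r => dr r * Y r) q).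
  rewrite -!primZ // -!primD; try exact: locintZ; last by apply: locintD; exact: locintZ.
  by apply: eq_prim => r _ _; rewrite phirateE.
rewrite !P /waiting_value.
have H := dsurv_primB hp sl 1 s0 st; rewrite mul1r in H.
have : (mu p - beta p) * (Y t - Y s) = (mu p - beta p) *
  (prim (fun r => dr r * Y r) t - prim (fun r => dr r * Y r) s
   - (stieltjes (stop E) K t - stieltjes (stop E) K s)) by rewrite H.
lra.
Qed.

Lemma Y_itv r : 0 <= r -> 0 <= Y r <= 1.
Proof. exact: (dsurv_itv hp sl one01). Qed.

Lemma phirate_norm r : 0 <= r -> `|waiting_rate r| <= phibnd.
Proof.
move=> r0; have [rp b0 bm mt t1] := params hp.
have h0 := hazard_ge0 hp r0; have h1 := hazard_le0 hp r0.
have /andP[a0 a1] := accept_itv sE r0; have /andP[y0 y1] := Y_itv r0.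
rewrite /waiting_rate /phibnd; apply: phirate_bound => //; try lra.
Qed.

(** A stop costs the agent mu - beta, so stops only lower the value and its growth is bounded by the
    drift alone. *)
Lemma phi_upper s t : 0 <= s -> s <= t -> waiting_value t - waiting_value s <= phibnd * (t - s).
Proof.
move=> s0 st; have [rp b0 bm mt t1] := params hp; rewrite phiB //.
have B : `|prim waiting_rate t - prim waiting_rate s| <= phibnd * (t - s).
  apply: primB_norm => //; first exact: locint_phirate.
  by move=> r sr _; apply: phirate_norm; lra.
have := le_trans (ler_norm _) B.
have : 0 <= stieltjes (stop E) K t - stieltjes (stop E) K s.
  rewrite -[leLHS](mul0r (cdfT (stop E) t - cdfT (stop E) s)); apply: (stieltjesB_ge sl) => //.
  - exact: meas_disc.
  - exact: locbnd_disc.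
  - by move=> r r0; exact: ltW (disc_gt0 hp _).
  - by move=> r _ _; exact: ltW (disc_gt0 hp _).
move=> H; have : 0 <= (mu p - beta p) * (stieltjes (stop E) K t - stieltjes (stop E) K s).
  by rewrite mulr_ge0 //; lra.
lra.
Qed.

Lemma stieltjesK_le s t : 0 <= s -> s <= t ->
  stieltjes (stop E) K t - stieltjes (stop E) K s <= cdfT (stop E) t - cdfT (stop E) s.
Proof.
move=> s0 st; rewrite -[leRHS]mul1r; apply: (stieltjesB_le sl) => //.
- exact: meas_disc.
- exact: locbnd_disc.
- by move=> r r0; exact: ltW (disc_gt0 hp _).
- by move=> r sr _; apply: (disc_le1 hp); lra.
Qed.

Lemma stieltjesK_ge s t : 0 <= s -> s <= t -> 0 <= stieltjes (stop E) K t - stieltjes (stop E) K s.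
Proof.
move=> s0 st.
rewrite -[leLHS](mul0r (cdfT (stop E) t - cdfT (stop E) s)); apply: (stieltjesB_ge sl) => //.
- exact: meas_disc.
- exact: locbnd_disc.
- by move=> r r0; exact: ltW (disc_gt0 hp _).
- by move=> r _ _; exact: ltW (disc_gt0 hp _).
Qed.

Lemma phi_lower s t : 0 <= s -> s <= t ->
  - phibnd * (t - s) - (cdfT (stop E) t - cdfT (stop E) s) <= waiting_value t - waiting_value s.
Proof.
move=> s0 st; have [rp b0 bm mt t1] := params hp; rewrite phiB //.
have B : `|prim waiting_rate t - prim waiting_rate s| <= phibnd * (t - s).
  apply: primB_norm => //; first exact: locint_phirate.
  by move=> r sr _; apply: phirate_norm; lra.
move: B; rewrite ler_norml => /andP[B _].
have := stieltjesK_le s0 st; have := stieltjesK_ge s0 st; nra.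
Qed.

Lemma phi_flat s t : 0 <= s -> s <= t -> cdfT (stop E) t = cdfT (stop E) s ->
  waiting_value t - waiting_value s = prim waiting_rate t - prim waiting_rate s.
Proof.
move=> s0 st e; rewrite phiB //.
have := stieltjesK_le s0 st; have := stieltjesK_ge s0 st; rewrite e subrr => A B.
have -> : stieltjes (stop E) K t - stieltjes (stop E) K s = 0 by lra.
by rewrite mulr0 subr0.
Qed.

(** Only to the right: a stopping atom makes the value drop below its left limit. *)
Lemma phi_gt_rcont s c : 0 <= s -> c < waiting_value s -> exists2 d, s < d &
  forall t, s <= t -> t < d -> c < waiting_value t.
Proof.
move=> s0 cs; have [rp b0 bm mt t1] := params hp.
have e0 : 0 < (waiting_value s - c) / 2 by rewrite divr_gt0 // subr_gt0.
have [d sd Hd] := cdfT_rcont sl s0 e0.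
have b1 : 0 < phibnd by rewrite /phibnd; have := hazard_ge0 hp (lexx 0); lra.
exists (Num.min d (s + (waiting_value s - c) / 2 / phibnd)).
  by rewrite lt_min sd ltrDl divr_gt0.
move=> t st; rewrite lt_min => /andP[td tb].
have := Hd t st td; have := phi_lower s0 st.
have : phibnd * (t - s) < (waiting_value s - c) / 2 by rewrite -ltr_pdivlMl // mulrC; lra.
lra.
Qed.

Lemma phi_lt_rcont s c : 0 <= s -> waiting_value s < c -> exists2 d, s < d &
  forall t, s <= t -> t < d -> waiting_value t < c.
Proof.
move=> s0 cs; have [rp b0 bm mt t1] := params hp.
have b1 : 0 < phibnd by rewrite /phibnd; have := hazard_ge0 hp (lexx 0); lra.
exists (s + (c - waiting_value s) / phibnd); first by rewrite ltrDl divr_gt0 // subr_gt0.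
move=> t st tb; have := phi_upper s0 st.
have : phibnd * (t - s) < c - waiting_value s by rewrite -ltr_pdivlMl // mulrC; lra.
lra.
Qed.

End Agent.

(** * Certain acceptance until the principal has stopped *)

Section Accept.
Local Open Scope classical_set_scope.
Context {R : realType}.
Variable p : primitives R.
Hypothesis hp : standing p.
Variable tauP : R.
Hypothesis htauP : is_tauP p tauP.
Variable sigma : R.
Hypothesis sigma01 : 0 < sigma < 1.
Variable E : profile R.
Hypothesis eqE : equilibrium p sigma E.
Implicit Types (r s t c : R).

Local Notation h := (hazard p).
Local Notation K := (disc p).
Local Notation a := (accept E).
Local Notation Y := (dsurv p (stop E) 1).
Local Notation Z := (dsurv p (fake E) sigma).
Local Notation f := (dens (fake E)).
Local Notation gain := (accept_gain p sigma E).
Local Notation T := tauP.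
Local Notation phi := (waiting_value p E).
Local Notation phirate := (waiting_rate p E).

Let sE := eq_strategies eqE.
Let sl := stop_law sE.
Let fl := fake_law sE.
Let T0 := tauP_gt0 htauP.

Variables V M : R.
Hypothesis V1 : forall t, 0 <= t -> uP p sigma E t%:E <= V.
Hypothesis V2 : forall r, 0 <= r -> charged (stop E) r%:E -> uP p sigma E r%:E = V.
Hypothesis M1 : forall t : \bar R, (0 <= t)%E -> uA p E t <= M.
Hypothesis M2 : forall t : \bar R, (0 <= t)%E -> charged (fake E) t -> uA p E t = M.

Lemma stop_uncharged r : 0 <= r -> uP p sigma E r%:E < V -> uncharged (stop E) r.
Proof.
move=> r0 lt; apply: (not_charged sl) => // ch; move: lt.
by rewrite V2 // ltxx.
Qed.

Lemma fake_uncharged r : 0 <= r -> uA p E r%:E < M -> uncharged (fake E) r.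
Proof.
move=> r0 lt; apply: (not_charged fl) => // ch; move: lt.
by rewrite M2 // ?ltxx // lt_fin0.
Qed.

(** Without fakes type-1 news is genuine, so [mu1] is 1. *)
Lemma accept_uncharged r : 0 <= r -> uncharged (fake E) r -> a r = 1.
Proof.
move=> r0 [f0 at0]; have [rp b0 bm mt t1] := params hp.
have [+ _] := PICa eqE r0; apply.
have H := mu1_noatom hp sigma01 sE r0 at0; have D := mu1_den_gt0 hp sigma01 sE r0.
rewrite f0 in H D; have -> : mu1 p sigma E r = 1; last exact: t1.
apply: (mulIf (lt0r_neq0 D)); rewrite H; ring.
Qed.

Lemma gain_mu1 r : 0 <= r -> atom (fake E) r = 0 ->
  gain r = expR (- rho p * r) * ((mu1 p sigma E r - theta p) *
    (mu p * g p r * surv (fake E) sigma r + sigma * f r * (1 - G p r))).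
Proof.
move=> r0 at0; rewrite mulrBl (mu1_noatom hp sigma01 sE r0 at0).
by rewrite /accept_gain /dsurv /disc (g_hazard hp); ring.
Qed.

(** By [accept_uncharged], doubtful acceptance requires faking at [r], which must then be optimal.
    For the principal, either [mu1] equals [theta] and accepting gains nothing, or she rejects. *)
Lemma partial_accept r : 0 <= r -> a r != 1 -> uA p E r%:E = M /\ a r * gain r = 0.
Proof.
move=> r0 a1; split.
  have ch : charged (fake E) r%:E.
    apply: contrapT => /(not_charged fl r0) /(accept_uncharged r0) e.
    by rewrite e eqxx in a1.
  by apply: M2 => //; exact: lt_fin0.
have at0 := atom_ge0 fl r0.
have [at1|at1] := eqVneq (atom (fake E) r) 0; last first.
  by rewrite (reject_atom hp eqE) ?mul0r // lt_neqAle eq_sym at1.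
have [A1 A2] := PICa eqE r0.
have [lt|gt|e] := ltgtP (mu1 p sigma E r) (theta p).
- by rewrite A2 // mul0r.
- by rewrite A1 // eqxx in a1.
- by rewrite gain_mu1 // e subrr; ring.
Qed.

(** A surely accepted fake at [r] would beat [M], so acceptance has to be doubtful enough to bring
    the payoff back to [M]; if [Y r] were 0, doubt could not lower it. *)
Lemma above_max r : 0 <= r -> M < phi r ->
  [/\ 0 < Y r, a r != 1, (mu p - beta p) * ((1 - a r) * Y r) = phi r - M &
      a r * gain r = 0].
Proof.
move=> r0 Mr; have [rp b0 bm mt t1] := params hp.
have le := M1 (lt_fin0 r0); have H := uA_phi hp sE r0.
have /andP[a0 a1] := accept_itv sE r0; have /andP[Y0 Y1] := Y_itv hp sE r0.
have [aY1 aY2] : (1 - a r) != 0 /\ Y r != 0.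
  split; apply/eqP => e; move: H; rewrite e ?mul0r ?mulr0 => H; lra.
have a' : a r != 1 by rewrite -subr_eq0 -oppr_eq0 opprB.
have [u w] := partial_accept r0 a'.
split=> //; first by rewrite lt_neqAle eq_sym aY2.
by rewrite -u H; ring.
Qed.

Lemma uP_decr_again0 s t : 0 <= s -> s < t ->
  (forall r, s < r -> r < t -> a r * gain r = 0) ->
  uP p sigma E t%:E < uP p sigma E s%:E.
Proof.
move=> s0 st H; have [rp b0 bm mt t1] := params hp.
have lB := locint_uPB hp sigma01 eqE.
rewrite -subr_lt0 (uPB hp sigma01 eqE s0 (ltW st)) subr_lt0 -ltrN2 -!primN //.
apply: prim_lt => //; first exact: locintN.
move=> r sr rt; rewrite H // sub0r opprK; apply: mulr_gt0; first by apply: mulr_gt0; lra.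
by apply: (Z_gt0 hp sigma01 eqE); lra.
Qed.

Lemma Y_gt0P r : 0 <= r -> (0 < Y r) = (cdfT (stop E) r < 1).
Proof.
move=> r0; rewrite /dsurv pmulr_rgt0 ?(disc_gt0 hp) //.
by rewrite /surv mul1r subr_gt0.
Qed.

(* If [phi] exceeds the agent's value [M] on [[s, d[], every time there is a faking
   time at which acceptance does not benefit the principal; so she does not stop there, and
   the excess [phi - M] decays at most exponentially, hence survives at [d]. *)
Lemma excess_persists s d : 0 <= s -> s <= d -> d <= T ->
  (forall r, s <= r -> r < d -> M < phi r) -> M < phi s -> M < phi d.
Proof.
move=> s0 sd dT Hr Ms; have [rp b0 bm mt t1] := params hp.
move: sd; rewrite le_eqVlt => /predU1P[<-//|sd].
have nostop r : s < r -> r <= d -> uncharged (stop E) r.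
  move=> sr rd; apply: stop_uncharged; first lra.
  apply: lt_le_trans (V1 s0); apply: uP_decr_again0 => // q sq qr.
  by have [||_ _ _ ->] := @above_max q; [lra|apply: Hr; lra|].
have flat r q : s <= r -> r <= q -> q <= d -> cdfT (stop E) q = cdfT (stop E) r.
  move=> sr rq qd; apply: (cdfT_flat sl) => //; first lra.
  by move=> w rw wq; apply: nostop; lra.
have h0 := hazard_ge0 hp (lexx 0).
(* Under an excess, the loss term of [waiting_rate] equals mu (1 - beta) / (mu - beta) times the
   hazard times the excess; the hazard is replaced by its largest value. *)
pose c := mu p * (1 - beta p) / (mu p - beta p) * h 0.
have c0 : 0 <= c by rewrite mulr_ge0 // divr_ge0 //; nra.
have rate r B : s <= r -> r < d -> phi r - M <= B -> 0 <= B -> - (c * B) <= phirate r.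
  move=> sr rd HB B0; have r0 : 0 <= r by lra.
  have [y0 _ e _] := above_max r0 (Hr r sr rd).
  have e' : (1 - a r) * Y r = (phi r - M) / (mu p - beta p).
    by rewrite -e [RHS]mulrC mulKf // gt_eqF // subr_gt0.
  rewrite /waiting_rate e'.
  have k0 : 0 <= (beta p * (1 - mu p) * h r - rho p * mu p) * Y r.
    by rewrite mulr_ge0 // ltW // (gainA_gt0 hp htauP) //; lra.
  have hr0 := hazard_ge0 hp r0; have hr1 := hazard_le0 hp r0.
  have m0 : 0 <= mu p * (1 - beta p) / (mu p - beta p) by rewrite divr_ge0 //; nra.
  have : h r * (phi r - M) <= h 0 * B by apply: ler_pM => //; have := Hr r sr rd; lra.
  move=> q; have := ler_wpM2l m0 q.
  rewrite /c; set m := mu p * (1 - beta p); set D := (mu p - beta p)^-1.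
  have -> : m * (h r * ((phi r - M) * D)) = m * D * (h r * (phi r - M)) by ring.
  have -> : m * D * h 0 * B = m * D * (h 0 * B) by ring.
  move=> q2; lra.
(* A window before [d] with c (d - r1) <= 1 / 2: from any of its points to [d], the excess falls by
   at most half of its supremum [B] over the window. *)
pose r1 := Num.max s (d - (2 * (1 + c))^-1).
have c2 : 0 < 2 * (1 + c) by lra.
have r1s : s <= r1 by rewrite le_max lexx.
have r1d : r1 < d by rewrite gt_max sd /= ltrBlDr ltrDl invr_gt0.
have r1c : c * (d - r1) <= 1 / 2.
  have r1' : d - (2 * (1 + c))^-1 <= r1 by rewrite le_max lexx orbT.
  have : d - r1 <= (2 * (1 + c))^-1 by lra.
  move=> q; have := ler_wpM2l c0 q; rewrite invfM => q2.
  have : c * (1 + c)^-1 <= 1 by rewrite ler_pdivrMr //; lra.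
  lra.
pose D := [set phi r - M | r in `[r1, d[ ].
have D1 : D (phi r1 - M) by exists r1 => //=; rewrite in_itv /= lexx.
have supD : has_sup D.
  split; first by exists (phi r1 - M).
  exists (phi r1 - M + phibnd p * (d - r1)) => _ [r /= + <-].
  rewrite in_itv /= => /andP[r1r rd].
  have := phi_upper hp sE (le_trans s0 r1s) r1r.
  have : phibnd p * (r - r1) <= phibnd p * (d - r1).
    by rewrite ler_wpM2l //; [rewrite /phibnd|]; lra.
  lra.
pose B := sup D.
have BD r : r1 <= r -> r < d -> phi r - M <= B.
  move=> r1r rd; apply: sup_upper_bound => //; exists r => //=.
  by rewrite in_itv /= r1r.
have B0 : 0 < B by apply: lt_le_trans (BD r1 (lexx _) r1d); rewrite subr_gt0 Hr.
have B4 : 0 < B / 4 by rewrite divr_gt0.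
(* From an excess above 3 B / 4 at [r2], a loss of at most B / 2 leaves more than B / 4 at [d]. *)
have [_ [r2 /= + <-] r2B] := sup_adherent B4 supD.
rewrite in_itv /= => /andP[r12 r2d].
have s2 : s <= r2 by lra.
have fl2 := flat r2 d s2 (ltW r2d) (lexx d).
have incr := phi_flat hp sE (le_trans s0 s2) (ltW r2d) fl2.
have : - (c * B) * (d - r2) <= phi d - phi r2.
  rewrite incr; apply: primBo_ge => //.
  - exact: (locint_phirate hp sE).
  - lra.
  - exact: ltW.
  - by move=> r r2r rd; apply: rate; [lra|lra|apply: BD; lra|lra].
have : (c * B) * (d - r2) <= B / 2.
  have : c * (d - r2) <= 1 / 2.
    by apply: le_trans r1c; rewrite ler_wpM2l //; lra.
  nra.
rewrite -/B in r2B; lra.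
Qed.

(** An excess needs [Y > 0], hence a time before [tauP], so the interval of excess starting at [t]
    has a finite end [d]. The excess holds at [d] by [excess_persists] and a little beyond by
    right-continuity, against the choice of [d]. *)
Lemma phi_le_max t : 0 <= t -> cdfT (stop E) t < 1 -> phi t <= M.
Proof.
move=> t0 Ft; rewrite leNgt; apply/negP => Mt.
have below r : 0 <= r -> M < phi r -> r < T.
  move=> r0 /(above_max r0) [+ _ _ _]; rewrite Y_gt0P // => Fr.
  rewrite ltNge; apply/negP => Tr.
  by rewrite (stop_cdf_T hp htauP sigma01 eqE Tr) ltxx in Fr.
pose A := [set x | t <= x /\ forall r, t <= r -> r <= x -> M < phi r].
have At : A t by split => // r tr rt; have -> : r = t by apply/eqP; rewrite eq_le rt.
have supA : has_sup A.
  split; first by exists t.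
  by exists T => x [tx Hx]; apply: ltW; apply: below; [lra|exact: Hx].
pose d := sup A.
have td : t <= d by exact: sup_upper_bound.
have Hr r : t <= r -> r < d -> M < phi r.
  move=> tr rd; have e0 : 0 < d - r by rewrite subr_gt0.
  have [x [tx Hx] xr] := sup_adherent e0 supA.
  by apply: Hx => //; rewrite -/d in xr; lra.
have dT : d <= T.
  apply: ge_sup; first by exists t.
  by move=> x [tx Hx]; apply: ltW; apply: below; [lra|exact: Hx].
have Md := excess_persists t0 td dT Hr Mt.
have [d' dd' Hd'] := phi_gt_rcont hp sE (le_trans t0 td) Md.
have : A ((d + d') / 2).
  split; first lra.
  move=> r tr rd; have [rd'|dr] := ltP r d; first exact: Hr.
  by apply: Hd' => //; lra.
by move/(sup_upper_bound supA); rewrite -/d; lra.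
Qed.

(** Doubtful acceptance at [t] would give the agent exactly [M]; certain acceptance would then give
    more, against [phi_le_max]. *)
Lemma accept1 t : 0 <= t -> cdfT (stop E) t < 1 -> a t = 1.
Proof.
move=> t0 Ft; apply/eqP; apply: contraT => a1.
have [u _] := partial_accept t0 a1; have := phi_le_max t0 Ft.
have := uA_phi hp sE t0; rewrite u => e le.
have [rp b0 bm mt t1] := params hp.
have y0 : 0 < Y t by rewrite Y_gt0P.
have /andP[a0 a2] := accept_itv sE t0.
have lt : 0 < 1 - a t by rewrite subr_gt0 lt_neqAle a1.
have : 0 < (mu p - beta p) * ((1 - a t) * Y t).
  by apply: mulr_gt0; [lra|exact: mulr_gt0].
lra.
Qed.

End Accept.

(** * First and last visits of a continuous function to a level *)

Section Hitting.
Local Open Scope classical_set_scope.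
Context {R : realType}.
Implicit Types (u : R -> R) (s t x y c : R).

Lemma continuous_near u x e : continuous u -> 0 < e ->
  exists2 d, 0 < d & forall y, `|x - y| < d -> `|u x - u y| < e.
Proof.
move=> cu e0; have /cvgrPdist_lt /(_ _ e0) := cu x.
by move=> /nbhs_ballP [d /= d0 Hd]; exists d.
Qed.

Lemma last_hit u V c x : continuous u -> c <= x -> u c = V -> u x <> V ->
  exists d, [/\ c <= d, d < x, u d = V & forall y, d < y -> y <= x -> u y <> V].
Proof.
move=> cu cx uc ux.
pose A := [set y | c <= y <= x /\ u y = V].
have supA : has_sup A.
  split; first by exists c; split => //; rewrite lexx.
  by exists x => y [/andP[_ yx] _].
have cA : A c by split => //; rewrite lexx.
have dx : sup A <= x by apply: ge_sup; [by exists c|move=> y [/andP[]]].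
have cd : c <= sup A by exact: sup_upper_bound.
have ud : u (sup A) = V.
  apply/eqP; apply: contraT => ne.
  have e0 : 0 < `|u (sup A) - V| by rewrite normr_gt0 subr_eq0.
  have [d d0 Hd] := continuous_near (sup A) cu e0.
  have [y Ay yd] := sup_adherent d0 supA.
  have ys := sup_upper_bound supA Ay.
  have := Hd y; rewrite ger0_norm ?subr_ge0 //; case: Ay => _ ->.
  by rewrite ltxx => ->//; lra.
exists (sup A); split => //.
  by rewrite lt_neqAle dx andbT; apply/eqP => e; rewrite e in ud.
move=> y dy yx uy; have : A y by split => //; rewrite yx andbT; lra.
by move/(sup_upper_bound supA); rewrite leNgt dy.
Qed.

(** Reversing time on [0, x] turns the last visit into the first. *)
Lemma first_hit u V x : continuous u -> 0 <= x -> u x = V ->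
  exists t, [/\ 0 <= t, t <= x, u t = V & forall y, 0 <= y -> y < t -> u y <> V].
Proof.
move=> cu x0 ux; have [u0|u0] := pselect (u 0 = V).
  by exists 0; split => // y y0 /(le_lt_trans y0); rewrite ltxx.
pose w y := u (x - y).
have cw : continuous w.
  move=> y; apply: continuous_comp; last exact: cu.
  by apply: continuousB; [exact: cvg_cst|exact: cvg_id].
have w0 : w 0 = V by rewrite /w subr0.
have wx : w x <> V by rewrite /w subrr.
have [d [d0 dx wd Hd]] := last_hit cw x0 w0 wx.
exists (x - d); split => //; try lra.
move=> y y0 yxd; have := Hd (x - y); rewrite /w opprB addrCA subrr addr0; apply; lra.
Qed.

End Hitting.

(** * The agent's payoff once the principal has surely stopped *)

Section AgentLate.
Local Open Scope classical_set_scope.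
Context {R : realType}.
Variable p : primitives R.
Hypothesis hp : standing p.
Variable E : profile R.
Hypothesis sE : strategies E.
Implicit Types (r s t c : R).
Local Notation h := (hazard p).
Local Notation a := (accept E).
Local Notation Y := (dsurv p (stop E) 1).
Let sl := stop_law sE.

Lemma Y_antihomo s t : 0 <= s -> s <= t -> Y t <= Y s.
Proof.
move=> s0 st; apply: ler_pM; last 2 first.
- exact: (disc_antihomo hp).
- by apply: surv_antihomo => //; rewrite ler01 lexx.
- exact: ltW (disc_gt0 hp _).
- by have /andP[] := surv_itv sl (@one01 R) (le_trans s0 st).
Qed.

Lemma Y_late t1 t : cdfT (stop E) t1 = 1 -> 0 <= t1 -> t1 <= t -> Y t = 0.
Proof.
move=> c1 t10 t1t; have : cdfT (stop E) t = 1.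
  by apply/eqP; rewrite eq_le (cdfT_le1 sl) -c1 (cdfT_nondecr sl).
by rewrite /dsurv /surv => ->; rewrite mul1r subrr mulr0.
Qed.

(* When the principal stops for sure by [t1], faking slightly before [t1] secures [mu]
   instead of [beta]. *)
Lemma uA_late t1 t t' : 0 <= t -> t < t1 -> a t = 1 -> cdfT (stop E) t < 1 ->
  cdfT (stop E) t1 = 1 -> h 0 * (t1 - t) < mu p - beta p -> t1 <= t' ->
  uA p E t'%:E < uA p E t%:E.
Proof.
move=> t0 tt1 at1 ct c1 small t1t'; have [rp b0 bm mt th1] := params hp.
have t10 : 0 <= t1 by lra.
have t'0 : 0 <= t' by lra.
rewrite !(uA_phi hp sE) // at1 (Y_late c1 t10 t1t') subrr mul0r mulr0 /waiting_value.
rewrite (Y_late c1 t10 t1t') !mulr0 !subr0 addr0.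
have Yt : 0 < Y t by rewrite /dsurv mulr_gt0 ?(disc_gt0 hp) // /surv mul1r subr_gt0.
have lY : locint Y by exact: (locint_dsurv hp sl (@one01 R)).
have lahY : locint (fun r => a r * (h r * Y r)) by exact: locintM_accept sE _ (locint_hY hp sE).
have i1 : prim Y t <= prim Y t'.
  apply: prim_nondecr => //; first lra.
  by move=> r tr _; have /andP[] := Y_itv hp sE (le_trans t0 (ltW tr)).
have i2 : prim (fun r => a r * (h r * Y r)) t' = prim (fun r => a r * (h r * Y r)) t1.
  apply: primB_eq0 => // r t1r _.
  by rewrite (Y_late c1 t10 (ltW t1r)) !mulr0.
have i3 : prim (fun r => a r * (h r * Y r)) t1 - prim (fun r => a r * (h r * Y r)) t
   <= (h 0 * Y t) * (t1 - t).
  apply: primB_le => //; first exact: ltW.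
  move=> r tr rt1; have r0 : 0 <= r by lra.
  have /andP[a0 a1] := accept_itv sE r0; have /andP[y0 y1] := Y_itv hp sE r0.
  have := Y_antihomo t0 (ltW tr) => yy; have := hazard_ge0 hp r0; have := hazard_le0 hp r0.
  move=> h1 h0; have : h r * Y r <= h 0 * Y t by apply: ler_pM.
  have : 0 <= h r * Y r by rewrite mulr_ge0.
  nra.
rewrite i2.
have i4 : 0 <= prim (fun r => a r * (h r * Y r)) t1 - prim (fun r => a r * (h r * Y r)) t.
  rewrite subr_ge0; apply: prim_nondecr => //; first exact: ltW.
  move=> r tr rt1; have r0 : 0 <= r by lra.
  have /andP[a0 a1] := accept_itv sE r0; have /andP[y0 y1] := Y_itv hp sE r0.
  by apply: mulr_ge0 => //; apply: mulr_ge0 => //; exact: hazard_ge0.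
move: i3 i4; set P1 := prim _ t1; set P2 := prim _ t => i3 i4.
have : (h 0 * Y t) * (t1 - t) < (mu p - beta p) * Y t.
  have -> : (h 0 * Y t) * (t1 - t) = (h 0 * (t1 - t)) * Y t by ring.
  by rewrite ltr_pM2r.
have m1 : 0 <= mu p * (1 - beta p) <= 1 by apply/andP; split; nra.
have : mu p * (1 - beta p) * (P1 - P2) <= P1 - P2.
  by case/andP: m1 => m0 m1; rewrite ler_piMl.
have : 0 <= beta p * rho p * (prim Y t' - prim Y t).
  by rewrite mulr_ge0 ?subr_ge0 // mulr_ge0 // ltW.
lra.
Qed.

(** Once stopping is certain neither news nor a fake pays any more, so faking at [T] and never
    faking coincide. *)
Lemma uA_oo T : 0 <= T -> cdfT (stop E) T = 1 ->
  (forall r, T < r -> uncharged (stop E) r) -> uA p E +oo%E = uA p E T%:E.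
Proof.
move=> T0 c1 H.
have sT r : T <= r -> cdfT (stop E) r = 1.
  by move=> Tr; apply/eqP; rewrite eq_le (cdfT_le1 sl) -c1 (cdfT_nondecr sl).
rewrite /uA upto_oo upto_fin c1 subrr mulr0 mulr0 mul0r; congr (_ + _).
apply: flow_supp => //.
- exact: itv0_sub.
- by move=> r tr r0; have [-> ->] := H r tr; rewrite sT ?ltW // subrr; split; ring.
Qed.

End AgentLate.

(** * Indifference rates and survival functions with a given hazard rate *)

Section Rates.
Local Open Scope classical_set_scope.
Context {R : realType}.
Variable p : primitives R.
Hypothesis hp : standing p.
Implicit Types (r s t c : R) (l : R -> R).
Local Notation h := (hazard p).
Local Notation K := (disc p).
Local Notation dr := (discrate p).

(* Hazard rate of faking that keeps the principal indifferent between stopping now and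
   later when she accepts all type-1 news. *)
Definition fake_rate s :=
  (mu p * (1 - theta p) * hazard p s - rho p * theta p) / (theta p - mu p).

(* Hazard rate of stopping that keeps the agent indifferent between faking now and later
   when type-1 news is always accepted. *)
Definition stop_rate s :=
  (beta p * (1 - mu p) * hazard p s - rho p * mu p) / (mu p - beta p).

Lemma affine_hazard (u v w : R) :
  meas_pos (fun s => (u * h s - v) / w) /\ forall r, 0 <= r ->
    `|(u * h r - v) / w| <= (`|u| * h 0 + `|v|) * `|w^-1|.
Proof.
split.
  apply: measM; last exact: meas_cst.
  by apply: measB; [apply: measM; [exact: meas_cst|exact: meas_hazard]|exact: meas_cst].
move=> r r0; rewrite normrM ler_wpM2r //; apply: le_trans (ler_normB _ _) _.
by rewrite lerD2r normrM ler_wpM2l // hazard_norm.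
Qed.

Lemma locint_fake_rate : locint fake_rate.
Proof.
by have [m b] := affine_hazard (mu p * (1 - theta p)) (rho p * theta p) (theta p - mu p);
  exact: meas_locint m b.
Qed.

Lemma locint_stop_rate : locint stop_rate.
Proof.
by have [m b] := affine_hazard (beta p * (1 - mu p)) (rho p * mu p) (mu p - beta p);
  exact: meas_locint m b.
Qed.

(** With hazard rate [l], [dsurv] solves a linear equation of rate discrate - l, while [disc] solves
    one of rate [discrate]; their quotient is the survival function. *)
Lemma dsurv_exp F c l L s t : timing_law F -> 0 <= c <= 1 -> 0 <= s -> s <= t ->
  locint l -> (forall r, 0 <= r -> `|l r| <= L) ->
  (forall a b, s <= a -> a <= b -> b <= t ->
     c * (stieltjes F K b - stieltjes F K a) =
     prim (fun r => l r * dsurv p F c r) b - prim (fun r => l r * dsurv p F c r) a) ->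
  surv F c t = surv F c s * expR (- (prim l t - prim l s)).
Proof.
move=> lF c01 s0 st ll lL H.
have ld := locint_discrate hp.
have lk : locint (fun r => dr r - l r) by exact: locintB.
have L0 : 0 <= L by apply: le_trans (lL 0 (lexx _)).
have rp : 0 <= rho p by have [/ltW] := params hp.
have h0 := hazard_ge0 hp (lexx 0).
have E : dsurv p F c t = dsurv p F c s *
    expR (prim (fun r => dr r - l r) t - prim (fun r => dr r - l r) s).
  apply: (@linear_ode _ _ _ (1 + (rho p + h 0) + L)) => //.
  - move=> r r0 _; apply: le_trans (ler_normB _ _) _.
    by have := lL r r0; have := discrate_norm hp r0; lra.
  - exact: (locintM_dsurv hp lF c01).
  - move=> r sr _; have /andP[d0 d1] := dsurv_itv hp lF c01 (le_trans s0 sr).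
    rewrite ger0_norm //; lra.
  move=> a b sa ab bt; rewrite (dsurv_primB hp lF c (le_trans s0 sa) ab) H //.
  have l1 := locintM_dsurv hp lF c01 ld.
  have l2 := locintM_dsurv hp lF c01 ll.
  have P q : prim (fun r => (dr r - l r) * dsurv p F c r) q =
     prim (fun r => dr r * dsurv p F c r) q - prim (fun r => l r * dsurv p F c r) q.
    by rewrite -primBfun //; apply: eq_prim => r _ _; ring.
  by rewrite !P; ring.
move: E; rewrite /dsurv (disc_exp hp s0 st) !primBfun //.
have -> : prim dr t - prim l t - (prim dr s - prim l s) =
   (prim dr t - prim dr s) + - (prim l t - prim l s) by ring.
rewrite [in RHS]expRD => E.
have k0 : K s * expR (prim dr t - prim dr s) != 0.
  by rewrite mulf_neq0 // gt_eqF ?expR_gt0 // (disc_gt0 hp).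
by apply: (mulfI k0); rewrite E; ring.
Qed.

End Rates.

(** * Equilibria without certain immediate stopping *)

Section Characterization.
Local Open Scope classical_set_scope.
Context {R : realType}.
Variable p : primitives R.
Hypothesis hp : standing p.
Variable tauP : R.
Hypothesis htauP : is_tauP p tauP.
Variable sigma : R.
Hypothesis sigma01 : 0 < sigma < 1.
Variable E : profile R.
Hypothesis eqE : equilibrium p sigma E.
Implicit Types (r s t c : R).

Local Notation h := (hazard p).
Local Notation K := (disc p).
Local Notation a := (accept E).
Local Notation Y := (dsurv p (stop E) 1).
Local Notation Z := (dsurv p (fake E) sigma).
Local Notation S := (surv (fake E) sigma).
Local Notation f := (dens (fake E)).
Local Notation gain := (accept_gain p sigma E).
Local Notation T := tauP.
Local Notation phi := (waiting_value p E).
Local Notation phirate := (waiting_rate p E).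
Local Notation FP := (cdfT (stop E)).
Local Notation FA := (cdfT (fake E)).

Let sE := eq_strategies eqE.
Let sl := stop_law sE.
Let fl := fake_law sE.
Let T0 := tauP_gt0 htauP.

Variables V M : R.
Hypothesis V1 : forall t, 0 <= t -> uP p sigma E t%:E <= V.
Hypothesis V2 : forall r, 0 <= r -> charged (stop E) r%:E -> uP p sigma E r%:E = V.
Hypothesis M1 : forall t : \bar R, (0 <= t)%E -> uA p E t <= M.
Hypothesis M2 : forall t : \bar R, (0 <= t)%E -> charged (fake E) t -> uA p E t = M.

(** The infimum of the times at which the CDF is 1; right-continuity makes it attained. *)
Lemma last_stop : FP 0 < 1 -> exists t1, [/\ 0 < t1, t1 <= T, FP t1 = 1 &
  forall r, 0 <= r -> r < t1 -> FP r < 1].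
Proof.
move=> F0; pose A := [set r | 0 <= r /\ FP r = 1].
have AT : A T by split; [exact: ltW|exact: (stop_cdf_T hp htauP sigma01 eqE)].
have infA : has_inf A by split; [exists T|exists 0 => r []].
have i0 : 0 <= inf A by apply: lb_le_inf; [exists T|move=> r []].
have lt r : 0 <= r -> r < inf A -> FP r < 1.
  move=> r0 ri; rewrite lt_neqAle (cdfT_le1 sl) andbT; apply/eqP => e.
  have : inf A <= r by apply: ge_inf => //; case: infA.
  by rewrite leNgt ri.
have i1 : FP (inf A) = 1.
  apply/eqP; apply: contraT => ne.
  have e0 : 0 < 1 - FP (inf A) by rewrite subr_gt0 lt_neqAle ne (cdfT_le1 sl).
  have [d id Hd] := cdfT_rcont sl i0 e0.
  have di : 0 < d - inf A by rewrite subr_gt0.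
  have [x [x0 x1] xd] := inf_adherent di infA.
  have ix : inf A <= x by apply: ge_inf => //; case: infA.
  by have := Hd x ix; rewrite x1 ltxx => ->//; lra.
exists (inf A); split => //.
- by rewrite lt_neqAle i0 andbT; apply/eqP => e; rewrite -e in i1; rewrite i1 ltxx in F0.
- by apply: ge_inf => //; case: infA.
Qed.

Section LastStop.
Variable t1 : R.
Hypotheses (t10 : 0 < t1) (t1T : t1 <= T) (F1 : FP t1 = 1).
Hypothesis Flt : forall r, 0 <= r -> r < t1 -> FP r < 1.

Lemma uA_after t : t1 <= t -> uA p E t%:E < M.
Proof.
have [t10' t1T'] := (t10, t1T).
move=> t1t; have [rp b0 bm mt th1] := params hp.
have h0 := hazard_gt0 hp (lexx 0).
(* Half of the margin allowed by [uA_late], so that its strict inequality holds. *)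
pose s := Num.max 0 (t1 - (mu p - beta p) / (2 * h 0)).
have d0 : 0 < (mu p - beta p) / (2 * h 0) by rewrite divr_gt0 //; lra.
have s0 : 0 <= s by rewrite le_max lexx.
have s1 : s < t1 by rewrite gt_max t10 /= ltrBlDr ltrDl.
have s2 : t1 - (mu p - beta p) / (2 * h 0) <= s by rewrite le_max lexx orbT.
have small : h 0 * (t1 - s) < mu p - beta p.
  apply: (@le_lt_trans _ _ (h 0 * ((mu p - beta p) / (2 * h 0)))).
    by rewrite ler_pM2l //; lra.
  have -> : h 0 * ((mu p - beta p) / (2 * h 0)) = (mu p - beta p) / 2.
    by field; rewrite gt_eqF.
  lra.
have a1 := accept1 hp htauP sigma01 eqE V1 V2 M1 M2 s0 (Flt s0 s1).
apply: lt_le_trans (uA_late hp sE s0 s1 a1 (Flt s0 s1) F1 small t1t) _.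
by apply: M1; exact: lt_fin0.
Qed.

Lemma fake_uncharged_after r : t1 <= r -> uncharged (fake E) r.
Proof.
move=> t1r; apply: (fake_uncharged eqE M2); first exact: le_trans (ltW t10) t1r.
exact: uA_after.
Qed.

(** Never faking pays as much as faking at [tauP], which is after the last stop and hence worse than
    [M]. *)
Lemma fake_mass0 : mass_infty (fake E) = 0.
Proof.
apply/eqP; rewrite eq_le (mass_infty_ge0 fl) andbT leNgt; apply/negP => ch.
have := M2 (t := +oo%E) (leey _) ch.
rewrite (@uA_oo _ p E sE T (ltW T0)) //.
- by move=> e; have := uA_after t1T; rewrite e ltxx.
- exact: (stop_cdf_T hp htauP sigma01 eqE).
- exact: (stop_before hp htauP sigma01 eqE).
Qed.

Lemma fake_cdf_after t : t1 <= t -> FA t = 1.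
Proof.
have [t10' t1T'] := (t10, t1T).
move=> t1t; have : tmass (fake E) = 1.
  by have := fake_mass0; rewrite /mass_infty -/(tmass _) => /eqP; rewrite subr_eq0 => /eqP.
rewrite (@tmass_flat _ _ t) // => r tr r0; apply: fake_uncharged_after; lra.
Qed.

Lemma accept_all r : 0 <= r -> a r = 1.
Proof.
move=> r0; have [rt|tr] := ltP r t1.
  exact: (accept1 hp htauP sigma01 eqE V1 V2 M1 M2 r0 (Flt r0 rt)).
by apply: (accept_uncharged hp sigma01 eqE r0); exact: fake_uncharged_after.
Qed.

Lemma no_atom r : 0 <= r -> atom (fake E) r = 0.
Proof.
move=> r0; apply/eqP; apply: contraT => ne.
have : a r = 0 by apply: (reject_atom hp eqE) => //; rewrite lt_neqAle eq_sym ne (atom_ge0 fl).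
by rewrite accept_all // => /eqP; rewrite oner_eq0.
Qed.

(** The stopping payoff under certain acceptance, as a function on the whole line: being continuous
    there, it can be fed to [last_hit] and [first_hit]. *)
Definition value_stop t := theta p * (1 - rho p * prim Z t) + prim gain t.

Lemma uP_value_stop t : 0 <= t -> uP p sigma E t%:E = value_stop t.
Proof.
move=> t0; rewrite (uPE hp sigma01 eqE t0) /value_stop; congr (_ + _).
by apply: eq_prim => r r0 _; rewrite accept_all // mul1r.
Qed.

Let lZ : locint Z. Proof. exact: (locint_Z hp sigma01 eqE). Qed.
Let lg : locint gain. Proof. exact: (locint_gain hp sigma01 sE). Qed.

Lemma value_stop_continuous : continuous value_stop.
Proof.
move=> x; apply: cvgD; last exact: prim_continuous.
apply: cvgM; first exact: cvg_cst.
apply: cvgB; first exact: cvg_cst.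
apply: cvgM; [exact: cvg_cst|exact: prim_continuous].
Qed.

Lemma value_stop_le t : 0 <= t -> value_stop t <= V.
Proof. by move=> t0; rewrite -uP_value_stop // V1. Qed.

Lemma no_stop_below r : 0 <= r -> value_stop r <> V -> uncharged (stop E) r.
Proof.
move=> r0 ne; apply: (stop_uncharged eqE V2) => //.
by rewrite uP_value_stop // lt_neqAle value_stop_le // andbT; apply/eqP.
Qed.

(** Otherwise, by continuity, she would not stop during an interval ending at [t1], and stopping
    would be certain already before [t1]. *)
Lemma value_stop_last : value_stop t1 = V.
Proof.
have [t10' t1T'] := (t10, t1T).
apply/eqP; apply: contraT => ne.
have e0 : 0 < `|V - value_stop t1| by rewrite normr_gt0 subr_eq0 eq_sym.
have [d d0 Hd] := continuous_near t1 value_stop_continuous e0.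
pose s := Num.max 0 (t1 - d / 2).
have s0 : 0 <= s by rewrite le_max lexx.
have s1 : s < t1 by rewrite gt_max t10 /= ltrBlDr ltrDl divr_gt0.
have s2 : t1 - d / 2 <= s by rewrite le_max lexx orbT.
have : FP t1 = FP s.
  apply: (cdfT_flat sl) => //; first exact: ltW.
  move=> r sr rt; apply: no_stop_below; first lra.
  move=> e; have := Hd r; rewrite e [`|value_stop t1 - V|]distrC ltxx => H.
  suff : false by []. apply: H; rewrite ltr_norml; apply/andP; split; lra.
by have := Flt s0 s1; rewrite F1 => + e; rewrite -e ltxx.
Qed.

Lemma phi_max r : 0 <= r -> r < t1 -> phi r <= M.
Proof. by move=> r0 rt; apply: (phi_le_max hp htauP sigma01 eqE V1 V2 M1 M2) => //; exact: Flt. Qed.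

Lemma phi_uA r : 0 <= r -> uA p E r%:E = phi r.
Proof. by move=> r0; rewrite (uA_phi hp sE r0) accept_all // subrr mul0r mulr0 subr0. Qed.

Lemma phirate1 r : 0 <= r -> phirate r = (beta p * (1 - mu p) * h r - rho p * mu p) * Y r.
Proof. by move=> r0; rewrite /waiting_rate accept_all //; ring. Qed.

Lemma phi_incr s t : 0 <= s -> s < t -> t <= t1 -> FP t = FP s -> phi s < phi t.
Proof.
have [t10' t1T'] := (t10, t1T).
move=> s0 st tt e; rewrite -subr_gt0 (phi_flat hp sE s0 (ltW st) e) subr_gt0.
apply: prim_lt => //; first exact: (locint_phirate hp sE).
move=> r sr rt; have r0 : 0 <= r by lra.
rewrite phirate1 // mulr_gt0 //; first by apply: (gainA_gt0 hp htauP); lra.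
by rewrite (Y_gt0P hp) // Flt //; lra.
Qed.

(* Without stops on [[s, t]] the agent strictly prefers waiting, so nobody fakes there. *)
Lemma no_stop_no_fake s t : 0 <= s -> s < t -> t < t1 ->
  (forall r, s < r -> r <= t -> value_stop r <> V) ->
  forall r, s <= r -> r < t -> uncharged (fake E) r.
Proof.
have [t10' t1T'] := (t10, t1T).
move=> s0 st tt H r sr rt; apply: (fake_uncharged eqE M2); first lra.
rewrite phi_uA; last lra.
have r0 : 0 <= r by lra.
apply: lt_le_trans (phi_max (le_trans s0 (ltW st)) tt).
apply: phi_incr => //; first lra.
apply: (cdfT_flat sl) => //; first exact: ltW.
by move=> q rq qt; apply: no_stop_below; [lra|apply: H; lra].
Qed.

Lemma value_stopB s t : 0 <= s -> s <= t -> value_stop t - value_stop s =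
  prim (fun r => gain r - theta p * rho p * Z r) t - prim (fun r => gain r -
    theta p * rho p * Z r) s.
Proof.
move=> s0 st; have l := locintZ (theta p * rho p) lZ.
have P w : prim (fun r => gain r - theta p * rho p * Z r) w =
    prim gain w - theta p * rho p * prim Z w by rewrite primBfun // primZ.
by rewrite /value_stop !P; ring.
Qed.

Lemma value_stop_incr s t : 0 <= s -> s < t -> t <= T ->
  (forall r, s < r -> r < t -> uncharged (fake E) r) -> value_stop s < value_stop t.
Proof.
have [t10' t1T'] := (t10, t1T).
move=> s0 st tT H; rewrite -subr_gt0 value_stopB ?(ltW st) // subr_gt0.
apply: prim_lt => //; first by apply: locintB => //; exact: locintZ.
move=> r sr rt; have r0 : 0 <= r by lra.
rewrite /accept_gain; have [-> _] := H r sr rt.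
have -> : mu p * (1 - theta p) * (h r * Z r) - (theta p - mu p) * sigma * (0 * K r)
   - theta p * rho p * Z r = (mu p * (1 - theta p) * h r - rho p * theta p) * Z r by ring.
apply: mulr_gt0; last exact: (Z_gt0 hp sigma01 eqE).
by apply: (gainP_gt0 hp htauP) => //; lra.
Qed.

(** After the last visit [d] to the maximum she would not stop, so nobody would fake until [x], so
    her payoff would rise above the maximum. *)
Lemma value_stop_const c x : 0 <= c -> c <= x -> x <= t1 -> value_stop c = V -> value_stop x = V.
Proof.
have [t10' t1T'] := (t10, t1T).
move=> c0 cx; rewrite le_eqVlt => /predU1P[-> _|xt uc]; first exact: value_stop_last.
have [//|ux] := pselect (value_stop x = V).
have [d [cd dx ud Hd]] := last_hit value_stop_continuous cx uc ux.
have d0 := le_trans c0 cd.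
have := value_stop_incr d0 dx (le_trans (ltW xt) t1T).
have nf := no_stop_no_fake d0 dx xt Hd.
rewrite ud ltNge value_stop_le; last lra.
by move=> H; have := H (fun r dr rx => nf r (ltW dr) rx).
Qed.

(** Nobody fakes after [t1], so if [t1] preceded [tauP] her payoff would still rise above [V]. *)
Lemma last_stopE : t1 = T.
Proof.
apply/eqP; apply: contraT => ne; have lt : t1 < T by rewrite lt_neqAle ne.
have := value_stop_incr (ltW t10) lt (lexx T); rewrite value_stop_last ltNge value_stop_le;
  last exact: ltW.
by move=> H; have := H (fun r tr _ => fake_uncharged_after (ltW tr)).
Qed.

Section FirstStop.
Variable t0 : R.
Hypotheses (t00 : 0 <= t0) (t0t1 : t0 <= t1) (u0 : value_stop t0 = V).
Hypothesis ult : forall y : R, 0 <= y -> y < t0 -> value_stop y <> V.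

Lemma stop_uncharged_before r : 0 <= r -> r < t0 -> uncharged (stop E) r.
Proof. by move=> r0 rt; apply: no_stop_below => //; exact: ult. Qed.

Lemma stop_cdf_before r : 0 <= r -> r < t0 -> FP r = 0.
Proof.
have [[t10' t1T'] [t00' t0t1']] := ((t10, t1T), (t00, t0t1)).
move=> r0 rt; rewrite (cdfT_flat sl (lexx 0) r0).
  by rewrite (cdfT0 sl); have [] := stop_uncharged_before (lexx 0) (le_lt_trans r0 rt).
by move=> q q0 qr; apply: stop_uncharged_before; lra.
Qed.

Lemma fake_uncharged_before r : 0 <= r -> r < t0 -> uncharged (fake E) r.
Proof.
have [[t10' t1T'] [t00' t0t1']] := ((t10, t1T), (t00, t0t1)).
move=> r0 rt; apply: (@no_stop_no_fake r ((r + t0) / 2)) => //; try lra.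
by move=> q rq qt; apply: ult; lra.
Qed.

Lemma fake_cdf_before r : 0 <= r -> r <= t0 -> FA r = 0.
Proof.
have [[t10' t1T'] [t00' t0t1']] := ((t10, t1T), (t00, t0t1)).
have c r' : 0 <= r' -> r' < t0 -> FA r' = 0.
  move=> r0 rt; rewrite (cdfT_flat fl (lexx 0) r0).
    by rewrite (cdfT0 fl) no_atom.
  by move=> q q0 qr; apply: fake_uncharged_before; lra.
move=> r0; rewrite le_eqVlt => /predU1P[->|]; last exact: c.
have d0 s : 0 <= s -> s <= t0 -> FA s = prim f s.
  move=> s0 _; rewrite cdfTE /jump jumps_eq0 ?addr0 // => q /=.
  by rewrite in_itv /= => /andP[q0 _]; rewrite no_atom // mul0r.
rewrite d0 // -[RHS](prim0 f); apply/eqP; rewrite -subr_eq0; apply/eqP.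
rewrite (@eq_primBo _ f (fun=> 0) 0 t0) //.
- by rewrite !prim_cst // !mul0r subrr.
- exact: (locint_dens fl).
- exact: locint_cst.
- by move=> q q0 qt; have [] := fake_uncharged_before (ltW q0) qt.
Qed.

Lemma fake_stieltjesB s t : 0 <= s -> s <= t ->
  stieltjes (fake E) K t - stieltjes (fake E) K s = prim (fun r => f r * K r) t -
    prim (fun r => f r * K r) s.
Proof.
have J q : jump (fake E) K q = 0.
  rewrite /jump jumps_eq0 // => r /=; rewrite in_itv /= => /andP[r0 _].
  by rewrite no_atom // mul0r.
by move=> _ _; rewrite /stieltjes !J; ring.
Qed.

(** From [t0] on her payoff is constant, so the gain net of interest integrates to 0 over every
    subinterval; solved for the faking density, this is the hazard rate [fake_rate]. *)
Lemma fake_surv t : t0 <= t -> t <= T ->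
  S t = expR (- (prim (fake_rate p) t - prim (fake_rate p) t0)).
Proof.
have [[t10' t1T'] [t00' t0t1']] := ((t10, t1T), (t00, t0t1)).
move=> t0t tT; have [rp b0 bm mt th1] := params hp.
have [m b] := affine_hazard hp (mu p * (1 - theta p)) (rho p * theta p) (theta p - mu p).
rewrite (@dsurv_exp _ p hp (fake E) sigma (fake_rate p) _ t0 t fl (sigma01w sigma01) t00 t0t
   (locint_fake_rate hp) b).
  by rewrite {1}/surv fake_cdf_before // mulr0 subr0 mul1r.
move=> s q t0s sq qt; have s0 := le_trans t00 t0s.
rewrite fake_stieltjesB //.
have q1 : q <= t1 by rewrite last_stopE; lra.
have e1 : value_stop q = V by apply: (value_stop_const t00 (le_trans t0s sq) q1).
have e2 : value_stop s = V by apply: (value_stop_const t00 t0s (le_trans sq q1)).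
have e := value_stopB s0 sq; rewrite e1 e2 subrr in e.
have lhZ := locint_hZ hp sigma01 sE.
have lfK := locint_densK hp fl.
have P w : prim (fun r => gain r - theta p * rho p * Z r) w =
   mu p * (1 - theta p) * prim (fun r => h r * Z r) w
   - (theta p - mu p) * sigma * prim (fun r => f r * K r) w - theta p * rho p * prim Z w.
  rewrite primBfun ?primZ //; last exact: locintZ.
  by rewrite /accept_gain primBfun ?primZ //; exact: locintZ.
have Q w : prim (fun r => fake_rate p r * Z r) w =
  (theta p - mu p)^-1 * (mu p * (1 - theta p) * prim (fun r => h r * Z r) w
     - theta p * rho p * prim Z w).
  rewrite -!primZ // -?primBfun -?primZ //; try exact: locintZ.
    by apply: eq_prim => r _ _; rewrite /fake_rate; ring.
  by apply: locintB; exact: locintZ.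
rewrite !P in e; rewrite !Q.
have d0 : theta p - mu p != 0 by rewrite gt_eqF // subr_gt0.
apply: (mulfI d0); rewrite !mulrBr !mulVKf // ?mulrA ?divff //.
rewrite ?mul1r; lra.
Qed.

Lemma sigma_first : 1 - sigma = expR (- (prim (fake_rate p) T - prim (fake_rate p) t0)).
Proof.
rewrite -fake_surv ?lexx // -?last_stopE //.
by rewrite /surv fake_cdf_after // mulr1.
Qed.

Lemma max_first : V = theta p +
  prim (fun r => K r * (mu p * (1 - theta p) * h r - rho p * theta p)) t0.
Proof.
rewrite -u0; have := value_stopB (lexx 0) t00; rewrite !prim0 subr0.
have -> : value_stop 0 = theta p by rewrite /value_stop !prim0; ring.
have lk : locint (fun r => K r * (mu p * (1 - theta p) * h r - rho p * theta p)).
  have m : meas_pos (fun r => mu p * (1 - theta p) * h r - rho p * theta p).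
    by apply: measB; [apply: measM; [exact: meas_cst|exact: (meas_hazard hp)]|exact: meas_cst].
  apply: (locint_discM hp m).
  have [_ b] := affine_hazard hp (mu p * (1 - theta p)) (rho p * theta p) 1.
  by apply: bounded_locbnd => r r0; have := b r r0; rewrite divr1; apply.
move=> e; have -> : value_stop t0 = theta p + (value_stop t0 - theta p) by ring.
congr (_ + _); rewrite e.
rewrite -[LHS]subr0 -[X in _ - X](prim0 (fun r => gain r - theta p * rho p * Z r)).
rewrite -[RHS]subr0 -[X in _ = _ - X](prim0 (fun r => K r * (mu p * (1 - theta p) * h r -
  rho p * theta p))).
apply: eq_primBo => //; first by apply: locintB => //; exact: locintZ.
move=> r r0 rt; have [f0 _] := fake_uncharged_before (ltW r0) rt.
by rewrite /accept_gain f0 /dsurv /surv fake_cdf_before ?ltW //; ring.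
Qed.

(** A value below [M] would last for a while and exclude faking, but [fake_surv] decreases strictly
    before [tauP]. At [tauP] itself stopping is certain and the value is lower. *)
Lemma phi_const t : t0 <= t -> t < T -> phi t = M.
Proof.
have [[t10' t1T'] [t00' t0t1']] := ((t10, t1T), (t00, t0t1)).
move=> t0t tT; have tt1 : t < t1 by rewrite last_stopE.
have t'0 := le_trans t00 t0t.
apply/eqP; rewrite eq_le phi_max //= leNgt; apply/negP => lt.
have [d td Hd] := phi_lt_rcont hp sE t'0 lt.
pose q := Num.min ((t + d) / 2) ((t + T) / 2).
have tq : t < q by rewrite lt_min; apply/andP; split; lra.
have qd : q < d by rewrite gt_min; apply/orP; left; lra.
have qT : q < T by rewrite gt_min; apply/orP; right; lra.
have un r : t <= r -> r <= q -> uncharged (fake E) r.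
  move=> tr rq; apply: (fake_uncharged eqE M2); first lra.
  by rewrite phi_uA; [apply: Hd; lra|lra].
have eS : S q = S t.
  rewrite /surv (cdfT_flat fl t'0 (ltW tq)) // => r tr rq; apply: un => //; exact: ltW.
have lt2 : S q < S t.
  have t0q : t0 <= q by exact: le_trans (ltW tq).
  rewrite (fake_surv t0q (ltW qT)) (fake_surv t0t (ltW tT)).
  rewrite ltr_expR ltrN2 ltrD2r; apply: prim_lt => //.
    exact: (locint_fake_rate hp).
  move=> r tr rq; rewrite /fake_rate divr_gt0 //.
    by apply: (gainP_gt0 hp htauP) => //; lra.
  by have [rp b0 bm mt th1] := params hp; lra.
by rewrite eS ltxx in lt2.
Qed.

(** A stopping atom at [t0] would make the value of faking drop there to [M], hence exceed [M]
    shortly before; [0 < t0] provides these earlier times. *)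
Lemma stop_cdf_first : 0 < t0 -> t0 < T -> FP t0 = 0.
Proof.
have [[t10' t1T'] [t00' t0t1']] := ((t10, t1T), (t00, t0t1)).
move=> t0p t0T; have [rp b0 bm mt th1] := params hp.
apply/eqP; rewrite eq_le (cdfT_ge0 sl) // andbT leNgt; apply/negP => F0.
have Kt := disc_gt0 hp t0.
pose q := K t0 * FP t0; have q0 : 0 < q by exact: mulr_gt0.
have b1 : 0 < phibnd p by rewrite /phibnd; have := hazard_ge0 hp (lexx 0); lra.
(* Over a time [e] the drift offsets at most half of what the atom costs. *)
pose e := (mu p - beta p) * q / 2 / phibnd p.
have e0 : 0 < e by rewrite !divr_gt0 // mulr_gt0 // subr_gt0.
pose s := Num.max 0 (t0 - e).
have s0 : 0 <= s by rewrite le_max lexx.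
have s1 : s < t0 by rewrite gt_max t0p /= ltrBlDr ltrDl.
have s2 : t0 - e <= s by rewrite le_max lexx orbT.
have le : phi s <= phi t0.
  by rewrite (phi_const (lexx t0) t0T) phi_max //; lra.
have := phiB hp sE s0 (ltW s1) => H.
have B : `|prim phirate t0 - prim phirate s| <= phibnd p * (t0 - s).
  apply: primB_norm => //; first exact: (locint_phirate hp sE).
  - exact: ltW.
  - by move=> r sr _; apply: (phirate_norm hp sE); lra.
have J : q <= stieltjes (stop E) K t0 - stieltjes (stop E) K s.
  rewrite /q -[FP t0]subr0 -(stop_cdf_before s0 s1); apply: (stieltjesB_ge sl) => //.
  - exact: ltW.
  - exact: (meas_disc hp).
  - exact: (locbnd_disc hp).
  - by move=> r r0; exact: ltW (disc_gt0 hp _).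
  - exact: ltW.
  - by move=> r sr rt; apply: (disc_antihomo hp) => //; lra.
have J' : (mu p - beta p) * q <= (mu p - beta p) * (stieltjes (stop E) K t0 -
  stieltjes (stop E) K s).
  by rewrite ler_pM2l // subr_gt0.
have C : phibnd p * (t0 - s) <= (mu p - beta p) * q / 2.
  have -> : (mu p - beta p) * q / 2 = phibnd p * e by rewrite /e; field; rewrite gt_eqF.
  by rewrite ler_pM2l //; lra.
have D : 0 < (mu p - beta p) * q by rewrite mulr_gt0 // subr_gt0.
have := le_trans (ler_norm _) B; lra.
Qed.

Lemma stop_surv t : 0 < t0 -> t0 <= t -> t < T ->
  surv (stop E) 1 t = expR (- (prim (stop_rate p) t - prim (stop_rate p) t0)).
Proof.
have [[t10' t1T'] [t00' t0t1']] := ((t10, t1T), (t00, t0t1)).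
move=> t0p t0t tT; have [rp b0 bm mt th1] := params hp.
have [m b] := affine_hazard hp (beta p * (1 - mu p)) (rho p * mu p) (mu p - beta p).
rewrite (@dsurv_exp _ p hp (stop E) 1 (stop_rate p) _ t0 t sl (@one01 R) t00 t0t
   (locint_stop_rate hp) b).
  by rewrite {1}/surv stop_cdf_first ?mulr0 ?subr0 ?mul1r //; lra.
move=> s q t0s sq qt; have s0 := le_trans t00 t0s.
have e := phiB hp sE s0 sq; rewrite !phi_const in e; try lra.
have d0 : mu p - beta p != 0 by rewrite gt_eqF // subr_gt0.
have Q w : prim phirate w = (mu p - beta p) * prim (fun r => stop_rate p r * Y r) w.
  rewrite -primZ; last by apply: (locintM_dsurv hp sl (@one01 R)); exact: locint_stop_rate.
  by apply: eq_prim => r r0 _; rewrite phirate1 // /stop_rate; field.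
rewrite !Q in e; apply: (mulfI d0); lra.
Qed.

End FirstStop.
End LastStop.

(** The stopping law is given only for [0 < t0]: when [t0 = 0], an initial atom of stopping is not
    excluded. *)
Lemma equilibrium_shape : FP 0 < 1 -> exists t0,
  [/\ [/\ 0 <= t0, t0 <= T,
      1 - sigma = expR (- (prim (fake_rate p) T - prim (fake_rate p) t0)) &
      V = theta p + prim (fun r => K r * (mu p * (1 - theta p) * h r - rho p * theta p)) t0],
      forall r, 0 <= r -> a r = 1,
      [/\ forall r, 0 <= r -> r <= t0 -> FA r = 0,
       forall r, t0 <= r -> r <= T ->
         1 - sigma * FA r = expR (- (prim (fake_rate p) r - prim (fake_rate p) t0)) &
       forall r, T <= r -> FA r = 1] &
      [/\ forall r, 0 <= r -> r < t0 -> FP r = 0,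
       forall r, 0 < t0 -> t0 <= r -> r < T ->
         1 - FP r = expR (- (prim (stop_rate p) r - prim (stop_rate p) t0)) &
       forall r, T <= r -> FP r = 1]].
Proof.
move=> F0; have [t1 [t10 t1T Ft1 Flt]] := last_stop F0.
have ul := value_stop_last t10 t1T Ft1 Flt.
have [t0 [t00 t01 u0 ult]] := first_hit value_stop_continuous (ltW t10) ul.
have tT := last_stopE t10 t1T Ft1 Flt.
exists t0; split; [split|exact: (accept_all t10 t1T Ft1 Flt)|split|split].
- by [].
- by rewrite -tT.
- exact: (sigma_first t10 t1T Ft1 Flt t00 t01 u0 ult).
- exact: (max_first t10 t1T Ft1 Flt t00 t01 u0 ult).
- exact: (fake_cdf_before t10 t1T Ft1 Flt t00 t01 ult).
- exact: (fake_surv t10 t1T Ft1 Flt t00 t01 u0 ult).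
- by rewrite -tT; exact: (fake_cdf_after t10 t1T Ft1 Flt).
- exact: (stop_cdf_before t10 t1T Ft1 Flt t00 t01 ult).
- move=> r t0p t0r rT; rewrite -(stop_surv t10 t1T Ft1 Flt t00 t01 u0 ult t0p t0r rT).
  by rewrite /surv mul1r.
- exact: (stop_cdf_T hp htauP sigma01 eqE).
Qed.

End Characterization.

(** * The equilibrium with beneficial search *)

Section HazardDensity.
Local Open Scope classical_set_scope.
Context {R : realType}.
Implicit Types (r s t : R).
Variables (l : R -> R) (L t0 T : R).
Hypotheses (ll : locint l) (lL : forall r, 0 <= r -> `|l r| <= L).
Hypothesis l0 : forall r, 0 <= r -> r <= T -> 0 <= l r.
Hypotheses (t00 : 0 <= t0) (t0T : t0 < T).

(* Density on [[t0, T[] of a random time with hazard rate [l]. *)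
Definition hdens r :=
  if (t0 <= r) && (r < T) then l r * expR (- (prim l r - prim l t0)) else 0.

Lemma locint_hdens : locint hdens.
Proof.
(* Indicator of [t0, T[, split into a nondecreasing and a nonincreasing factor for measurability. *)
pose i r := ((t0 <= r)%R : nat)%:R * ((r < T)%R : nat)%:R : R.
have mi : meas_pos i.
  apply: measM.
    by apply: meas_homo => s t s0 st; rewrite ler_nat; case: (leP t0 s) => // h;
      rewrite (le_trans h st).
  apply: meas_antihomo => s t s0 st; rewrite ler_nat; case: (ltP t T) => // h.
  by rewrite (le_lt_trans st h).
have bi : locbnd i.
  apply: (@bounded_locbnd _ _ 1) => r _; rewrite /i.
  by case: (t0 <= r)%R; case: (r < T)%R;
    rewrite ?mulr0 ?mul0r ?mulr1 ?normr0 ?normr1 ?ler01 ?lexx.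
have ce : continuous (fun r => expR (- (prim l r - prim l t0))).
  move=> x; apply: continuous_comp; last exact: continuous_expR.
  apply: cvgN; apply: cvgB; [exact: prim_continuous|exact: cvg_cst].
apply: (locint_eq (locintM (locintMc ll ce) mi bi)) => r _.
by rewrite /hdens /i; case: (t0 <= r); case: (r < T); rewrite /= ?mulr1 ?mulr0 ?mul0r.
Qed.

Lemma hdens_ge0 r : 0 <= r -> 0 <= hdens r.
Proof.
move=> r0; rewrite /hdens; case: ifPn => // /andP[_ rT].
by rewrite mulr_ge0 ?expR_ge0 // l0 // ltW.
Qed.

Lemma prim_hdens_before t : t <= t0 -> prim hdens t = 0.
Proof.
move=> tt; have [t_0|t_0] := ltP t 0; first exact: prim_neg.
rewrite -(prim0 hdens); apply/eqP; rewrite -subr_eq0.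
rewrite (@eq_primBo _ hdens (fun=> 0) 0 t) //; last 3 first.
- exact: locint_hdens.
- exact: locint_cst.
- by move=> r r0 rt; rewrite /hdens leNgt (lt_le_trans rt tt).
by rewrite !prim_cst // !mul0r subrr.
Qed.

Lemma prim_hdens t : t0 <= t -> t <= T ->
  prim hdens t = 1 - expR (- (prim l t - prim l t0)).
Proof.
move=> tt tT; have lN := locintN ll.
have lNL r : 0 <= r -> r <= t -> `|- l r| <= L by move=> r0 _; rewrite normrN lL.
have H := exp_rule t00 tt lN lNL.
have ce : continuous (fun r => expR (prim (fun x => - l x) r)).
  by move=> x; apply: continuous_comp; [exact: prim_continuous|exact: continuous_expR].
have lk : locint (fun r => - l r * expR (prim (fun x => - l x) r)) by exact: locintMc.
have lk2 := locintZ (- expR (prim l t0)) lk.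
have E : prim hdens t - prim hdens t0 =
  prim (fun r => - expR (prim l t0) * (- l r * expR (prim (fun x => - l x) r))) t -
  prim (fun r => - expR (prim l t0) * (- l r * expR (prim (fun x => - l x) r))) t0.
  apply: eq_primBo => //; first exact: locint_hdens.
  move=> r tr rt; rewrite /hdens (ltW tr) (lt_le_trans rt tT) /= primN // opprB addrC expRD.
  ring.
move: E; rewrite (prim_hdens_before (lexx t0)) subr0 !primZ // -mulrBr -H !primN // => ->.
have e1 : expR (prim l t0) * expR (- prim l t0) = 1 by rewrite -expRD subrr expR0.
rewrite opprB (expRD (prim l t0)); move: e1.
by move: (expR (prim l t0)) (expR _) (expR _) => u v w e; rewrite mulNr mulrBr e opprB.
Qed.

Lemma prim_hdens_after t : T <= t -> prim hdens t = 1 - expR (- (prim l T - prim l t0)).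
Proof.
move=> Tt; rewrite -(prim_hdens (ltW t0T) (lexx T)).
apply: primB_eq0 => //; first exact: locint_hdens.
  exact: ltW (le_lt_trans t00 t0T).
by move=> r Tr _; rewrite /hdens [r < T]ltNge (ltW Tr) andbF.
Qed.

End HazardDensity.

(** * The profile built from the indifference rates *)

Section Construction.
Local Open Scope classical_set_scope.
Context {R : realType}.
Variable p : primitives R.
Hypothesis hp : standing p.
Variable tauP : R.
Hypothesis htauP : is_tauP p tauP.
Variable sigma : R.
Hypothesis sigma01 : 0 < sigma < 1.
Variable t0 : R.
Implicit Types (r s t c : R).
Local Notation T := tauP.
Local Notation h := (hazard p).
Local Notation K := (disc p).
Hypotheses (t0_gt0 : 0 < t0) (t0_lt : t0 < T).
Local Notation LA := (prim (fake_rate p)).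
Local Notation LB := (prim (stop_rate p)).
Hypothesis sigmaE : 1 - sigma = expR (- (LA T - LA t0)).

Let t00 : 0 <= t0. Proof. exact: ltW. Qed.
Let T0 := tauP_gt0 htauP.

Local Notation dA := (hdens (fake_rate p) t0 T).
Local Notation dB := (hdens (stop_rate p) t0 T).
Local Notation q := (expR (- (LB T - LB t0))).

(** The ex ante law of fakes has hazard rate [fake_rate]; dividing by [sigma] conditions on the
    manipulative type and gives total mass 1 by [sigmaE]. *)
Definition eq_fake := Timing (fun r => dA r / sigma) (fun=> 0).
(** At rate [stop_rate] a mass [q] has not stopped before [tauP]; it becomes an atom there, so that
    stopping by [tauP] is certain. *)
Definition eq_stop := Timing dB (fun r => if r == T then q else 0).
Definition eq_profile := Profile (fun=> 1) eq_stop eq_fake.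

Local Notation E := eq_profile.

Let lA := locint_fake_rate hp.
Let lB := locint_stop_rate hp.

Lemma fake_rate_norm r : 0 <= r -> `|fake_rate p r| <=
  (`|mu p * (1 - theta p)| * h 0 + `|rho p * theta p|) * `|(theta p - mu p)^-1|.
Proof.
by have [_] := affine_hazard hp (mu p * (1 - theta p)) (rho p * theta p) (theta p - mu p); apply.
Qed.

Lemma stop_rate_norm r : 0 <= r -> `|stop_rate p r| <=
  (`|beta p * (1 - mu p)| * h 0 + `|rho p * mu p|) * `|(mu p - beta p)^-1|.
Proof.
by have [_] := affine_hazard hp (beta p * (1 - mu p)) (rho p * mu p) (mu p - beta p); apply.
Qed.

Lemma fake_rate_ge0 r : 0 <= r -> r <= T -> 0 <= fake_rate p r.
Proof.
move=> r0 rT; have [rp b0 bm mt t1] := params hp.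
by rewrite divr_ge0 ?(gainP_ge0 hp htauP) // subr_ge0 ltW.
Qed.

Lemma stop_rate_gt0 r : 0 <= r -> r <= T -> 0 < stop_rate p r.
Proof.
move=> r0 rT; have [rp b0 bm mt t1] := params hp.
by rewrite divr_gt0 ?(gainA_gt0 hp htauP) // subr_gt0.
Qed.

Lemma stop_rate_ge0 r : 0 <= r -> r <= T -> 0 <= stop_rate p r.
Proof. by move=> r0 rT; apply: ltW; exact: stop_rate_gt0. Qed.

Let sigma0 : 0 < sigma. Proof. by case/andP: sigma01. Qed.

Let ldA : locint dA. Proof. exact: (locint_hdens _ _ lA). Qed.
Let ldB : locint dB. Proof. exact: (locint_hdens _ _ lB). Qed.
Let ldAs : locint (fun r => dA r / sigma).
Proof. by apply: (locint_eq (locintZ sigma^-1 ldA)) => r _; rewrite mulrC. Qed.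

Lemma prim_dAs t : prim (fun r => dA r / sigma) t = prim dA t / sigma.
Proof. by rewrite mulrC -primZ //; apply: eq_prim => r _ _; rewrite mulrC. Qed.

Lemma dA_ge0 r : 0 <= r -> 0 <= dA r.
Proof. exact: (hdens_ge0 _ fake_rate_ge0). Qed.

Lemma dB_ge0 r : 0 <= r -> 0 <= dB r.
Proof. exact: (hdens_ge0 _ stop_rate_ge0). Qed.

Lemma eq_fake_law : timing_law eq_fake.
Proof.
have d0 r : 0 <= r -> 0 <= dA r / sigma by move=> r0; rewrite divr_ge0 ?dA_ge0 // ltW.
split => //; first exact: locint_meas ldAs.
rewrite (@esum1 _ _ _ (fun s : R => (0 : R)%:E)) // adde0.
apply: (@integral_oo_le _ _ 1 T) => // t Tt.
rewrite prim_dAs (prim_hdens_after lA fake_rate_norm t00 t0_lt Tt) -sigmaE.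
by rewrite opprB addrC subrK divff // gt_eqF.
Qed.

Lemma eq_stop_law : timing_law eq_stop.
Proof.
split => //=.
- exact: locint_meas ldB.
- exact: dB_ge0.
- by move=> t _; case: ifPn => // _; exact: expR_ge0.
have -> : (\esum_(s in `[0%R, +oo[) (if s == T then q else 0)%:E = q%:E)%R.
  rewrite (esumID [set T]); last by move=> r _; case: ifPn; rewrite lee_fin ?expR_ge0.
  rewrite [X in (_ + X)%E]esum1; last first.
    by move=> r [_ /= /eqP rT]; rewrite (negPf rT).
  rewrite adde0 setIidr.
    by rewrite esum_set1 eqxx // lee_fin expR_ge0.
  by move=> r /= ->; rewrite in_itv /= andbT ltW.
have : (\int[lebesgue_measure]_(s in `[0%R, +oo[) (dB s)%:E <= (1 - q)%:E)%E.
  apply: (@integral_oo_le _ _ _ T) => // [|t Tt]; first exact: dB_ge0.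
  by rewrite (prim_hdens_after lB stop_rate_norm t00 t0_lt Tt).
move=> le; apply: le_trans (leeD le (lexx _)) _.
by rewrite -EFinD subrK.
Qed.

Lemma eq_strats : strategies E.
Proof.
split => //=.
- by move=> t _; rewrite ler01 lexx.
- exact: eq_stop_law.
- exact: eq_fake_law.
Qed.

Let sl := eq_stop_law.
Let fl := eq_fake_law.

Lemma FA_E t : cdfT eq_fake t = prim dA t / sigma.
Proof.
rewrite cdfTE prim_dAs /jump jumps_eq0 ?addr0 // => r _ /=; exact: mul0r.
Qed.

Lemma FB_E t : t < T -> cdfT eq_stop t = prim dB t.
Proof.
move=> tT; rewrite cdfTE /jump jumps_eq0 ?addr0 // => r /=.
rewrite in_itv /= => /andP[_ rt]; rewrite lt_eqF ?mul0r //; exact: le_lt_trans tT.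
Qed.

Lemma FB_T : cdfT eq_stop T = 1.
Proof.
apply/eqP; rewrite eq_le (cdfT_le1 sl) cdfTE /=.
rewrite (prim_hdens lB stop_rate_norm t00 (ltW t0_lt) (lexx T)).
have := atom_le_jump sl (ltW T0); rewrite /= eqxx; lra.
Qed.

Lemma surv_fake t : t0 <= t -> t <= T -> surv eq_fake sigma t = expR (- (LA t - LA t0)).
Proof.
move=> tt tT; rewrite /surv FA_E (prim_hdens lA fake_rate_norm t00 tt tT).
have s0 : sigma != 0 by rewrite gt_eqF.
by rewrite mulrC (divfK s0) subKr.
Qed.

Lemma surv_stop_before t : t <= t0 -> surv eq_stop 1 t = 1.
Proof.
move=> tt; rewrite /surv FB_E ?prim_hdens_before ?mulr0 ?subr0 //.
exact: le_lt_trans t0_lt.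
Qed.

Lemma surv_stop t : t0 <= t -> t < T -> surv eq_stop 1 t = expR (- (LB t - LB t0)).
Proof.
move=> tt tT; rewrite /surv FB_E // (prim_hdens lB stop_rate_norm t00 tt (ltW tT)).
by rewrite mul1r subKr.
Qed.

Lemma stop_after r : T < r -> uncharged eq_stop r.
Proof. by move=> Tr; split; rewrite /= ?gt_eqF // /hdens [r < T]ltNge (ltW Tr) andbF. Qed.

Lemma fake_after r : T <= r -> uncharged eq_fake r.
Proof. by move=> Tr; split; rewrite //= /hdens [r < T]ltNge Tr andbF mul0r. Qed.

Local Notation Y := (dsurv p eq_stop 1).
Local Notation Z := (dsurv p eq_fake sigma).
Local Notation phi := (waiting_value p E).
Local Notation phirate := (waiting_rate p E).
Let sE := eq_strats.

Lemma eq_uA t : 0 <= t -> uA p E t%:E = phi t.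
Proof. by move=> t_0; rewrite (uA_phi hp sE t_0) subrr mul0r mulr0 subr0. Qed.

Lemma eq_phirate r : phirate r = (beta p * (1 - mu p) * h r - rho p * mu p) * Y r.
Proof. by rewrite /waiting_rate subrr mul0r !mulr0 subr0. Qed.

Lemma eq_phi_before s : 0 <= s -> s < t0 -> phi s < phi t0.
Proof.
move=> s0 st; have t0T := t0_lt; have t0p := t0_gt0.
have e : cdfT eq_stop t0 = cdfT eq_stop s.
  rewrite (FB_E t0_lt) (FB_E (lt_trans st t0_lt)).
  by rewrite (prim_hdens_before _ lB (lexx t0)) (prim_hdens_before _ lB (ltW st)).
rewrite -subr_gt0 (phi_flat hp sE s0 (ltW st) e) subr_gt0.
apply: prim_lt => //; first exact: (locint_phirate hp sE).
move=> r sr rt; rewrite eq_phirate mulr_gt0 //; first by apply: (gainA_gt0 hp htauP); lra.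
by rewrite /dsurv surv_stop_before ?mulr1 ?(disc_gt0 hp) // ltW.
Qed.

(** Before [tauP] stopping has no atom, and its density makes the loss from stops cancel the drift
    of waiting. *)
Lemma eq_phi_const t : t0 <= t -> t < T -> phi t = phi t0.
Proof.
move=> tt tT; have [rp b0 bm mt t1] := params hp.
apply/eqP; rewrite -subr_eq0 (phiB hp sE t00 tt).
have J s : s < T -> jump eq_stop K s = 0.
  move=> sT; rewrite /jump jumps_eq0 // => r /=.
  by rewrite in_itv /= => /andP[_ rs]; rewrite lt_eqF ?mul0r //; exact: le_lt_trans sT.
rewrite /stieltjes /= !J //.
have lsY : locint (fun r => stop_rate p r * Y r).
  exact: (locintM_dsurv hp sl (@one01 R) lB).
have Q w : prim phirate w = (mu p - beta p) * prim (fun r => stop_rate p r * Y r) w.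
  rewrite -primZ //; apply: eq_prim => r r0 _; rewrite eq_phirate /stop_rate; field.
  by rewrite gt_eqF // subr_gt0.
rewrite !Q -mulrBr !addr0.
rewrite (@eq_primBo _ (fun r => dB r * K r) (fun r => stop_rate p r * Y r) t0 t) ?subrr //.
  exact: (locint_densK hp sl).
move=> r tr rt; have rT := lt_trans rt tT.
by rewrite /dsurv surv_stop ?(ltW tr) // /hdens (ltW tr) rT /=; ring.
Qed.

Lemma eq_uA_after t : T <= t -> uA p E t%:E < phi t0.
Proof.
move=> Tt; have [rp b0 bm mt th1] := params hp.
have t0T := t0_lt; have t0p := t0_gt0; have h0 := hazard_gt0 hp (lexx 0).
pose s := Num.max t0 (T - (mu p - beta p) / (2 * h 0)).
have d0 : 0 < (mu p - beta p) / (2 * h 0) by rewrite divr_gt0 //; lra.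
have s0 : t0 <= s by rewrite le_max lexx.
have s1 : s < T by rewrite gt_max t0T /= ltrBlDr ltrDl.
have s2 : T - (mu p - beta p) / (2 * h 0) <= s by rewrite le_max lexx orbT.
have small : h 0 * (T - s) < mu p - beta p.
  apply: (@le_lt_trans _ _ (h 0 * ((mu p - beta p) / (2 * h 0)))).
    by rewrite ler_pM2l //; lra.
  have -> : h 0 * ((mu p - beta p) / (2 * h 0)) = (mu p - beta p) / 2.
    by field; rewrite gt_eqF.
  lra.
have sp : 0 <= s by lra.
have Fs : cdfT eq_stop s < 1.
  have := surv_stop s0 s1; rewrite /surv mul1r => e.
  by rewrite -subr_gt0 e expR_gt0.
have := @uA_late _ p hp E sE T s t sp s1 erefl Fs FB_T small Tt.
by rewrite (eq_uA sp) eq_phi_const.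
Qed.

(** All times in [t0, tauP[ tie by [eq_phi_const]; earlier ones forgo gains from waiting, and from
    [tauP] on, +oo included, stopping has become certain. *)
Lemma eq_AIC (t t' : \bar R) : (0 <= t)%E -> (0 <= t')%E ->
  charged (fake E) t -> uA p E t' <= uA p E t.
Proof.
have t0T := t0_lt; have t0p := t0_gt0.
have oo : uA p E +oo%E = uA p E T%:E.
  by rewrite (@uA_oo _ p E sE T (ltW T0) FB_T) //; exact: stop_after.
have top (u : \bar R) : (0 <= u)%E -> uA p E u <= phi t0.
  case: u => [u| |//]; last by move=> _; rewrite oo; apply: ltW; exact: eq_uA_after.
  rewrite lee_fin => u0; have [uT|Tu] := ltP u T; last by apply: ltW; exact: eq_uA_after.
  rewrite eq_uA //; have [ut|tu] := ltP u t0; first by apply: ltW; exact: eq_phi_before.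
  by rewrite eq_phi_const.
case: t => [r| |//] t_0 t'0.
  rewrite lee_fin in t_0 => -[] /=; last by rewrite ltxx.
  rewrite /hdens; case: ifPn; last by rewrite mul0r ltxx.
  by move=> /andP[tr rT] _; rewrite eq_uA // eq_phi_const // top.
rewrite /= /mass_infty -/(tmass _) (@tmass_flat _ _ T).
  rewrite FA_E (prim_hdens lA fake_rate_norm t00 (ltW t0T) (lexx T)) -sigmaE.
  by rewrite (_ : 1 - (1 - sigma) = sigma) ?divff ?subrr ?ltxx ?gt_eqF //; ring.
by move=> r Tr _; apply: fake_after; exact: ltW.
Qed.

(** Where fakes occur they use up the gain from accepting except for the interest rho theta, so the
    posterior stays at least [theta]; elsewhere news is genuine. Certain acceptance is thus
    optimal. *)
Lemma eq_mu1 r : 0 <= r -> theta p <= mu1 p sigma E r.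
Proof.
move=> r0; have [rp b0 bm mt t1] := params hp.
have D := mu1_den_gt0 hp sigma01 sE r0.
have N := mu1_noatom hp sigma01 sE r0 erefl.
rewrite -(ler_pM2r D) N -subr_ge0 (g_hazard hp).
have G1 := ltW (Gbar_gt0 hp r); have h0 := hazard_ge0 hp r0.
have S0 := ltW (surv_gt0 sigma01 sE r0).
have -> : mu p * (h r * (1 - G p r)) * surv (fake E) sigma r +
  mu p * sigma * dens (fake E) r * (1 - G p r) - theta p * (
  mu p * (h r * (1 - G p r)) * surv (fake E) sigma r +
  sigma * dens (fake E) r * (1 - G p r)) =
  (1 - G p r) * (mu p * (1 - theta p) * h r * surv (fake E) sigma r -
    (theta p - mu p) * (sigma * dens (fake E) r)) by ring.
apply: mulr_ge0 => //=.
have -> : sigma * (dA r / sigma) = dA r by rewrite mulrCA divff ?mulr1 // gt_eqF.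
rewrite /hdens; case: ifPn => [/andP[tr rT]|_].
  rewrite -surv_fake ?(ltW rT) //.
  have -> : (theta p - mu p) * (fake_rate p r * surv eq_fake sigma r) =
    (mu p * (1 - theta p) * h r - rho p * theta p) * surv eq_fake sigma r.
    by rewrite /fake_rate; field; rewrite gt_eqF // subr_gt0.
  have -> : mu p * (1 - theta p) * h r * surv eq_fake sigma r -
    (mu p * (1 - theta p) * h r - rho p * theta p) * surv eq_fake sigma r =
    rho p * theta p * surv eq_fake sigma r by ring.
  by apply: mulr_ge0 => //; rewrite mulr_ge0 //; lra.
rewrite mulr0 subr0; apply: mulr_ge0 => //; apply: mulr_ge0 => //.
by rewrite mulr_ge0 //; lra.
Qed.

Local Notation gain := (accept_gain p sigma E).

Lemma eq_uPB s t : 0 <= s -> s <= t -> uP p sigma E t%:E - uP p sigma E s%:E =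
  prim (fun r => gain r - theta p * rho p * Z r) t -
  prim (fun r => gain r - theta p * rho p * Z r) s.
Proof.
move=> s0 st.
have na r : 0 <= r -> 0 < atom (fake E) r -> accept E r = 0 by rewrite /= ltxx.
have lZ : locint Z by exact: (locint_dsurv hp fl (sigma01w sigma01)).
have lg : locint gain by exact: (locint_gain hp sigma01 sE).
rewrite !(uP_fin hp sigma01 sE na) // ?(le_trans s0) //.
have P w : prim (fun r => accept E r * gain r) w = prim gain w.
  by apply: eq_prim => r _ _; rewrite /= mul1r.
have Q w : prim (fun r => gain r - theta p * rho p * Z r) w =
    prim gain w - theta p * rho p * prim Z w.
  by rewrite primBfun // ?primZ //; exact: locintZ.
rewrite !P !Q; ring.
Qed.

Lemma locint_eq_uPB : locint (fun r => gain r - theta p * rho p * Z r).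
Proof.
apply: locintB; first exact: (locint_gain hp sigma01 sE).
apply: locintZ; exact: (locint_dsurv hp fl (sigma01w sigma01)).
Qed.

Lemma eq_gain_unf r : dA r = 0 -> gain r - theta p * rho p * Z r =
  (mu p * (1 - theta p) * h r - rho p * theta p) * Z r.
Proof. by move=> e; rewrite /accept_gain /= e; ring. Qed.

Lemma eq_Z_gt0 r : 0 <= r -> 0 < Z r.
Proof. by move=> r0; rewrite /dsurv mulr_gt0 ?(disc_gt0 hp) // (surv_gt0 sigma01 sE). Qed.

Lemma eq_uP_before t : 0 <= t -> t < t0 -> uP p sigma E t%:E <= uP p sigma E t0%:E.
Proof.
move=> t_0 tt; have t0T := t0_lt; have t0p := t0_gt0.
rewrite -subr_ge0 eq_uPB ?(ltW tt) // subr_ge0 ltW //.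
apply: prim_lt => //; first exact: locint_eq_uPB.
move=> r tr rt; rewrite eq_gain_unf; last by rewrite /hdens leNgt rt.
apply: mulr_gt0; last by apply: eq_Z_gt0; lra.
by apply: (gainP_gt0 hp htauP); lra.
Qed.

Lemma eq_uP_const t : t0 <= t -> t <= T -> uP p sigma E t%:E = uP p sigma E t0%:E.
Proof.
move=> tt tT; apply/eqP; rewrite -subr_eq0 eq_uPB //.
rewrite (@eq_primBo _ _ (fun=> 0) t0 t) //.
- by rewrite !prim_cst ?(le_trans t00) // !mul0r subrr.
- exact: locint_eq_uPB.
- exact: locint_cst.
move=> r tr rt; have rT := lt_le_trans rt tT.
rewrite /accept_gain /= /hdens (ltW tr) rT /= -surv_fake ?(ltW tr) ?(ltW rT) //.
rewrite /dsurv /fake_rate; field.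
by have [rp b0 bm mt t1] := params hp; rewrite !gt_eqF // subr_gt0.
Qed.

(** Her payoff rises until [t0], is flat up to [tauP] and falls afterwards. *)
Lemma eq_uP_le t : 0 <= t -> uP p sigma E t%:E <= uP p sigma E t0%:E.
Proof.
move=> t_0; have [tt|tt] := ltP t t0; first exact: eq_uP_before.
have [tT|Tt] := leP t T; first by rewrite eq_uP_const.
rewrite -(eq_uP_const (ltW t0_lt) (lexx T)) -subr_le0 eq_uPB ?(ltW T0) ?(ltW Tt) //.
rewrite subr_le0 -lerN2 -!primN; try exact: locint_eq_uPB.
apply: ltW; apply: prim_lt => //; [exact: locintN locint_eq_uPB|exact: ltW|].
move=> r Tr _; rewrite eq_gain_unf; last by rewrite /hdens [r < T]ltNge (ltW Tr) andbF.
rewrite oppr_gt0 nmulr_rlt0 ?eq_Z_gt0 //; first exact: ltW (lt_trans T0 Tr).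
exact: (gainP_lt0 hp htauP).
Qed.

Lemma eq_PICt (t t' : \bar R) : (0 <= t)%E -> (0 <= t')%E ->
  charged (stop E) t -> uP p sigma E t' <= uP p sigma E t.
Proof.
move=> t_0 t'0 ch.
have na r : 0 <= r -> 0 < atom (fake E) r -> accept E r = 0 by rewrite /= ltxx.
have -> : uP p sigma E t = uP p sigma E t0%:E.
  case: t t_0 ch => [r| |//] r0.
    case => /=.
      rewrite /hdens; case: ifPn; last by rewrite ltxx.
      by move=> /andP[tr rT] _; rewrite eq_uP_const // ltW.
    case: ifPn; last by rewrite ltxx.
    by move=> /eqP -> _; rewrite eq_uP_const // ltW.
  rewrite /= /mass_infty -/(tmass _) (@tmass_flat _ _ T) ?FB_T ?subrr ?ltxx //.
  by move=> r Tr _; exact: stop_after.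
case: t' t'0 => [r| |//]; first by rewrite lee_fin; exact: eq_uP_le.
move=> _; apply: (uP_oo_le hp sigma01 sE na (T := 0)) => r; exact: eq_uP_le.
Qed.

Lemma eq_equilibrium : equilibrium p sigma E.
Proof.
split.
- exact: eq_strats.
- exact: eq_AIC.
- by move=> t t_0; split => // lt; have := eq_mu1 t_0; rewrite leNgt lt.
- exact: eq_PICt.
Qed.

Lemma eq_stop0 : cdfT (stop E) 0 = 0.
Proof. by rewrite /= FB_E ?prim0. Qed.

End Construction.

(** * Comparison with delegation *)

Section Comparison.
Local Open Scope classical_set_scope.
Context {R : realType}.
Variable p : primitives R.
Hypothesis hp : standing p.
Variable tauP : R.
Hypothesis htauP : is_tauP p tauP.
Implicit Types (r s t sigma : R).
Local Notation T := tauP.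
Local Notation LA := (prim (fake_rate p)).

(* Principal's payoff when faking starts at [t]. *)
Definition search_value t := theta p +
  prim (fun r => disc p r * (mu p * (1 - theta p) * hazard p r - rho p * theta p)) t.

Lemma locint_search_value :
  locint (fun r => disc p r * (mu p * (1 - theta p) * hazard p r - rho p * theta p)).
Proof.
have [m b] := affine_hazard hp (mu p * (1 - theta p)) (rho p * theta p) 1.
have l := locint_discM hp m (bounded_locbnd b).
by apply: (locint_eq l) => r _; rewrite divr1.
Qed.

Lemma search_value_lt s t : 0 <= s -> s < t -> t <= T -> search_value s < search_value t.
Proof.
move=> s0 st tT; rewrite ltrD2l; apply: prim_lt => //; first exact: locint_search_value.
move=> r sr rt; apply: mulr_gt0; first exact: disc_gt0.
by apply: (gainP_gt0 hp htauP); lra.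
Qed.

Lemma search_value0 : search_value 0 = theta p.
Proof. by rewrite /search_value prim0 addr0. Qed.

Lemma fake_rate_prim_lt s t : 0 <= s -> s < t -> t <= T -> LA s < LA t.
Proof.
move=> s0 st tT; apply: prim_lt => //; first exact: locint_fake_rate.
move=> r sr rt; have [rp b0 bm mt t1] := params hp.
rewrite /fake_rate divr_gt0 //; last lra.
by apply: (gainP_gt0 hp htauP); lra.
Qed.

Lemma fake_rate_prim_ge0 t : 0 <= t -> t <= T -> 0 <= LA t.
Proof.
rewrite le_eqVlt => /predU1P[<-|t0] tT; first by rewrite prim0.
by rewrite -[leLHS](prim0 (fake_rate p)) ltW // fake_rate_prim_lt.
Qed.

Lemma fake_rate_prim_inj s t : 0 <= s -> s <= T -> 0 <= t -> t <= T -> LA s = LA t -> s = t.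
Proof.
move=> s0 sT t0 tT e; have [st|ts|//] := ltgtP s t.
- by have := fake_rate_prim_lt s0 st tT; rewrite e ltxx.
- by have := fake_rate_prim_lt t0 ts sT; rewrite e ltxx.
Qed.

Lemma sigma_barE : sigma_bar p tauP = 1 - expR (- LA T).
Proof. by []. Qed.

Lemma payoff_shape sigma E : 0 < sigma < 1 -> equilibrium p sigma E ->
  payoffP p sigma E = theta p \/
  exists t0, [/\ [/\ 0 <= t0, t0 <= T, 1 - sigma = expR (- (LA T - LA t0)) &
      payoffP p sigma E = search_value t0],
      forall r, 0 <= r -> accept E r = 1,
      [/\ forall r, 0 <= r -> r <= t0 -> cdfT (fake E) r = 0,
       forall r, t0 <= r -> r <= T ->
         1 - sigma * cdfT (fake E) r = expR (- (LA r - LA t0)) &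
       forall r, T <= r -> cdfT (fake E) r = 1] &
      [/\ forall r, 0 <= r -> r < t0 -> cdfT (stop E) r = 0,
       forall r, 0 < t0 -> t0 <= r -> r < T ->
         1 - cdfT (stop E) r = expR (- (prim (stop_rate p) r - prim (stop_rate p) t0)) &
       forall r, T <= r -> cdfT (stop E) r = 1]].
Proof.
move=> s01 eqE; have sl := stop_law (eq_strategies eqE).
have [F0|F0] := ltP (cdfT (stop E) 0) 1; last first.
  left; apply: (payoff_immediate hp htauP s01 eqE).
  by apply/eqP; rewrite eq_le (cdfT_le1 sl).
right; have [V [V1 V2 ->]] := max_uP hp htauP s01 eqE.
have [M [M1 M2]] := max_uA eqE.
exact: (equilibrium_shape hp htauP s01 eqE V1 V2 M1 M2 F0).
Qed.

(** Even faking from time 0 on at [fake_rate] exhausts only the mass [sigma_bar] by [tauP], which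
    leaves immediate stopping. *)
Lemma payoff_high_sigma sigma E : 0 < sigma < 1 -> sigma_bar p T < sigma ->
  equilibrium p sigma E -> payoffP p sigma E = theta p.
Proof.
move=> s01 hs eqE; have [//|[t0 [[t00 t0T se _] _ _ _]]] := payoff_shape s01 eqE.
have := fake_rate_prim_ge0 t00 t0T => L0.
have : expR (- LA T) <= 1 - sigma by rewrite se ler_expR; lra.
move: hs; rewrite sigma_barE; lra.
Qed.

Section LowSigma.
Variables (sigma : R) (b : R).
Hypotheses (b0 : 0 < b) (bT : b < T).
(** The left-hand side is the value of [sigma] for which faking starts exactly at [b]; a larger one
    needs an earlier start. *)
Hypothesis sigma_lo : 1 - expR (- (LA T - LA b)) < sigma.
Hypothesis sigma_hi : sigma < sigma_bar p T.

Lemma low_sigma01 : 0 < sigma < 1.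
Proof.
have := fake_rate_prim_lt (ltW b0) bT (lexx T) => L; have := sigma_lo; have := sigma_hi.
rewrite sigma_barE => h1 h2.
have e1 : expR (- (LA T - LA b)) <= 1 by rewrite -expR0 ler_expR; lra.
have e2 := expR_gt0 (- LA T); apply/andP; split; lra.
Qed.

Lemma fake_start_bounds t0 : 0 <= t0 -> t0 <= T ->
  1 - sigma = expR (- (LA T - LA t0)) -> 0 < t0 /\ t0 < b.
Proof.
move=> t00 t0T se; have h1 := sigma_lo; have h2 := sigma_hi; split.
  rewrite lt_neqAle t00 andbT; apply/eqP => e; move: h2 se.
  rewrite sigma_barE -e prim0 subr0; lra.
rewrite ltNge; apply/negP => bt.
have le : LA b <= LA t0.
  move: bt; rewrite le_eqVlt => /predU1P[->//|bt].
  by apply: ltW; apply: fake_rate_prim_lt => //; exact: ltW.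
have le2 : expR (- (LA T - LA b)) <= 1 - sigma.
  by rewrite se ler_expR lerN2 lerD2l lerN2.
by move: h1; rewrite ltNge => /negP; apply; rewrite lerBrDr addrC -lerBrDr.
Qed.

Lemma fake_start_exists : exists t0, [/\ 0 < t0, t0 < T &
  1 - sigma = expR (- (LA T - LA t0))].
Proof.
have /andP[s0 s1] := low_sigma01.
have ls : 0 < 1 - sigma by lra.
(* The equation for the start, solved for [LA t0]; [sigma < sigma_bar] makes this level nonnegative,
   as the intermediate value theorem requires. *)
pose v := LA T + ln (1 - sigma).
have v1 : v <= LA T by rewrite gerDl ln_le0 //; lra.
have v0 : 0 <= v.
  have := sigma_hi; rewrite sigma_barE => h2.
  have : expR (- LA T) <= 1 - sigma by lra.
  rewrite -[leRHS]lnK ?posrE // ler_expR /v; lra.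
have c : {within `[0, T], continuous LA}.
  apply: continuous_subspaceT; apply: prim_continuous; exact: locint_fake_rate.
have Tp := tauP_gt0 htauP.
have L0T := fake_rate_prim_ge0 (ltW Tp) (lexx T).
have [|t0 + e] := @IVT _ LA 0 T v (ltW Tp) c.
  by rewrite prim0 min_l ?max_r // v0.
rewrite in_itv /= => /andP[t00 t0T].
have se : 1 - sigma = expR (- (LA T - LA t0)).
  rewrite e /v (_ : - (LA T - (LA T + ln (1 - sigma))) = ln (1 - sigma)); last ring.
  by rewrite lnK ?posrE.
have [t0p t0b] := fake_start_bounds t00 t0T se.
by exists t0; split => //; exact: lt_trans bT.
Qed.

Lemma payoff_low_sigma E : equilibrium p sigma E -> payoffP p sigma E < search_value b.
Proof.
move=> eqE; have [->|[t0 [[t00 t0T se ->] _ _ _]]] := payoff_shape low_sigma01 eqE.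
  by rewrite -search_value0 search_value_lt // ltW.
have [_ t0b] := fake_start_bounds t00 t0T se.
by rewrite search_value_lt // ltW.
Qed.

(** The payoff of the constructed profile is not computed: as it does not stop at time 0,
    [equilibrium_shape] identifies its payoff as the search value at some start, which
    [fake_start_bounds] shows to be positive. *)
Lemma beneficial_exists : exists2 E, equilibrium p sigma E & beneficial p sigma E.
Proof.
have [t0 [t00 t0T se]] := fake_start_exists.
have eqE := eq_equilibrium hp htauP low_sigma01 t00 t0T se.
exists (eq_profile p T sigma t0) => //.
have [V [V1 V2 VE]] := max_uP hp htauP low_sigma01 eqE.
have [M [M1 M2]] := max_uA eqE.
have F0 : cdfT (stop (eq_profile p T sigma t0)) 0 < 1.
  by rewrite eq_stop0 // ltr01.
have [t1 [[t10 t1T se1 V_E] _ _ _]] := equilibrium_shape hp htauP low_sigma01 eqE V1 V2 M1 M2 F0.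
have [t1p _] := fake_start_bounds t10 t1T se1.
rewrite /beneficial VE V_E -/(search_value t1) -search_value0.
exact: search_value_lt.
Qed.

(** Benefit rules out immediate stopping. Both profiles then have starts solving the same equation
    in [sigma]; the accumulated faking rate is injective on [0, tauP], so the starts agree, and they
    determine both laws. *)
Lemma beneficial_unique E E' : equilibrium p sigma E -> beneficial p sigma E ->
  equilibrium p sigma E' -> beneficial p sigma E' -> same_profile E E'.
Proof.
move=> eqE bE eqE' bE' t t_0; have s01 := low_sigma01; have /andP[s0 _] := s01.
have [e|[u [[u0 uT su _] aE [A1 A2 A3] [B1 B2 B3]]]] := payoff_shape s01 eqE.
  by move: bE; rewrite /beneficial e ltxx.
have [e|[u' [[u0' uT' su' _] aE' [A1' A2' A3'] [B1' B2' B3']]]] := payoff_shape s01 eqE'.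
  by move: bE'; rewrite /beneficial e ltxx.
have uu : u = u'.
  apply: fake_rate_prim_inj => //.
  have : expR (- (LA T - LA u)) = expR (- (LA T - LA u')) by rewrite -su -su'.
  by move/expR_inj/oppr_inj/addrI/oppr_inj.
rewrite -uu {u' u0' uT' su' uu} in A1' A2' B1' B2'.
have [up _] := fake_start_bounds u0 uT su.
split; first by rewrite aE ?aE'.
- have [tT|Tt] := ltP t T; last by rewrite B3 ?B3'.
  have [tu|ut] := ltP t u; first by rewrite B1 ?B1'.
  have := B2 t up ut tT; rewrite -(B2' t up ut tT); lra.
- have [tT|Tt] := leP t T; last by rewrite A3 ?A3' // ltW.
  have [tu|ut] := leP t u; first by rewrite A1 ?A1'.
  have := A2 t (ltW ut) tT; rewrite -(A2' t (ltW ut) tT) => e.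
  by apply: (mulfI (lt0r_neq0 s0)); lra.
Qed.

End LowSigma.

Lemma search_value_small c : theta p < c -> exists2 b, 0 < b < T & search_value b < c.
Proof.
move=> tc; have e0 : 0 < c - theta p by rewrite subr_gt0.
have [d d0 Hd] := continuous_near 0 (prim_continuous locint_search_value) e0.
have Tp := tauP_gt0 htauP.
pose b := Num.min (d / 2) (T / 2).
have b0 : 0 < b by rewrite lt_min !divr_gt0.
have bd : b <= d / 2 by rewrite ge_min lexx.
have bT : b <= T / 2 by rewrite ge_min lexx orbT.
exists b; first by rewrite b0 /=; lra.
have := Hd b; rewrite sub0r normrN gtr0_norm // prim0 sub0r normrN => H.
have {}H := le_lt_trans (ler_norm _) (H _).
by rewrite /search_value addrC -ltrBrDr H //; lra.
Qed.

End Comparison.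

Unset Implicit Arguments.

(** [hneq] removes the tie [uPD p tauA = theta p], which [mild] admits: above [sigma_bar] every
    equilibrium pays exactly [theta p], so a strict comparison would fail there. *)
Theorem proposition5 (R : realType) (p : primitives R) (tauP tauA : R)
    (hp : standing p) (htauP : is_tauP p tauP) (htauA : is_tauA p tauP tauA)
    (hmild : mild p tauA) (hneq : uPD p tauA <> theta p) :
  (forall sigma : R, 0 < sigma < 1 -> sigma_bar p tauP < sigma ->
     forall E : profile R, equilibrium p sigma E ->
       payoffP p sigma E < uPD p tauA)
  /\
  (exists sigmaD : R, 0 < sigmaD < sigma_bar p tauP /\
     forall sigma : R, sigmaD < sigma < sigma_bar p tauP ->
       (exists E : profile R,
          [/\ equilibrium p sigma E, beneficial p sigma E &
              forall E' : profile R, equilibrium p sigma E' ->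
                beneficial p sigma E' -> same_profile E E'])
       /\
       (forall E : profile R, equilibrium p sigma E ->
          payoffP p sigma E < uPD p tauA)).
Proof.
have uD : theta p < uPD p tauA.
  move: hmild; rewrite /mild /severe -leNgt le_eqVlt => /predU1P[e|//].
  by case: hneq.
split=> [sigma s01 hs E eqE|].
  by rewrite (payoff_high_sigma hp htauP s01 hs eqE).
have [b /andP[b0 bT] vb] := search_value_small hp htauP uD.
have L1 := fake_rate_prim_lt hp htauP (ltW b0) bT (lexx tauP).
have L2 := fake_rate_prim_lt hp htauP (lexx 0) b0 (ltW bT); rewrite prim0 in L2.
(* The threshold is the [sigma] for which faking starts at [b], where [b] was chosen so early that
   fake-free search until [b] is worth less than delegation. It is positive because [b < tauP], and
   below [sigma_bar] because [0 < b]. *)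
exists (1 - expR (- (prim (fake_rate p) tauP - prim (fake_rate p) b))); split.
  rewrite sigma_barE; apply/andP; split.
    by rewrite subr_gt0 -expR0 ltr_expR; lra.
  by rewrite ltrD2l ltrN2 ltr_expR; lra.
move=> sigma /andP[lo hi]; split; last first.
  by move=> E eqE; apply: lt_trans vb; exact: (payoff_low_sigma hp htauP b0 bT lo hi eqE).
have [E eqE bE] := beneficial_exists hp htauP b0 bT lo hi.
exists E; split=> // E' eqE' bE'.
exact: (beneficial_unique hp htauP b0 bT lo hi eqE bE eqE' bE').
Qed.
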